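(* Suppose the model assumptions (i)–(vi) of the context hold and $R_1BR_2=\theta$. Then, as $n\to\infty$, $$\begin{pmatrix} n^{1/2}(\hat B_1-B)\\ n^{1/2}(\hat B_2-B)\\ n^{1/2}(\hat B_3-B)\\ n^{1/2}(\hat B_4-B)\end{pmatrix}\xrightarrow{d}\begin{pmatrix}\eta_1\\ \zeta_2\\ \zeta_3\\ \zeta_4\end{pmatrix}\sim\mathcal N_{4p\times q}\left(\begin{pmatrix}0\\ 0\\ 0\\ 0\end{pmatrix},\begin{pmatrix}\Sigma_{11}&\Sigma_{12}&\Sigma_{13}&\Sigma_{14}\\ \Sigma_{21}&\Sigma_{22}&\Sigma_{23}&\Sigma_{24}\\ \Sigma_{31}&\Sigma_{32}&\Sigma_{33}&\Sigma_{34}\\ \Sigma_{41}&\Sigma_{42}&\Sigma_{43}&\Sigma_{44}\end{pmatrix}\right),$$ where $\Sigma_{ij}=A_i\Lambda A_j'$ for $i,j=1,2,3,4$, with $P_2=R_2(R_2'R_2)^{-1}R_2'$ and $$A_1=(\Sigma K)^{-1}\otimes I_q,$$ $$A_2=A_1-\Big((\Sigma K)^{-1}R_1'(R_1(\Sigma K)^{-1}R_1')^{-1}R_1(\Sigma K)^{-1}\Big)\otimes P_2,$$ $$A_3=A_1-\Big(\Sigma^{-1}R_1'(R_1\Sigma^{-1}R_1')^{-1}R_1(\Sigma K)^{-1}\Big)\otimes P_2,$$ $$A_4=A_1-\Big(R_1'(R_1R_1')^{-1}R_1(\Sigma K)^{-1}\Big)\otimes P_2.$$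
   Context: Conventions: $'$ is transpose, $\otimes$ the Kronecker product, $I_m$ the identity matrix. For a matrix $A$, $\operatorname{vec}(A)$ denotes the column vector obtained by stacking the rows of $A$ (so $\operatorname{vec}(AYC)=(A\otimes C')\operatorname{vec}(Y)$). A random $a\times b$ matrix $Y$ is $\mathcal N_{a\times b}(\mu,\Omega)$ if $\operatorname{vec}(Y)$ is (possibly degenerate) $ab$-variate normal with mean $\operatorname{vec}(\mu)$ and covariance matrix $\Omega$. Model: for each sample size $n$, $Z=DB+E$, $X=D+\Delta$, $D=M+\Psi$, where $Z,E$ are $n\times q$, $D,X,\Delta,M,\Psi$ are $n\times p$, $B$ is the $p\times q$ matrix of regression coefficients, $M$ is nonrandom, and $E=(\epsilon_{ij})$, $\Delta=(\delta_{ij})$, $\Psi=(\psi_{ij})$ are random; $Z,X$ are observed. As $n$ grows, rows are appended. $R_1$ ($r_1\times p$), $R_2$ ($q\times r_2$), $\theta$ ($r_1\times r_2$) are known matrices. Assumptions: (i) the $\epsilon_{ij}$ are independent with mean $0$, variance $\sigma_\epsilon^2$, third moment $\gamma_{1\epsilon}\sigma_\epsilon^3$, fourth moment $(\gamma_{2\epsilon}+3)\sigma_\epsilon^4$; (ii) the $\delta_{ij}$ are i.i.d. with mean $0$, variance $\sigma_\delta^2$, third moment $\gamma_{1\delta}\sigma_\delta^3$, fourth moment $(\gamma_{2\delta}+3)\sigma_\delta^4$; (iii) the $\psi_{ij}$ are i.i.d. with mean $0$, variance $\sigma_\psi^2$, third moment $\gamma_{1\psi}\sigma_\psi^3$, fourth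 moment $(\gamma_{2\psi}+3)\sigma_\psi^4$; (iv) $\Delta,\Psi,E$ are mutually independent; (v) the $n$-th row of $M$, written as a column vector $M_{(n)}\in\mathbb R^p$, converges to a finite vector $\sigma_M\in\mathbb R^p$ as $n\to\infty$; (vi) $\operatorname{rank}X=p$, $\operatorname{rank}R_1=r_1$, $\operatorname{rank}R_2=r_2$. All inverses written are assumed to exist. Notation: $\Sigma_X=n^{-1}M'M+\sigma_\psi^2I_p+\sigma_\delta^2I_p$, $\Sigma_D=n^{-1}M'M+\sigma_\psi^2I_p$, $K_X=\Sigma_X^{-1}\Sigma_D$, $\Sigma=\sigma_M\sigma_M'+\sigma_\psi^2I_p+\sigma_\delta^2I_p$, $K=\Sigma^{-1}(\Sigma-\sigma_\delta^2I_p)$. Further $\bar K_X=(\Sigma_X-\Sigma_D)\Sigma_X^{-1}$, $H=n^{-1/2}X'X-n^{1/2}\Sigma_X$, $h=n^{-1/2}X'(E-\Delta B)+n^{1/2}\sigma_\delta^2B$, and $\Lambda=\lim_{n\to\infty}\mathrm E[u_nu_n']$ (a $pq\times pq$ matrix; the limit exists), where $u_n\in\mathbb R^{pq}$ is obtained by stacking the columns of the $q\times p$ matrix $h'+B'\bar K_XH$. Estimators: $\hat B_1=K_X^{-1}(X'X)^{-1}X'Z$ (unrestricted), and the restricted estimators $$\hat B_2=\hat B_1-(X'XK_X)^{-1}R_1'[R_1(X'XK_X)^{-1}R_1']^{-1}(R_1\hat B_1R_2-\theta)(R_2'R_2)^{-1}R_2',$$ $$\hat B_3=\hat B_1-(X'X)^{-1}R_1'[R_1(X'X)^{-1}R_1']^{-1}(R_1\hat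 B_1R_2-\theta)(R_2'R_2)^{-1}R_2',$$ $$\hat B_4=\hat B_1-R_1'(R_1R_1')^{-1}(R_1\hat B_1R_2-\theta)(R_2'R_2)^{-1}R_2'.$$ *)

(* Defs.v *)
From HB Require Import structures.
From mathcomp Require Import all_boot all_order all_algebra.
From mathcomp Require Import all_classical all_reals all_analysis.
From mathcomp Require Import finmap mxtens.

Set Implicit Arguments.
Unset Strict Implicit.
Unset Printing Implicit Defensive.

Import Order.TTheory GRing.Theory Num.Theory.
Import numFieldNormedType.Exports.

Local Open Scope classical_set_scope.
Local Open Scope ring_scope.

(* Stacks the rows: [mxvec] enumerates the entries in row-major order. *)
Definition vec (R : Type) (a b : nat) (A : 'M[R]_(a, b)) : 'cV[R]_(a * b) :=
  (mxvec A)^T.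

Section Probability.
Context {d : measure_display} {T : measurableType d} {R : realType}.
Variable P : probability T R.

Definition mutually_independent (I : choiceType) (F : I -> set (set T)) :=
  forall (J : {fset I}) (A : I -> set T),
    (forall i, i \in J -> F i (A i)) ->
    P (\bigcap_(i in [set` J]) A i) = (\prod_(i <- J) P (A i))%E.

Definition sigma_rv (X : T -> R) : set (set T) :=
  preimage_set_system setT X measurable.

Definition sigma_mx (a b : nat) (Y : T -> 'M[R]_(a, b)) : set (set T) :=
  <<s \bigcup_(ij in [set: 'I_a * 'I_b]) sigma_rv (fun w => Y w ij.1 ij.2) >>.

Definition random_mx (a b : nat) (Y : T -> 'M[R]_(a, b)) :=
  forall i j, measurable_fun setT (fun w => Y w i j).

(* The point mass is treated apart because the library's [normal_prob m 0] is
   the uniform law on [0, 1]. *)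
Definition univariate_normal (X : T -> R) :=
  measurable_fun setT X /\
  ((exists m : R, forall A, measurable A -> P (X @^-1` A) = \d_m A) \/
   (exists m s : R, 0 < s /\
      forall A, measurable A -> P (X @^-1` A) = normal_prob m s A)).

Definition multivariate_normal (k : nat) (V : T -> 'cV[R]_k)
    (mu : 'cV[R]_k) (Omega : 'M[R]_k) :=
  [/\ random_mx V,
      forall c : 'rV[R]_k, univariate_normal (fun w => (c *m V w) 0 0),
      forall i, ('E_P[fun w => (V w i 0)%R])%E = (mu i 0)%:E
    & forall i j,
        covariance P (fun w => V w i 0) (fun w => V w j 0) = (Omega i j)%:E].

Definition matrix_normal (a b : nat) (Y : T -> 'M[R]_(a, b))
    (mu : 'M[R]_(a, b)) (Omega : 'M[R]_(a * b)) :=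
  multivariate_normal (fun w => vec (Y w)) (vec mu) Omega.

End Probability.

Definition converges_in_distribution {R : realType}
    {d : measure_display} {T : measurableType d} (P : probability T R)
    {d' : measure_display} {T' : measurableType d'} (P' : probability T' R)
    (a b : nat) (Y : nat -> T -> 'M[R]_(a, b)) (Y' : T' -> 'M[R]_(a, b)) :=
  [/\ forall n, random_mx (Y n), random_mx Y'
    & forall f : 'M[R]_(a, b) -> R,
        continuous f -> (exists C : R, forall y, `|f y| <= C) ->
        ('E_P[fun w => f (Y n w)])%E @[n --> \oo]
          --> ('E_P'[fun w => f (Y' w)])%E].

(* Infinite arrays whose first n rows form the data of the sample of size n.
   The scale parameters are only used through the moment formulas, so no sign
   is prescribed. *)
Record eiv_model (d : measure_display) (T : measurableType d) (R : realType)
    (P : probability T R) (p q : nat) := EIVModel {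
  regB : 'M[R]_(p, q);
  rowM : nat -> 'cV[R]_p;
  sigmaM : 'cV[R]_p;
  eps : nat -> 'I_q -> {RV P >-> R};
  del : nat -> 'I_p -> {RV P >-> R};
  psi : nat -> 'I_p -> {RV P >-> R};
  sig_eps : R; gam1_eps : R; gam2_eps : R;
  sig_del : R; gam1_del : R; gam2_del : R;
  sig_psi : R; gam1_psi : R; gam2_psi : R }.

Section Model.
Context {d : measure_display} {T : measurableType d} {R : realType}.
Context {P : probability T R} {p q : nat}.
Variable m : eiv_model P p q.

Local Notation B := (regB m).

Section Sample.
Variable n : nat.

Definition smpM : 'M[R]_(n, p) := \matrix_(i, j) rowM m i j 0.
Definition smpE (w : T) : 'M[R]_(n, q) := \matrix_(i, j) eps m i j w.
Definition smpDelta (w : T) : 'M[R]_(n, p) := \matrix_(i, j) del m i j w.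
Definition smpPsi (w : T) : 'M[R]_(n, p) := \matrix_(i, j) psi m i j w.

Definition smpD (w : T) : 'M[R]_(n, p) := smpM + smpPsi w.
Definition smpX (w : T) : 'M[R]_(n, p) := smpD w + smpDelta w.
Definition smpZ (w : T) : 'M[R]_(n, q) := smpD w *m B + smpE w.

Definition gramX (w : T) : 'M[R]_p := (smpX w)^T *m smpX w.

Definition SigmaX : 'M[R]_p :=
  n%:R^-1 *: (smpM^T *m smpM) + (sig_psi m ^+ 2)%:M + (sig_del m ^+ 2)%:M.
Definition SigmaD : 'M[R]_p :=
  n%:R^-1 *: (smpM^T *m smpM) + (sig_psi m ^+ 2)%:M.
Definition KX : 'M[R]_p := invmx SigmaX *m SigmaD.
Definition KXbar : 'M[R]_p := (SigmaX - SigmaD) *m invmx SigmaX.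

Definition rootn : R := Num.sqrt n%:R.

Definition devH (w : T) : 'M[R]_p := rootn^-1 *: gramX w - rootn *: SigmaX.
Definition devh (w : T) : 'M[R]_(p, q) :=
  rootn^-1 *: ((smpX w)^T *m (smpE w - smpDelta w *m B))
  + rootn *: (sig_del m ^+ 2 *: B).

(* Stacking the columns of a matrix is stacking the rows of its transpose. *)
Definition vecu (w : T) : 'cV[R]_(p * q) :=
  vec ((devh w)^T + B^T *m KXbar *m devH w)^T.

Definition Bhat1 (w : T) : 'M[R]_(p, q) :=
  invmx KX *m invmx (gramX w) *m (smpX w)^T *m smpZ w.

Section Restricted.
Variables (r1 r2 : nat).
Variables (R1 : 'M[R]_(r1, p)) (R2 : 'M[R]_(q, r2)) (theta : 'M[R]_(r1, r2)).

Definition Bhat2 (w : T) : 'M[R]_(p, q) :=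
  Bhat1 w - invmx (gramX w *m KX) *m R1^T
              *m invmx (R1 *m invmx (gramX w *m KX) *m R1^T)
              *m (R1 *m Bhat1 w *m R2 - theta) *m invmx (R2^T *m R2) *m R2^T.
Definition Bhat3 (w : T) : 'M[R]_(p, q) :=
  Bhat1 w - invmx (gramX w) *m R1^T
              *m invmx (R1 *m invmx (gramX w) *m R1^T)
              *m (R1 *m Bhat1 w *m R2 - theta) *m invmx (R2^T *m R2) *m R2^T.
Definition Bhat4 (w : T) : 'M[R]_(p, q) :=
  Bhat1 w - R1^T *m invmx (R1 *m R1^T)
              *m (R1 *m Bhat1 w *m R2 - theta) *m invmx (R2^T *m R2) *m R2^T.

Definition Bhat (i : 'I_4) (w : T) : 'M[R]_(p, q) :=
  tnth [tuple Bhat1 w; Bhat2 w; Bhat3 w; Bhat4 w] i.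

Definition stacked_errors (w : T) : 'M[R]_(\sum_(i < 4) p, q) :=
  \mxcol_(i < 4) (rootn *: (Bhat i w - B)).

End Restricted.
End Sample.

Definition Sigmalim : 'M[R]_p :=
  sigmaM m *m (sigmaM m)^T + (sig_psi m ^+ 2)%:M + (sig_del m ^+ 2)%:M.
Definition Klim : 'M[R]_p := invmx Sigmalim *m (Sigmalim - (sig_del m ^+ 2)%:M).

Definition Lambda : 'M[R]_(p * q) :=
  \matrix_(k, l) lim (fine ('E_P[fun w => (vecu n w k 0 * vecu n w l 0)%R])%E
                      @[n --> \oo]).

Section Limit.
Variables (r1 r2 : nat) (R1 : 'M[R]_(r1, p)) (R2 : 'M[R]_(q, r2)).

Local Notation SK := (Sigmalim *m Klim).

Definition P2 : 'M[R]_q := R2 *m invmx (R2^T *m R2) *m R2^T.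

Definition A1 : 'M[R]_(p * q) := invmx SK *t (1%:M : 'M[R]_q).
Definition A2 : 'M[R]_(p * q) :=
  A1 - (invmx SK *m R1^T *m invmx (R1 *m invmx SK *m R1^T)
          *m R1 *m invmx SK) *t P2.
Definition A3 : 'M[R]_(p * q) :=
  A1 - (invmx Sigmalim *m R1^T *m invmx (R1 *m invmx Sigmalim *m R1^T)
          *m R1 *m invmx SK) *t P2.
Definition A4 : 'M[R]_(p * q) :=
  A1 - (R1^T *m invmx (R1 *m R1^T) *m R1 *m invmx SK) *t P2.

Definition Ablk (i : 'I_4) : 'M[R]_(p * q) := tnth [tuple A1; A2; A3; A4] i.

Lemma stacked_dim : (\sum_(i < 4) p * q = (\sum_(i < 4) p) * q)%N.
Proof. by rewrite big_distrl. Qed.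

Definition limit_covariance : 'M[R]_((\sum_(i < 4) p) * q) :=
  castmx (stacked_dim, stacked_dim)
    (\mxblock_(i < 4, j < 4) (Ablk i *m Lambda *m (Ablk j)^T)).

End Limit.

Definition moments (X : {RV P >-> R}) (s g1 g2 : R) :=
  [/\ ('E_P[X])%E = 0%E,
      ('V_P[X])%E = (s ^+ 2)%:E,
      ('E_P[fun w => (X w ^+ 3)%R])%E = (g1 * s ^+ 3)%:E
    & ('E_P[fun w => (X w ^+ 4)%R])%E = ((g2 + 3) * s ^+ 4)%:E].

Definition independent_array (k : nat) (X : nat -> 'I_k -> {RV P >-> R}) :=
  mutually_independent P (fun ij : nat * 'I_k => sigma_rv (X ij.1 ij.2)).

Definition identically_distributed (k : nat)
    (X : nat -> 'I_k -> {RV P >-> R}) :=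
  forall i j i' j' A, measurable A ->
    distribution P (X i j) A = distribution P (X i' j') A.

Record eiv_assumptions : Prop := EIVAssumptions {
  eps_indep : independent_array (eps m);
  eps_moments : forall i j,
    moments (eps m i j) (sig_eps m) (gam1_eps m) (gam2_eps m);
  del_indep : independent_array (del m);
  del_ident : identically_distributed (del m);
  del_moments : forall i j,
    moments (del m i j) (sig_del m) (gam1_del m) (gam2_del m);
  psi_indep : independent_array (psi m);
  psi_ident : identically_distributed (psi m);
  psi_moments : forall i j,
    moments (psi m i j) (sig_psi m) (gam1_psi m) (gam2_psi m);
  arrays_indep : forall n, mutually_independent P
    (tnth [tuple sigma_mx (@smpDelta n); sigma_mx (@smpPsi n);
                 sigma_mx (@smpE n)]);
  rowM_cvg : rowM m n @[n --> \oo] --> sigmaM m }.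

(* Existence of every inverse occurring in the estimators and in the limit;
   for the sample-dependent ones, almost surely for all large n. *)
Record inverses_exist (r1 r2 : nat) (R1 : 'M[R]_(r1, p)) (R2 : 'M[R]_(q, r2))
    : Prop := InversesExist {
  SigmaX_unit : \forall n \near \oo, SigmaX n \in unitmx;
  KX_unit : \forall n \near \oo, KX n \in unitmx;
  gramX_unit : \forall n \near \oo,
    {ae P, forall w, gramX n w \in unitmx};
  R1_gramXKX_unit : \forall n \near \oo,
    {ae P, forall w, R1 *m invmx (gramX n w *m KX n) *m R1^T \in unitmx};
  R1_gramX_unit : \forall n \near \oo,
    {ae P, forall w, R1 *m invmx (gramX n w) *m R1^T \in unitmx};
  R1_unit : R1 *m R1^T \in unitmx;
  R2_unit : R2^T *m R2 \in unitmx;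
  Sigma_unit : Sigmalim \in unitmx;
  SigmaK_unit : Sigmalim *m Klim \in unitmx;
  R1_SigmaK_unit : R1 *m invmx (Sigmalim *m Klim) *m R1^T \in unitmx;
  R1_Sigma_unit : R1 *m invmx Sigmalim *m R1^T \in unitmx }.

End Model.

(* Main.v *)
Require Import Defs.
From HB Require Import structures.
From mathcomp Require Import all_boot all_order all_algebra.
From mathcomp Require Import all_classical all_reals all_analysis.
From mathcomp Require Import finmap mxtens ring lra measurable_realfun.

Set Implicit Arguments.
Unset Strict Implicit.
Unset Printing Implicit Defensive.

Import Order.TTheory GRing.Theory Num.Theory.
Import numFieldNormedType.Exports.

Local Open Scope classical_set_scope.
Local Open Scope ring_scope.

(* Write U for the matrix whose stacked entries form u_n. Since Sigma_X (I - K_X) = sigma_delta^2 I, the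
   first estimator satisfies n^(1/2) (B1 - B) = (X'X K_X / n)^-1 U exactly, and the restriction
   R1 B R2 = theta turns each restricted error into the first one minus an oblique projection of it.
   The coefficients converge in probability, so the four errors together are, up to o_P(1), a fixed linear
   image of U, and U itself is up to o_P(1) n^(-1/2) times a sum of independent centred row contributions.
   Those are combinations, with convergent coefficients, of finitely many monomials of degree one and two
   in the errors of a row, whose mixed second moments do not depend on the row and whose squares are
   uniformly integrable. Hence E cos(b + t.U) tends to its Gaussian value: the summands are replaced one by
   one using second order Taylor bounds, and the moments of a row enter through a Cesaro mean. Finally,
   tightness and the density of trigonometric polynomials on boxes (Bernstein polynomials in the variables
   (1 + sin(w x)) / 2) pass from cosines to bounded continuous functions. The limit exists as a Gaussian
   vector because the limit covariance is a limit of second moments, hence positive semidefinite. *)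

(** * Expectations and independence *)

(** Two obstacles shape the proof. The [eps] need not be identically distributed and share only
    moments up to order four, so their squares need not be uniformly square integrable; this is
    harmless because E enters h linearly and H not at all, and the squares that do occur are those
    of the i.i.d. [psi] and [del]. Moreover [KXbar] varies with the sample size, so u_n is not a
    normalized sum of fixed row terms; it is compared with [umx0], and [Lambda], defined through u_n
    itself, is shown to be the limit of second moments of both. Everything stays real: the free
    phase b in cos(b + x) does the work of the imaginary part and makes linear combinations of
    cosines an algebra. An approximation on a box helps only if it stays bounded outside; Bernstein
    polynomials in variables with values in [0, 1] are averages of values of f, hence keep its bound
    everywhere, and tightness controls the event of leaving the box. The limit may be degenerate, so
    normal laws are indexed by their variance, with a point mass at 0. *)

Section RealExpectation.
Context {d : measure_display} {T : measurableType d} {R : realType}.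
Variable P : probability T R.
Implicit Types f g : T -> R.

(** A real number by [fine], which sends infinite integrals to 0; hence the [L1] hypotheses in the
    rules of linearity and comparison. *)
Definition Ex (f : T -> R) : R := \int[P]_w f w.

Definition L1 (f : T -> R) := P.-integrable setT (EFin \o f).

Lemma L1_measurable f : L1 f -> measurable_fun setT f.
Proof. by move=> /measurable_int/measurable_EFinP. Qed.

Lemma L1_cst c : L1 (fun=> c).
Proof. exact: finite_measure_integrable_cst. Qed.

Lemma L1D f g : L1 f -> L1 g -> L1 (fun w => f w + g w).
Proof. by move=> lf lg; exact: integrableD lf lg. Qed.

Lemma L1Z c f : L1 f -> L1 (fun w => c * f w).
Proof. by move=> lf; exact: integrableZl lf. Qed.

Lemma L1N f : L1 f -> L1 (fun w => - f w).
Proof. by move=> lf; exact: integrableN lf. Qed.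

Lemma L1B f g : L1 f -> L1 g -> L1 (fun w => f w - g w).
Proof. by move=> lf /L1N; exact: L1D. Qed.

Lemma L1_norm f : L1 f -> L1 (fun w => `|f w|).
Proof. by move=> lf; exact: integrable_norm. Qed.

Lemma L1_sum (I : Type) (s : seq I) (f : I -> T -> R) :
  (forall i, L1 (f i)) -> L1 (fun w => \sum_(i <- s) f i w).
Proof.
move=> lf; elim: s => [|i s ih].
  by under eq_fun do rewrite big_nil; exact: L1_cst.
by under eq_fun do rewrite big_cons; exact: L1D.
Qed.

Lemma L1_le f g : measurable_fun setT f -> L1 g ->
  (forall w, `|f w| <= g w) -> L1 f.
Proof.
move=> mf lg fg; apply: le_integrable lg => //; first exact/measurable_EFinP.
by move=> w _ /=; rewrite lee_fin (le_trans (fg w)) // ler_norm.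
Qed.

Lemma L1_bounded f c : measurable_fun setT f -> (forall w, `|f w| <= c) -> L1 f.
Proof. by move=> mf fc; apply: L1_le (L1_cst c) fc. Qed.

Lemma eq_L1 (f g : T -> R) : f =1 g -> L1 f -> L1 g.
Proof. by move=> /funext ->. Qed.

Lemma Ex_cst c : Ex (fun=> c) = c.
Proof. by rewrite /Ex Rintegral_cst// [X in fine X]probability_setT mulr1. Qed.

Lemma ExD f g : L1 f -> L1 g -> Ex (fun w => f w + g w) = Ex f + Ex g.
Proof. by move=> lf lg; rewrite /Ex RintegralD. Qed.

Lemma ExB f g : L1 f -> L1 g -> Ex (fun w => f w - g w) = Ex f - Ex g.
Proof. by move=> lf lg; rewrite /Ex RintegralB. Qed.

Lemma ExZ c f : L1 f -> Ex (fun w => c * f w) = c * Ex f.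
Proof. by move=> lf; rewrite /Ex RintegralZl. Qed.

Lemma Ex_sum (I : Type) (s : seq I) (f : I -> T -> R) :
  (forall i, L1 (f i)) ->
  Ex (fun w => \sum_(i <- s) f i w) = \sum_(i <- s) Ex (f i).
Proof.
move=> lf; elim: s => [|i s ih].
  by under eq_fun do rewrite big_nil; rewrite big_nil Ex_cst.
under eq_fun do rewrite big_cons.
by rewrite ExD//; [rewrite ih big_cons|exact: L1_sum].
Qed.

Lemma Ex_ge0 f : (forall w, 0 <= f w) -> 0 <= Ex f.
Proof. by move=> f0; apply: Rintegral_ge0. Qed.

Lemma le_Ex f g : L1 f -> L1 g -> (forall w, f w <= g w) -> Ex f <= Ex g.
Proof. by move=> lf lg fg; apply: le_Rintegral. Qed.

Lemma Ex_norm_le f g : L1 f -> L1 g -> (forall w, `|f w| <= g w) ->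
  `|Ex f| <= Ex g.
Proof.
move=> lf lg fg; apply: le_trans (_ : Ex (fun w => `|f w|) <= _).
  exact: le_normr_Rintegral.
by apply: le_Ex => //; exact: L1_norm.
Qed.

Lemma expectationE f : L1 f -> ('E_P[f])%E = (Ex f)%:E.
Proof. by move=> lf; rewrite unlock /Ex /Rintegral fineK// integrable_fin_num. Qed.

Lemma fine_expectation f : fine ('E_P[f])%E = Ex f.
Proof. by rewrite unlock. Qed.

(** For a nonnegative function a finite expectation is integrability. The fourth moment assumptions,
    equalities in the extended reals, become [L1] facts this way. *)
Lemma L1_ge0 f c : measurable_fun setT f -> (forall w, 0 <= f w) ->
  ('E_P[f])%E = c%:E -> L1 f /\ Ex f = c.
Proof.
move=> mf f0 Ef; split; last by rewrite -fine_expectation Ef.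
apply/integrableP; split; first exact/measurable_EFinP.
under eq_integral do rewrite /= ger0_norm//.
by move: Ef; rewrite unlock => ->; rewrite ltry.
Qed.

Lemma Ex_indic A : measurable A -> Ex (\1_A) = fine (P A).
Proof. by move=> mA; rewrite -fine_expectation expectation_indic. Qed.

Lemma integrable_sqr_L1 f : measurable_fun setT f -> L1 (fun w => f w ^+ 2) -> L1 f.
Proof.
move=> mf lf; apply: L1_le (L1D (L1_cst 1) lf) _ => // w /=.
rewrite -(real_normK (num_real (f w))); have := sqr_ge0 (`|f w| - 2^-1).
by rewrite sqrrB; lra.
Qed.

Lemma L1M_sqr f g : measurable_fun setT f -> measurable_fun setT g ->
  L1 (fun w => f w ^+ 2) -> L1 (fun w => g w ^+ 2) -> L1 (fun w => f w * g w).
Proof.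
move=> mf mg lf lg; apply: L1_le (L1D lf lg) _ => [|w].
  exact: measurable_funM.
have := sqr_ge0 (f w - g w); have := sqr_ge0 (f w + g w).
by rewrite ler_norml; nra.
Qed.

Lemma Ex_dominated (f_ : nat -> T -> R) (f g : T -> R) :
  (forall n, measurable_fun setT (f_ n)) -> measurable_fun setT f -> L1 g ->
  (forall w, f_ n w @[n --> \oo] --> f w) ->
  (forall n w, `|f_ n w| <= g w) ->
  Ex (f_ n) @[n --> \oo] --> Ex f.
Proof.
move=> mf_ mf lg ff fg.
have := @dominated_convergence _ T R P setT measurableT
  (fun n w => (f_ n w)%:E) (EFin \o f) (EFin \o g).
case.
- by move=> n; exact/measurable_EFinP.
- exact/measurable_EFinP.
- by apply: aeW => w _; apply: cvg_EFin; [exact: nearW|exact: ff].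
- exact: lg.
- by apply: aeW => w n _ /=; rewrite lee_fin.
move=> lf _ cf; apply: fine_cvg.
by rewrite /Ex /Rintegral fineK// integrable_fin_num.
Qed.

End RealExpectation.

Section IndependentPair.
Context {d : measure_display} {T : measurableType d} {R : realType}.
Variable P : probability T R.
Implicit Types f g : T -> R.

Definition indep_rv (f g : T -> R) := forall A B, measurable A -> measurable B ->
  (P (f @^-1` A `&` g @^-1` B) = P (f @^-1` A) * P (g @^-1` B))%E.

(** Independence makes the law of the pair agree with the product of the two laws on rectangles,
    hence everywhere by uniqueness of the product measure; Fubini then splits the integral of xy. *)
Lemma indep_ExM f g : indep_rv f g -> L1 P f -> L1 P g ->
  L1 P (fun w => f w * g w) /\ Ex P (fun w => f w * g w) = Ex P f * Ex P g.
Proof.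
move=> ifg lf lg.
have mf := L1_measurable lf; have mg := L1_measurable lg.
have mfg : measurable_fun setT (fun w => (f w, g w)) by exact/measurable_fun_pair.
pose F : {RV P >-> R} := HB.pack f (isMeasurableFun.Build _ _ _ _ f mf).
pose G : {RV P >-> R} := HB.pack g (isMeasurableFun.Build _ _ _ _ g mg).
pose FG : {mfun T >-> (R * R)%type} := HB.pack (fun w => (f w, g w))
  (isMeasurableFun.Build _ _ _ _ (fun w => (f w, g w)) mfg).
pose mu := (distribution P F \x distribution P G)%E.
have muE X : measurable X -> mu X = pushforward P FG X.
  apply: (product_measure_unique (m' := pushforward P FG)) => A B mA mB.
  by rewrite /pushforward/= -ifg//; congr (P _).
have lF : (distribution P F).-integrable setT (@EFin R).
  by apply: integrable_pushforward => //; exact: EFin_measurable.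
have lG : (distribution P G).-integrable setT (@EFin R).
  by apply: integrable_pushforward => //; exact: EFin_measurable.
have mh : measurable_fun setT (fun z : R * R => (z.1 * z.2)%:E).
  by apply/measurable_EFinP; apply: measurable_funM.
have mabs : measurable_fun setT (EFin \o (fun x : R => `|x|)).
  by apply/measurable_EFinP; exact: normr_measurable.
(* Tonelli for |x||y|: the iterated integral is the product of two finite first absolute moments. *)
have lh : mu.-integrable setT (fun z : R * R => (z.1 * z.2)%:E).
  apply/integrable12ltyP => //=.
  pose b0 : \bar R := (\int[distribution P G]_y `|y|%:E)%E.
  rewrite (eq_integral (fun x : R => `|x|%:E * b0)%E); last first.
    move=> x _; under eq_integral do rewrite normrM EFinM.
    by rewrite ge0_integralZl//; exact: mabs.
  move/integrableP : lG => [_ /=]; move/integrableP : lF => [_ /=].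
  set a := integral _ _ _ => aoo; set b := integral _ _ _ => boo.
  have afin : a \is a fin_num.
    by rewrite ge0_fin_numE//; apply: integral_ge0.
  have bfin : b \is a fin_num.
    by rewrite ge0_fin_numE//; apply: integral_ge0.
  rewrite ge0_integralZr//; last exact: integral_ge0.
  rewrite -/a (_ : b0 = b)// ltey_eq.
  by have -> : (a * b)%E \is a fin_num by exact: fin_numM.
have lFG : L1 P (fun w => f w * g w).
  rewrite /L1.
  have : (pushforward P FG).-integrable setT (fun z : R * R => (z.1 * z.2)%:E).
    move/integrableP : lh => [? h]; apply/integrableP; split => //.
    apply: le_lt_trans h; rewrite le_eqVlt; apply/orP; left; apply/eqP.
    by apply: eq_measure_integral => A mA _; exact/esym/muE.
  move=> /integrableP[_ h]; apply/integrableP; split.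
    by apply/measurable_EFinP; exact: measurable_funM.
  rewrite ge0_integral_pushforward// in h.
  exact: measurableT_comp.
split => //.
rewrite /Ex /Rintegral.
have -> : (\int[P]_w (f w * g w)%:E = \int[mu]_z (z.1 * z.2)%:E)%E.
  rewrite (eq_measure_integral (pushforward P FG)); last first.
    by move=> A mA _; exact: muE.
  by rewrite integral_pushforward//.
rewrite -integral12_prod_meas1//= /fubini_F/=.
have lF0 : ((\int[distribution P F]_x (x)%:E) = (Ex P f)%:E)%E.
  rewrite integral_distribution//=.
  by rewrite /Ex /Rintegral fineK//; exact: integrable_fin_num.
have lG0 : ((\int[distribution P G]_x (x)%:E) = (Ex P g)%:E)%E.
  rewrite integral_distribution//=.
  by rewrite /Ex /Rintegral fineK//; exact: integrable_fin_num.
rewrite (eq_integral (fun x : R => x%:E * (Ex P g)%:E)%E); last first.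
  move=> x _; under eq_integral do rewrite EFinM.
  by rewrite integralZl// lG0.
rewrite /= integralZr// lF0 -EFinM /= .
by rewrite /Ex /Rintegral.
Qed.

End IndependentPair.

(** * Independence of disjoint blocks of variables *)

Section BlockIndependence.
Context {d : measure_display} {T : measurableType d} {R : realType}.
Variable P : probability T R.
Variables (I : choiceType) (F : I -> set (set T)).
Hypothesis F_indep : mutually_independent P F.
Hypothesis FT : forall i, F i setT.
Hypothesis FI : forall i, setI_closed (F i).
Hypothesis F_meas : forall i, F i `<=` measurable.

Definition block_sys (J : set I) : set (set T) := \bigcup_(i in J) F i.

(** The pi-system of finite intersections with one event per index of the block; on it the product
    formula comes directly from mutual independence. *)
Let rect (J : set I) : set (set T) := [set A | exists (S : {fset I}) (C : I -> set T),
  [/\ forall i, i \in S -> J i, forall i, i \in S -> F i (C i)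
    & A = \bigcap_(i in [set` S]) C i]].

Let rect_setI J : setI_closed (rect J).
Proof.
move=> A B [S [C [SJ SF ->]]] [S' [C' [SJ' SF' ->]]].
(* Outside its own index set each family is padded with the whole space, which every [F i]
   contains. *)
exists (S `|` S')%fset, (fun i => (if i \in S then C i else setT) `&`
                               (if i \in S' then C' i else setT)).
split.
- by move=> i; rewrite in_fsetU => /orP[/SJ|/SJ'].
- move=> i iS; apply: FI; case: ifPn => iS1 //; [exact: SF|exact: SF'].
- apply/seteqP; split => [w [h1 h2] i /=|w h].
    rewrite in_fsetU => /orP[iS|iS]; rewrite iS; split => //; try exact: h1; try exact: h2.
      by case: ifPn => // iS'; exact: h2.
    by case: ifPn => // iS'; exact: h1.
  split=> i /= iS.
    have /h : i \in (S `|` S')%fset by rewrite in_fsetU iS.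
    by rewrite iS => -[].
  have /h : i \in (S `|` S')%fset by rewrite in_fsetU iS orbT.
  by rewrite iS => -[].
Qed.

Let rect_measurable J : rect J `<=` measurable.
Proof.
move=> A [S [C [SJ SF ->]]]; apply: fin_bigcap_measurable => //.
by move=> i /= iS; apply: F_meas; exact: SF.
Qed.

(** The pi-lambda theorem: for a family closed under intersection, the generated Dynkin system is
    the generated sigma-algebra. *)
Let block_rect J : <<s block_sys J >> `<=` <<d rect J >>.
Proof.
rewrite setI_closed_g_dynkin_g_sigma_algebra//.
apply: sub_sigma_algebra2 => A [i Ji FA].
exists [fset i]%fset, (fun=> A); split.
- by move=> j; rewrite in_fset1 => /eqP ->.
- by move=> j; rewrite in_fset1 => /eqP ->.
- apply/seteqP; split => [w Aw j //|w /(_ i)]; apply.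
  by rewrite /= in_fset1.
Qed.

Lemma block_sys_measurable J : <<s block_sys J >> `<=` measurable.
Proof.
apply: smallest_sub; first exact: sigma_algebra_measurable.
by move=> A [i _]; exact: F_meas.
Qed.

Let rect_indep J K : J `&` K = set0 -> forall A B, rect J A -> rect K B ->
  P (A `&` B) = (P A * P B)%E.
Proof.
move=> JK A B [S [C [SJ SF ->]]] [S' [C' [SJ' SF' ->]]].
have dSS i : i \in S -> i \in S' -> False.
  move=> /SJ Ji /SJ' Ki; suff : (J `&` K) i by rewrite JK.
  by [].
pose D i := if i \in S then C i else C' i.
have -> : \bigcap_(i in [set` S]) C i `&` \bigcap_(i in [set` S']) C' i =
    \bigcap_(i in [set` (S `|` S')%fset]) D i.
  apply/seteqP; split => [w [h1 h2] i /=|w h].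
    rewrite in_fsetU /D => /orP[iS|iS]; first by rewrite iS; exact: h1.
    by case: ifPn => iS'; [exact: h1|exact: h2].
  split=> i /= iS.
    by have /h : i \in (S `|` S')%fset by [rewrite in_fsetU iS]; rewrite /D iS.
  have /h : i \in (S `|` S')%fset by rewrite in_fsetU iS orbT.
  by rewrite /D; case: ifPn => // iS1; case: (dSS i).
have DF i : i \in (S `|` S')%fset -> F i (D i).
  rewrite in_fsetU /D; case: ifPn => [iS _|iS /= iS']; [exact: SF|exact: SF'].
rewrite (F_indep DF) (F_indep SF) (F_indep SF').
rewrite (big_fsetID _ (fun i => i \in S))/=.
congr (_ * _)%E.
  rewrite (_ : [fset x in (S `|` S')%fset | x \in S]%fset = S); last first.
    by apply/fsetP => i; rewrite !inE /= andb_idl// => ->.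
  by apply: eq_fbigr => i iS _; rewrite /D iS.
rewrite (_ : [fset x in (S `|` S')%fset | x \notin S]%fset = S'); last first.
  apply/fsetP => i; rewrite !inE /=; apply/andP/idP => [[/orP[->//|//]]|iS'].
  by rewrite iS' orbT; split => //; apply/negP => /dSS /(_ iS').
apply: eq_fbigr => i iS _; rewrite /D; case: ifPn => // iS1.
by case: (dSS i).
Qed.

(** The lambda-system half of the argument: complements use that [P B] is finite, disjoint unions
    that P is sigma-additive. *)
Lemma dynkin_indep (B : set T) : measurable B ->
  dynkin [set A | measurable A /\ P (A `&` B) = (P A * P B)%E].
Proof.
move=> mB; split => /=.
- by rewrite setTI [P setT]probability_setT mul1e.
- move=> A [mA AB]; split; first exact: measurableC.
  rewrite setIC -setDE measureD//; last by rewrite ltey_eq fin_num_measure.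
  transitivity (P B - P A * P B)%E.
    by congr (_ - _)%E; rewrite setIC; exact: AB.
  rewrite probability_setC//.
  by rewrite muleBl ?mul1e// fin_num_measure.
- move=> A tA AB; have mA n : measurable (A n) by have [] := AB n.
  split; first exact: bigcupT_measurable.
  rewrite setI_bigcupl measure_bigcup//; last 2 first.
  + by move=> i _; exact: measurableI.
  + exact: trivIset_setIr.
  rewrite measure_bigcup//.
  rewrite -[P B]fineK ?fin_num_measure// muleC -nneseriesZl//.
  apply: eq_eseriesr => n _; have [_ ABn] := AB n.
  by rewrite fineK ?fin_num_measure// [RHS]muleC; exact: ABn.
Qed.

(** Two rounds of the pi-lambda argument: with A a fixed rectangle the second event extends to its
    sigma-algebra, and with that event fixed the first one does. *)
Lemma block_indep J K : J `&` K = set0 -> forall A B,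
  <<s block_sys J >> A -> <<s block_sys K >> B -> P (A `&` B) = (P A * P B)%E.
Proof.
move=> JK.
have step A B : rect J A -> <<s block_sys K >> B -> P (A `&` B) = (P A * P B)%E.
  move=> rA /block_rect; set D := [set B | measurable B /\ P (B `&` A) = (P B * P A)%E].
  have mA := rect_measurable rA.
  have dD : dynkin D by exact: dynkin_indep.
  move=> /(_ D)[]; last by move=> mB; rewrite setIC muleC.
  split => // C rC; split; first exact: rect_measurable rC.
  by rewrite setIC muleC; exact: rect_indep JK _ _ rA rC.
move=> A B /block_rect hA hB.
set D := [set A | measurable A /\ P (A `&` B) = (P A * P B)%E].
have mB := block_sys_measurable hB.
have dD : dynkin D by exact: dynkin_indep.
have [] := hA D; last by [].
split => // C rC; split; first exact: rect_measurable rC.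
exact: step.
Qed.

(** Stated on the measurable type of the generated sigma-algebra, so that the closure rules for
    measurable functions apply unchanged to functions of the variables of a block. *)
Definition block_fun (J : set I) (f : T -> R) :=
  measurable_fun [set: g_sigma_algebraType (block_sys J)] f.

Lemma block_fun_measurable J f : block_fun J f -> measurable_fun setT f.
Proof. by move=> mf _ A mA; apply: (@block_sys_measurable J); exact: mf. Qed.

Lemma block_funS J K f : J `<=` K -> block_fun J f -> block_fun K f.
Proof.
move=> JK mf mT A mA; have := mf measurableT _ mA.
by apply: sub_sigma_algebra2 => B [i /JK Ki FB]; exists i.
Qed.

Lemma block_indep_rv J K f g : J `&` K = set0 -> block_fun J f -> block_fun K g ->
  indep_rv P f g.
Proof.
move=> JK mf mg A B mA mB; apply: (block_indep JK).
  by rewrite -[X in <<s _ >> X]setTI; exact: mf.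
by rewrite -[X in <<s _ >> X]setTI; exact: mg.
Qed.

Lemma block_ExM J K f g : J `&` K = set0 -> block_fun J f -> block_fun K g ->
  L1 P f -> L1 P g ->
  L1 P (fun w => f w * g w) /\ Ex P (fun w => f w * g w) = Ex P f * Ex P g.
Proof. by move=> JK mf mg; apply: indep_ExM; exact: block_indep_rv mf mg. Qed.

End BlockIndependence.

Section IndependentVariables.
Context {d : measure_display} {T : measurableType d} {R : realType}.
Variable P : probability T R.
Variables (I : choiceType) (z : I -> T -> R).
Hypothesis mz : forall i, measurable_fun setT (z i).
Hypothesis z_indep : mutually_independent P (fun i => sigma_rv (z i)).

Lemma sigma_rvT (f : T -> R) : sigma_rv f setT.
Proof. by exists setT => //; rewrite preimage_setT setTI. Qed.

Lemma sigma_rvI (f : T -> R) : setI_closed (sigma_rv f).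
Proof.
move=> _ _ [A mA <-] [B mB <-]; exists (A `&` B); first exact: measurableI.
by rewrite !setTI preimage_setI.
Qed.

Lemma sigma_rv_measurable (f : T -> R) : measurable_fun setT f ->
  sigma_rv f `<=` measurable.
Proof. by move=> mf _ [A mA <-]; exact: mf. Qed.

Definition vars_fun (J : set I) (f : T -> R) := block_fun (fun i => sigma_rv (z i)) J f.

Lemma vars_funD J f g : vars_fun J f -> vars_fun J g -> vars_fun J (fun w => f w + g w).
Proof. exact: measurable_funD. Qed.

Lemma vars_funM J f g : vars_fun J f -> vars_fun J g -> vars_fun J (fun w => f w * g w).
Proof. exact: measurable_funM. Qed.

Lemma vars_fun_cst J c : vars_fun J (fun=> c).
Proof. exact: measurable_cst. Qed.

Lemma vars_fun_sum (A : Type) (s : seq A) J (f : A -> T -> R) :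
  (forall a, vars_fun J (f a)) -> vars_fun J (fun w => \sum_(a <- s) f a w).
Proof.
move=> mf; elim: s => [|a s ih].
  by under eq_fun do rewrite big_nil; exact: vars_fun_cst.
by under eq_fun do rewrite big_cons; exact: vars_funD.
Qed.

Lemma vars_fun_var (J : set I) i : J i -> vars_fun J (z i).
Proof.
move=> Ji _ A mA; apply: sub_sigma_algebra; exists i => //.
by exists A.
Qed.

Lemma vars_fun_comp J f (g : R -> R) : measurable_fun setT g -> vars_fun J f ->
  vars_fun J (g \o f).
Proof. by move=> mg mf; exact: measurableT_comp. Qed.

Lemma vars_fun_measurable J f : vars_fun J f -> measurable_fun setT f.
Proof.
by apply: block_fun_measurable => i; apply: sigma_rv_measurable.
Qed.

Lemma vars_funS J K f : J `<=` K -> vars_fun J f -> vars_fun K f.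
Proof. exact: block_funS. Qed.

Lemma vars_indep_rv J K f g : J `&` K = set0 -> vars_fun J f -> vars_fun K g -> indep_rv P f g.
Proof.
apply: block_indep_rv => // i; first exact: sigma_rvT; first exact: sigma_rvI.
exact: sigma_rv_measurable.
Qed.

Lemma vars_ExM J K f g : J `&` K = set0 -> vars_fun J f -> vars_fun K g ->
  L1 P f -> L1 P g ->
  L1 P (fun w => f w * g w) /\ Ex P (fun w => f w * g w) = Ex P f * Ex P g.
Proof.
apply: block_ExM => // i; first exact: sigma_rvT; first exact: sigma_rvI.
exact: sigma_rv_measurable.
Qed.

(** Since s has no repetition, the head variable lies outside the block of the tail, so the two
    factors are independent. The middle clause is what the induction passes on to make this
    visible. *)
Lemma vars_Ex_prod (s : seq I) (g : I -> R -> R) : uniq s ->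
  (forall i, measurable_fun setT (g i)) -> (forall i, L1 P (g i \o z i)) ->
  [/\ L1 P (fun w => \prod_(i <- s) g i (z i w)),
     vars_fun [set` s] (fun w => \prod_(i <- s) g i (z i w))
   & Ex P (fun w => \prod_(i <- s) g i (z i w)) = \prod_(i <- s) Ex P (g i \o z i)].
Proof.
move=> + mg lg; elim: s => [_|i s ih /= /andP[iNs us]].
  under eq_fun do rewrite big_nil.
  by rewrite big_nil Ex_cst; split => //; [exact: L1_cst|exact: vars_fun_cst].
under eq_fun do rewrite big_cons.
have [ls vs es] := ih us.
have vi : vars_fun [set i] (g i \o z i).
  by apply: vars_fun_comp => //; exact: vars_fun_var.
have [|l e] := vars_ExM _ vi vs (lg i) ls.
  by apply/seteqP; split => // j [/= -> /=]; rewrite (negbTE iNs).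
split => //; last by rewrite e es big_cons.
apply: vars_funM.
  by apply: vars_funS vi => j /= ->; rewrite mem_head.
by apply: vars_funS vs => j /= js; rewrite in_cons js orbT.
Qed.

End IndependentVariables.

(** * A central limit theorem for cosines *)

Section TrigEstimates.
Context {R : realType}.

(** The derivative is bounded only on the interval from -|x| to |x|, so that M may be a power of |x|
    and one Taylor estimate yields the next. *)
Lemma MVT_bound (f f' : R -> R) (M x : R) : (forall y : R, is_derive y 1 f (f' y)) ->
  f 0 = 0 -> (forall y, `|y| <= `|x| -> `|f' y| <= M) -> `|f x| <= M * `|x|.
Proof.
move=> df f0 bf.
have cf (a b : R) : {within `[a, b], continuous f}.
  apply: continuous_subspaceT => y; apply: differentiable_continuous.
  by apply/derivable1_diffP; have [] := df y.
have [x0|x0|->] := ltrgt0P x; last by rewrite f0 normr0 mulr0.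
  have [c c0 e] := MVT x0 (fun y _ => df y) (cf 0 x).
  move: e; rewrite f0 !subr0 => ->.
  rewrite normrM (gtr0_norm x0) ler_wpM2r ?(ltW x0)//.
  move: c0; rewrite in_itv/= => /andP[c0 cx].
  apply: bf; rewrite !gtr0_norm//; exact: ltW.
have [c c0 e] := MVT x0 (fun y _ => df y) (cf x 0).
move: e; rewrite f0 !sub0r => /eqP; rewrite eqr_oppLR -mulrN opprK => /eqP ->.
rewrite normrM (ltr0_norm x0) ler_wpM2r ?oppr_ge0 ?(ltW x0)//.
move: c0; rewrite in_itv/= => /andP[c0 cx].
by apply: bf; rewrite !ltr0_norm// lerN2 ltW.
Qed.

Lemma sin_norm_le (x : R) : `|sin x| <= `|x|.
Proof.
rewrite -[leRHS]mul1r; apply: (@MVT_bound _ cos); last by move=> y _; exact: cos_max.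
exact: sin0.
Qed.

(** The half-angle formula 1 - cos x = 2 sin^2(x/2) with |sin y| <= |y| keeps the sharp constant
    1/2. *)
Lemma one_sub_cos (x : R) : 0 <= 1 - cos x <= x ^+ 2 / 2.
Proof.
rewrite subr_ge0 cos_le1/=.
have -> : cos x = cos ((x / 2) *+ 2) by congr cos; rewrite mulr2n -splitr.
rewrite cos_mulr2n cos2sin2.
have := sin_norm_le (x / 2); rewrite -ler_sqr ?nnegrE// !real_normK ?num_real//.
by move=> h; rewrite mulr2n; lra.
Qed.

Lemma sin_sub_id_cube (x : R) : `|sin x - x| <= `|x| ^+ 3.
Proof.
rewrite exprSr; apply: (@MVT_bound (fun x => sin x - x) (fun x => cos x - 1)).
- by rewrite sin0 subr0.
- move=> y yx; rewrite distrC; have /andP[c0 cy] := one_sub_cos y.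
  rewrite ger0_norm// (le_trans cy)//.
  rewrite -(real_normK (num_real y)).
  have : `|y| ^+ 2 <= `|x| ^+ 2 by rewrite ler_sqr ?nnegrE.
  by have := sqr_ge0 `|y|; lra.
Qed.

Lemma sin_sub_id_sqr (x : R) : `|sin x - x| <= 2 * x ^+ 2.
Proof.
have [x1|x1] := leP `|x| 1.
  apply: le_trans (sin_sub_id_cube x) _.
  rewrite exprSr real_normK ?num_real// mulrC ler_wpM2r ?sqr_ge0//; lra.
apply: le_trans (ler_normB _ _) _; rewrite -(real_normK (num_real x)).
have := sin_norm_le x; nra.
Qed.

Lemma cos_taylor_sqr (x : R) : `|cos x - 1 + x ^+ 2 / 2| <= x ^+ 2.
Proof. by have := one_sub_cos x; rewrite ler_norml => /andP[]; nra. Qed.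

(** For |x| <= 1 the derivative x - sin x even gives |x|^4; elsewhere the quadratic bound already
    lies below the cube. *)
Lemma cos_taylor_cube (x : R) : `|cos x - 1 + x ^+ 2 / 2| <= `|x| ^+ 3.
Proof.
have [x1|x1] := leP `|x| 1; last first.
  apply: le_trans (cos_taylor_sqr x) _.
  rewrite [leRHS]exprSr real_normK ?num_real// -[leLHS]mulr1 ler_wpM2l ?sqr_ge0//.
  exact: ltW.
apply: (@le_trans _ _ (`|x| ^+ 3 * `|x|)); last first.
  by rewrite -[leRHS]mulr1 ler_wpM2l// exprn_ge0.
apply: (@MVT_bound (fun x => cos x - 1 + x ^+ 2 / 2) (fun x => - sin x + x)).
- move=> y; apply: is_derive_eq.
  by rewrite subr0 /GRing.scale/=; lra.
- by rewrite cos0 expr0n/=; lra.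
- move=> y yx; rewrite -normrN opprD opprK; apply: le_trans (sin_sub_id_cube y) _.
  by rewrite lerXn2r ?nnegrE.
Qed.

(* The truncation (|x| - c)_+^2, convex and hence better behaved under sums
   than x^2 1_{|x| > c}. *)
Definition excess (c x : R) : R := (Num.max (`|x| - c) 0) ^+ 2.

Let max0_ge0 (u : R) : 0 <= Num.max u 0.
Proof. by rewrite le_max lexx orbT. Qed.

Lemma excess_ge0 c x : 0 <= excess c x.
Proof. exact: sqr_ge0. Qed.

Lemma excess_le_sqr c x : 0 <= c -> excess c x <= x ^+ 2.
Proof.
move=> c0; rewrite /excess -(real_normK (num_real x)) ler_sqr ?nnegrE ?max0_ge0//.
by rewrite ge_max normr_ge0 andbT gerBl.
Qed.

Lemma le_excess c x y : `|x| <= `|y| -> excess c x <= excess c y.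
Proof.
move=> xy; rewrite /excess ler_sqr ?nnegrE ?max0_ge0//.
by rewrite ge_max !le_max lexx orbT andbT lerB.
Qed.

Lemma le_excess_level c c' x : c <= c' -> excess c' x <= excess c x.
Proof.
move=> cc; rewrite /excess ler_sqr ?nnegrE ?max0_ge0//.
by rewrite ge_max !le_max lexx orbT andbT lerB.
Qed.

Lemma excessM c a x : 0 <= a -> excess (a * c) (a * x) = a ^+ 2 * excess c x.
Proof.
move=> a0; rewrite /excess -exprMn; congr (_ ^+ 2).
by rewrite normrM ger0_norm// -mulrBr maxr_pMr// mulr0.
Qed.

(** The positive part of |x| - c is subadditive when the levels add, and (u + v)^2 <= 2u^2 +
    2v^2. *)
Lemma excessD c x y : excess (c + c) (x + y) <= 2 * excess c x + 2 * excess c y.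
Proof.
have h : Num.max (`|x + y| - (c + c)) 0 <=
  Num.max (`|x| - c) 0 + Num.max (`|y| - c) 0.
  have hx : `|x| - c <= Num.max (`|x| - c) 0 by rewrite le_max lexx.
  have hy : `|y| - c <= Num.max (`|y| - c) 0 by rewrite le_max lexx.
  have hx0 : 0 <= Num.max (`|x| - c) 0 by rewrite le_max lexx orbT.
  have hy0 : 0 <= Num.max (`|y| - c) 0 by rewrite le_max lexx orbT.
  by rewrite ge_max; have := ler_normD x y; lra.
have h0 : 0 <= Num.max (`|x + y| - (c + c)) 0 by rewrite le_max lexx orbT.
move: h h0; rewrite /excess; set u := Num.max _ _; set v := Num.max _ _; set t := Num.max _ _.
by move=> h h0; have := sqr_ge0 (v - t); nra.
Qed.

Lemma sqr_le_excess c x : 0 <= c -> c + c <= `|x| -> x ^+ 2 <= 4 * excess c x.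
Proof.
move=> c0 cx; rewrite /excess max_l; last by rewrite subr_ge0; lra.
by rewrite -(real_normK (num_real x)); nra.
Qed.

(** A Chebyshev-type bound from c(|x| - c) <= x^2: bounded fourth moments control [excess]
    uniformly. *)
Lemma excess_le_pow4 c x : 0 < c -> excess c x <= c ^- 2 * (x ^+ 2) ^+ 2.
Proof.
move=> c0; rewrite /excess.
have [cx|cx] := leP (`|x| - c) 0.
  by rewrite expr0n/= mulr_ge0 ?sqr_ge0// invr_ge0 sqr_ge0.
rewrite ler_pdivlMl ?exprn_gt0// -exprMn ler_sqr ?nnegrE ?sqr_ge0 ?mulr_ge0 ?(ltW c0) ?(ltW cx)//.
by rewrite -(real_normK (num_real x)); nra.
Qed.

(** Lindeberg's splitting at |x| = 2c: below, the cubic bound gives 2c x^2; above, |x| <= 2(|x| - c)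
    brings the quadratic bound 2x^2 under 8 [excess c x]. *)
Lemma trig_taylor c x : 0 < c ->
  `|sin x - x| <= 8 * excess c x + 2 * c * x ^+ 2 /\
  `|cos x - 1 + x ^+ 2 / 2| <= 8 * excess c x + 2 * c * x ^+ 2.
Proof.
move=> c0; have [cx|cx] := leP `|x| (c + c).
  have h : `|x| ^+ 3 <= 8 * excess c x + 2 * c * x ^+ 2.
    apply: (@le_trans _ _ (2 * c * x ^+ 2)); last first.
      by rewrite lerDr mulr_ge0// excess_ge0.
    by rewrite exprS -(real_normK (num_real x)) ler_wpM2r ?sqr_ge0//; lra.
  by split; apply: le_trans h; [exact: sin_sub_id_cube|exact: cos_taylor_cube].
have h : 2 * x ^+ 2 <= 8 * excess c x + 2 * c * x ^+ 2.
  have := sqr_le_excess (ltW c0) (ltW cx).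
  by have : 0 <= c * x ^+ 2 by [rewrite mulr_ge0 ?sqr_ge0 ?ltW]; lra.
split; apply: le_trans h; first exact: sin_sub_id_sqr.
by apply: le_trans (cos_taylor_sqr x) _; have := sqr_ge0 x; lra.
Qed.

(** With a = s/2, two uses of 1 + u <= exp u give 1 - a <= exp(-a) <= 1/(1 + a), which is within a^2
    of 1 - a. *)
Lemma expRN_taylor (s : R) : 0 <= s -> `|expR (- s / 2) - (1 - s / 2)| <= s ^+ 2.
Proof.
move=> s0; have := expR_ge1Dx (- s / 2); have := expR_ge1Dx (s / 2).
rewrite mulNr; set a := s / 2; have -> : s = 2 * a by rewrite /a; lra.
have a0 : 0 <= a by rewrite /a; lra.
move=> h1 h2.
have : expR (- a) * expR a = 1 by rewrite -expRD addNr expR0.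
have := expR_gt0 (- a); set u := expR (- a) in h2 *; set v := expR a in h1 *.
move=> u0 uv.
have h3 : u * (1 + a) <= u * v by rewrite ler_wpM2l// ltW.
rewrite uv in h3.
by rewrite ger0_norm; nra.
Qed.

Lemma continuous_cosD b : continuous (fun x : R => cos (b + x)).
Proof.
move=> x; apply: continuous_comp; last exact: continuous_cos.
by apply: cvgD; [exact: cvg_cst|exact: cvg_id].
Qed.

Lemma continuous_sinD b : continuous (fun x : R => sin (b + x)).
Proof.
move=> x; apply: continuous_comp; last exact: continuous_sin.
by apply: cvgD; [exact: cvg_cst|exact: cvg_id].
Qed.

End TrigEstimates.

Lemma cvg_sub0 {T : Type} {R : realType} (F : set_system T) {FF : Filter F}
  (f g : T -> R) (l : R) :
  f x - g x @[x --> F] --> 0 -> g x @[x --> F] --> l -> f x @[x --> F] --> l.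
Proof.
move=> fg gl; have -> : f = (fun x => (f x - g x) + g x).
  by apply/funext => x; rewrite subrK.
by rewrite -[l]add0r; exact: cvgD.
Qed.

Lemma cesaro_mean {R : realType} (u : nat -> R) (l : R) : u n @[n --> \oo] --> l ->
  n%:R^-1 * \sum_(i < n) u i @[n --> \oo] --> l.
Proof.
move=> /cesaro h; rewrite -(cvg_shiftS (fun n => n%:R^-1 * \sum_(i < n) u i)).
apply: cvg_trans h; apply: near_eq_cvg; apply: nearW => n.
by rewrite /arithmetic_mean/= /series/= big_mkord.
Qed.

(** * Lindeberg replacement for cosines *)

Section TrigCLT.
Context {d : measure_display} {T : measurableType d} {R : realType}.
Variable P : probability T R.

Lemma measurable_cosD (f : T -> R) b : measurable_fun setT f ->
  measurable_fun setT (fun w => cos (b + f w)).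
Proof.
move=> mf; apply: (measurableT_comp (f := fun x : R => cos (b + x))) => //.
apply: continuous_measurable_fun; exact: continuous_cosD.
Qed.

Lemma measurable_sinD (f : T -> R) b : measurable_fun setT f ->
  measurable_fun setT (fun w => sin (b + f w)).
Proof.
move=> mf; apply: (measurableT_comp (f := fun x : R => sin (b + x))) => //.
apply: continuous_measurable_fun; exact: continuous_sinD.
Qed.

Lemma L1_cosD (f : T -> R) b : measurable_fun setT f -> L1 P (fun w => cos (b + f w)).
Proof.
by move=> mf; apply: (@L1_bounded _ _ _ P _ 1) (measurable_cosD b mf) _ => w; exact: cos_max.
Qed.

Lemma L1_sinD (f : T -> R) b : measurable_fun setT f -> L1 P (fun w => sin (b + f w)).
Proof.
by move=> mf; apply: (@L1_bounded _ _ _ P _ 1) (measurable_sinD b mf) _ => w; exact: sin_max.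
Qed.

Lemma Ex_cos_le1 (f : T -> R) b : measurable_fun setT f ->
  `|Ex P (fun w => cos (b + f w))| <= 1.
Proof.
move=> mf; rewrite -[leRHS](Ex_cst P); apply: Ex_norm_le (L1_cst _ _) _ => [|w].
  exact: L1_cosD.
exact: cos_max.
Qed.

Lemma Ex_sin_le1 (f : T -> R) b : measurable_fun setT f ->
  `|Ex P (fun w => sin (b + f w))| <= 1.
Proof.
move=> mf; rewrite -[leRHS](Ex_cst P); apply: Ex_norm_le (L1_cst _ _) _ => [|w].
  exact: L1_sinD.
exact: sin_max.
Qed.

Lemma indep_rv_comp (f g : T -> R) (u v : R -> R) : indep_rv P f g ->
  measurable_fun setT u -> measurable_fun setT v -> indep_rv P (u \o f) (v \o g).
Proof.
move=> fg mu mv A B mA mB; apply: (fg (u @^-1` A) (v @^-1` B)).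
  by rewrite -[X in measurable X]setTI; exact: mu.
by rewrite -[X in measurable X]setTI; exact: mv.
Qed.

(** The real counterpart of the product rule for characteristic functions, by the addition formula
    for the cosine. *)
Lemma Ex_cosD_indep (f g : T -> R) b : measurable_fun setT f -> measurable_fun setT g ->
  indep_rv P f g -> Ex P (fun w => cos (b + (f w + g w))) =
  Ex P (fun w => cos (b + f w)) * Ex P (fun w => cos (g w)) -
  Ex P (fun w => sin (b + f w)) * Ex P (fun w => sin (g w)).
Proof.
move=> mf mg fg.
have mc c : measurable_fun setT (fun x : R => cos (c + x)).
  apply: continuous_measurable_fun; exact: continuous_cosD.
have ms c : measurable_fun setT (fun x : R => sin (c + x)).
  apply: continuous_measurable_fun; exact: continuous_sinD.
have e1 : (fun w => cos (g w)) = (fun w => cos (0 + g w)).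
  by apply/funext => w; rewrite add0r.
have e2 : (fun w => sin (g w)) = (fun w => sin (0 + g w)).
  by apply/funext => w; rewrite add0r.
rewrite e1 e2.
have [lc <-] := indep_ExM (indep_rv_comp fg (mc b) (mc 0)) (L1_cosD b mf) (L1_cosD 0 mg).
have [ls <-] := indep_ExM (indep_rv_comp fg (ms b) (ms 0)) (L1_sinD b mf) (L1_sinD 0 mg).
rewrite -ExB//; congr (Ex P _); apply/funext => w /=.
by rewrite !add0r -cosD addrA.
Qed.

Lemma measurable_excess c : measurable_fun setT (@excess R c).
Proof.
apply: measurable_funX; apply: measurable_maxr => //.
by apply: measurable_funB => //; exact: normr_measurable.
Qed.

Lemma L1_excess c (f : T -> R) : 0 <= c -> measurable_fun setT f ->
  L1 P (fun w => f w ^+ 2) -> L1 P (fun w => excess c (f w)).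
Proof.
move=> c0 mf lf; apply: L1_le lf _ => [|w].
  by apply: (measurableT_comp (measurable_excess c)).
by rewrite ger0_norm ?excess_ge0// excess_le_sqr.
Qed.

(** s is the variance and r bounds both Taylor remainders; s^2 pays for passing from 1 - s/2 to
    exp(-s/2). For the sine, the linear term drops out because X is centred. *)
Lemma Ex_trig_step (X : T -> R) c : 0 < c -> measurable_fun setT X ->
  L1 P (fun w => X w ^+ 2) -> Ex P X = 0 ->
  let s := Ex P (fun w => X w ^+ 2) in
  let r := 8 * Ex P (fun w => excess c (X w)) + 2 * c * s in
  `|Ex P (fun w => cos (X w)) - expR (- s / 2)| <= r + s ^+ 2 /\
  `|Ex P (fun w => sin (X w))| <= r.
Proof.
move=> c0 mX lX X0 s r.
have lX1 := integrable_sqr_L1 mX lX.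
have le := L1_excess (ltW c0) mX lX.
have lr : L1 P (fun w => 8 * excess c (X w) + 2 * c * X w ^+ 2).
  by apply: L1D; exact: L1Z.
have rE : r = Ex P (fun w => 8 * excess c (X w) + 2 * c * X w ^+ 2).
  by rewrite ExD ?ExZ//; exact: L1Z.
have lcos : L1 P (fun w => cos (X w)).
  by apply: eq_L1 (L1_cosD 0 mX) => w; rewrite add0r.
have lsin : L1 P (fun w => sin (X w)).
  by apply: eq_L1 (L1_sinD 0 mX) => w; rewrite add0r.
split; last first.
  rewrite -[X in `|X|]subr0 -X0 -ExB// rE; apply: Ex_norm_le => //.
    exact: L1B.
  by move=> w; have [] := trig_taylor (X w) c0.
have s0 : 0 <= s by apply: Ex_ge0 => w; exact: sqr_ge0.
have -> : Ex P (fun w => cos (X w)) - expR (- s / 2) =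
  (Ex P (fun w => cos (X w)) - (1 - s / 2)) - (expR (- s / 2) - (1 - s / 2)) by lra.
apply: le_trans (ler_normB _ _) _; apply: lerD; last exact: expRN_taylor.
have lh : L1 P (fun w => X w ^+ 2 / 2).
  by apply: eq_L1 (L1Z 2^-1 lX) => w; rewrite mulrC.
have -> : Ex P (fun w => cos (X w)) - (1 - s / 2) =
    Ex P (fun w => cos (X w) - 1 + X w ^+ 2 / 2).
  rewrite ExD//; last by apply: L1B => //; exact: L1_cst.
  rewrite ExB//; last exact: L1_cst.
  rewrite Ex_cst; have -> : Ex P (fun w => X w ^+ 2 / 2) = 2^-1 * s.
    by rewrite -ExZ//; congr (Ex P _); apply/funext => w; rewrite mulrC.
  by lra.
rewrite rE; apply: Ex_norm_le => //.
  by apply: L1D => //; apply: L1B => //; exact: L1_cst.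
by move=> w; have [] := trig_taylor (X w) c0.
Qed.

(** One summand at a time: the cosine of the new summand becomes its Gaussian factor at cost r +
    s^2, and its sine is dropped at cost r. Earlier errors are not amplified, as that factor is at
    most 1. *)
Lemma trig_sum_estimate (X : nat -> T -> R) c : 0 < c ->
  (forall j, measurable_fun setT (X j)) -> (forall j, L1 P (fun w => X j w ^+ 2)) ->
  (forall j, Ex P (X j) = 0) ->
  (forall n, indep_rv P (fun w => \sum_(j < n) X j w) (X n)) ->
  let s j := Ex P (fun w => X j w ^+ 2) in
  let r j := 8 * Ex P (fun w => excess c (X j w)) + 2 * c * s j in
  forall n b, `|Ex P (fun w => cos (b + \sum_(j < n) X j w)) -
    cos b * expR (- (\sum_(j < n) s j) / 2)| <= \sum_(j < n) (2 * r j + s j ^+ 2).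
Proof.
move=> c0 mX lX X0 iX s r; elim=> [|n ih] b.
  under eq_fun do rewrite big_ord0 addr0.
  by rewrite !big_ord0 Ex_cst oppr0 mul0r expR0 mulr1 subrr normr0.
under eq_fun do rewrite big_ord_recr/=.
have mS : measurable_fun setT (fun w => \sum_(j < n) X j w).
  exact: measurable_sum.
rewrite Ex_cosD_indep//; last exact: iX.
rewrite !big_ord_recr/= opprD mulrDl expRD.
have [hc hs] := Ex_trig_step c0 (mX n) (lX n) (X0 n); rewrite -/(s n) -/(r n) in hc hs.
have := ih b; set U := Ex P _; set V := cos b; set e1 := expR _.
have U1 : `|U| <= 1 by exact: Ex_cos_le1.
set W := Ex P (fun w => sin (b + _)); have W1 : `|W| <= 1 by exact: Ex_sin_le1.
move: hc hs; set C := Ex P _; set S := Ex P _; set e2 := expR _ => hc hs hU.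
have e20 : 0 <= e2 by exact: expR_ge0.
have e21 : e2 <= 1.
  rewrite expR_le1 mulNr oppr_le0 divr_ge0//.
  by apply: Ex_ge0 => w; exact: sqr_ge0.
have -> : U * C - W * S - V * (e1 * e2) = U * (C - e2) + (U - V * e1) * e2 - W * S by ring.
apply: le_trans (ler_normB _ _) _; apply: le_trans (lerD (ler_normD _ _) (lexx _)) _.
rewrite !normrM (ger0_norm e20).
have h1 : `|U| * `|C - e2| <= r n + s n ^+ 2.
  by apply: le_trans hc; rewrite -[leRHS]mul1r ler_wpM2r.
have h2 : `|U - V * e1| * e2 <= \sum_(j < n) (2 * r j + s j ^+ 2).
  by apply: le_trans hU; rewrite -[leRHS]mulr1 ler_wpM2l.
have h3 : `|W| * `|S| <= r n.
  by apply: le_trans hs; rewrite -[leRHS]mul1r ler_wpM2r.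
by rewrite mulrDl mul1r; lra.
Qed.

Definition unif_sqr_int (y : nat -> T -> R) :=
  [/\ forall i, measurable_fun setT (y i), forall i, L1 P (fun w => y i w ^+ 2)
    & forall e, 0 < e -> exists2 K, 0 < K & forall i, Ex P (fun w => excess K (y i w)) <= e].

Theorem trig_clt (y : nat -> T -> R) (v : R) : unif_sqr_int y ->
  (forall i, Ex P (y i) = 0) ->
  (forall n, indep_rv P (fun w => \sum_(j < n) y j w) (y n)) ->
  Ex P (fun w => y n w ^+ 2) @[n --> \oo] --> v ->
  forall b, Ex P (fun w => cos (b + (Num.sqrt n%:R)^-1 * \sum_(j < n) y j w)) @[n --> \oo]
    --> cos b * expR (- v / 2).
Proof.
move=> [my ly uy] y0 iy cv b.
pose s j := Ex P (fun w => y j w ^+ 2).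
have s0 j : 0 <= s j by apply: Ex_ge0 => w; exact: sqr_ge0.
have [V V0 sV] : exists2 V, 0 < V & forall j, s j <= V.
  have /cvg_seq_bounded [M [_ hM]] : cvgn s by apply/cvg_ex; exists v.
  exists (`|M| + 1); first by rewrite ltr_wpDl.
  move=> j; rewrite (le_trans (ler_norm _))//; apply: (hM (`|M| + 1)) => //.
  by rewrite ltr_pwDr// ler_norm.
have lim1 : cos b * expR (- (n%:R^-1 * \sum_(j < n) s j) / 2) @[n --> \oo] -->
    cos b * expR (- v / 2).
  apply: cvgMr; apply: continuous_cvg; first exact: continuous_expR.
  by apply: cvgMl; apply: cvgN; exact: cesaro_mean.
apply: cvg_sub0 lim1.
apply/cvgr0Pnorm_le => e e0.
(* Each of three errors gets e/(3n) per summand: 16 times the scaled [excess], at most e/(48n); 4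
   times c s_j/n, where c V = e/12; and (s_j/n)^2. *)
have e48 : 0 < e / 48 by rewrite divr_gt0.
have [K K0 hK] := uy _ e48.
pose c := e / (12 * V).
have c0 : 0 < c by rewrite divr_gt0// mulr_gt0.
near=> n.
have n0 : (0 < n)%N by near: n; exact: nbhs_infty_gt.
have nr0 : 0 < n%:R :> R by rewrite ltr0n.
have sn0 : 0 < Num.sqrt n%:R :> R by rewrite sqrtr_gt0.
set q := (Num.sqrt n%:R)^-1 : R.
have q0 : 0 < q by rewrite invr_gt0.
have q2 : q ^+ 2 = n%:R^-1 by rewrite exprVn sqr_sqrtr// ltW.
have EqZ (f : T -> R) : L1 P (fun w => f w ^+ 2) ->
  Ex P (fun w => (q * f w) ^+ 2) = n%:R^-1 * Ex P (fun w => f w ^+ 2).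
  by move=> lf; under eq_fun do rewrite exprMn q2; rewrite ExZ.
have lq j : L1 P (fun w => (q * y j w) ^+ 2).
  by under eq_fun do rewrite exprMn q2; exact: L1Z.
have mq j : measurable_fun setT (fun w => q * y j w) by exact: measurable_funM.
have Eq0 j : Ex P (fun w => q * y j w) = 0.
  by rewrite ExZ ?y0 ?mulr0//; exact: integrable_sqr_L1.
have iq m : indep_rv P (fun w => \sum_(j < m) (q * y j w)) (fun w => q * y m w).
  under eq_fun do rewrite -mulr_sumr.
  by apply: (indep_rv_comp (u := fun x => q * x) (v := fun x => q * x)) (iy m) _ _;
    exact: measurable_funM.
have := trig_sum_estimate c0 mq lq Eq0 iq n b.
under eq_fun do rewrite -mulr_sumr.
under [X in expR (- X / 2)]eq_bigr do rewrite EqZ//.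
rewrite -mulr_sumr => /le_trans; apply.
apply: (@le_trans _ _ (\sum_(j < n) (n%:R^-1 * e))); last first.
  rewrite sumr_const card_ord -[leLHS]mulr_natl mulrA divff ?mul1r//.
  by rewrite gt_eqF.
apply: ler_sum => j _.
have hs : Ex P (fun w => (q * y j w) ^+ 2) = n%:R^-1 * s j by exact: EqZ.
(* Undoing the scaling turns the level c into sqrt(n) c, which exceeds the uniform level K once n >=
   (K/c)^2. *)
have cK : K <= Num.sqrt n%:R * c.
  rewrite -ler_pdivrMr// -(ger0_norm (ltW (divr_gt0 K0 c0))) -sqrtr_sqr ler_sqrt ?(ltW nr0)//.
  near: n; exact: nbhs_infty_ger.
have hex : Ex P (fun w => excess c (q * y j w)) <= n%:R^-1 * (e / 48).
  have -> : c = q * (Num.sqrt n%:R * c) by rewrite mulrA mulVf ?mul1r// gt_eqF.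
  under eq_fun do rewrite excessM ?(ltW q0)// q2.
  have lK k : 0 < k -> L1 P (fun w => excess k (y j w)) by move=> /ltW k0; exact: L1_excess.
  have k0 : 0 < Num.sqrt n%:R * c by exact: mulr_gt0.
  rewrite ExZ ?lK// ler_wpM2l ?invr_ge0 ?(ltW nr0)//.
  apply: le_trans (hK j); apply: le_Ex; [exact: lK|exact: lK|move=> w].
  exact: le_excess_level.
rewrite hs.
have nV : n%:R^-1 * V ^+ 2 <= e / 3.
  rewrite mulrC ler_pdivrMr//.
  rewrite mulrC -ler_pdivrMr ?divr_gt0//.
  near: n; exact: nbhs_infty_ger.
have sj := sV j.
have cV : c * V = e / 12 by rewrite /c; field; rewrite gt_eqF.
have i0 : 0 < n%:R^-1 :> R by rewrite invr_gt0.
have h1 : 2 * c * (n%:R^-1 * s j) <= n%:R^-1 * (e / 6).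
  have -> : 2 * c * (n%:R^-1 * s j) = n%:R^-1 * (2 * (c * s j)) by ring.
  rewrite ler_wpM2l ?(ltW i0)//.
  have : c * s j <= c * V by rewrite ler_wpM2l ?(ltW c0).
  by rewrite cV; lra.
have h2 : (n%:R^-1 * s j) ^+ 2 <= n%:R^-1 * (e / 3).
  have -> : (n%:R^-1 * s j) ^+ 2 = n%:R^-1 * (n%:R^-1 * s j ^+ 2) by ring.
  rewrite ler_wpM2l ?(ltW i0)//; apply: le_trans nV; rewrite ler_wpM2l ?(ltW i0)//.
  by rewrite ler_sqr ?nnegrE// ltW.
set a := n%:R^-1 in hex h1 h2 i0 *; set x := Ex P _ in hex *.
have -> : a * e = 2 * (8 * (a * (e / 48)) + a * (e / 6)) + a * (e / 3) by lra.
by rewrite lerD// ler_wpM2l// lerD// ler_wpM2l.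
Unshelve. all: by end_near. Qed.

End TrigCLT.

Lemma indic_preimageE (R : realType) (T U : Type) (f : T -> U) (A : set U) (x : T) :
  (\1_(f @^-1` A) x : R) = \1_A (f x).
Proof. by rewrite !indicE; congr (_%:R); apply/idP/idP => /set_mem h; exact/mem_set. Qed.

(** * Gaussian laws and vectors *)

Section NormalConvolution.
Context {R : realType}.
Local Notation mu := (@lebesgue_measure R).
Implicit Types (m s : R).

(** Both sides are measures in A with the same values on half-open intervals, and these determine
    Lebesgue measure. *)
Lemma lebesgue_measure_affine (a c : R) (A : set R) : 0 < a -> measurable A ->
  (a%:E * mu ((fun x => a * x + c)%R @^-1` A) = mu A)%E.
Proof.
move=> a0 mA.
have mf : measurable_fun setT (fun x : measurableTypeR R => a * x + c : measurableTypeR R).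
  by apply: measurable_funD => //; exact: measurable_funM.
pose f : {mfun measurableTypeR R >-> measurableTypeR R} :=
  HB.pack (fun x : measurableTypeR R => a * x + c) (isMeasurableFun.Build _ _ _ _ _ mf).
pose nu : {measure set (measurableTypeR R) -> \bar R} :=
  mscale (NngNum (ltW a0)) (pushforward mu f).
rewrite -[LHS]/(nu mf A); apply/esym.
apply: (@lebesgue_measure_unique R (nu mf)) => //= _ [[u v]] _ <-.
rewrite /nu/= /mscale/= /pushforward/=.
have -> : (fun x : R => a * x + c) @^-1` [set` `]u, v]] =
    [set` `](u - c) / a, (v - c) / a]].
  apply/seteqP; split => x /=; rewrite !in_itv/= ltr_pdivrMr// ler_pdivlMr//.
    by rewrite ltrBlDr lerBrDr mulrC.
  by rewrite ltrBlDr lerBrDr mulrC.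
rewrite !lebesgue_measure_itv/= !lte_fin ltr_pM2r ?invr_gt0// ltrD2r.
case: ifPn => _; last by rewrite mule0.
by rewrite -!EFinD -EFinM -mulrBl mulrC divfK ?gt_eqF//; congr (_ %:E); lra.
Qed.

Lemma ge0_integral_affine (a c : R) (f : R -> \bar R) : 0 < a ->
  measurable_fun setT f -> (forall x, 0 <= f x)%E ->
  (a%:E * \int[mu]_x f (a * x + c)%R = \int[mu]_x f x)%E.
Proof.
move=> a0 mf f0.
have mg : measurable_fun setT (fun x : measurableTypeR R => a * x + c : measurableTypeR R).
  by apply: measurable_funD => //; exact: measurable_funM.
pose g : {mfun measurableTypeR R >-> measurableTypeR R} :=
  HB.pack (fun x : measurableTypeR R => a * x + c) (isMeasurableFun.Build _ _ _ _ _ mg).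
pose nu : {measure set (measurableTypeR R) -> \bar R} :=
  mscale (NngNum (ltW a0)) (pushforward mu g).
rewrite [RHS](eq_measure_integral (nu mg)); last first.
  by move=> A mA _; apply/esym; exact: lebesgue_measure_affine.
rewrite ge0_integral_mscale//=.
by rewrite ge0_integral_pushforward.
Qed.

(** Integration against a dominated measure goes through its Radon-Nikodym derivative, which equals
    the normal density almost everywhere since both have the same integrals over measurable sets. *)
Lemma ge0_integral_normal_prob m s (f : R -> \bar R) :
  measurable_fun setT f -> (forall x, 0 <= f x)%E ->
  (\int[normal_prob m s]_x f x = \int[mu]_x (f x * (normal_pdf m s x)%:E))%E.
Proof.
move=> mf f0.
have dom := @normal_prob_dominates R m s.
rewrite -(Radon_Nikodym_SigmaFinite.change_of_variables dom)//.
apply: ae_eq_integral => //.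
- apply: emeasurable_funM => //.
  exact: measurable_int (Radon_Nikodym_SigmaFinite.f_integrable dom).
- by apply: emeasurable_funM => //; apply/measurable_EFinP; exact: measurable_normal_pdf.
- apply: ae_eqe_mul2l => /=.
  apply: integral_ae_eq => //=.
  + exact: (Radon_Nikodym_SigmaFinite.f_integrable dom).
  + by apply/measurable_EFinP; exact: measurable_normal_pdf.
  + by move=> E _ mE; rewrite -(Radon_Nikodym_SigmaFinite.f_integral dom).
Qed.

Lemma normal_peakE (u : R) : 0 < u -> normal_peak u = (u * Num.sqrt (pi *+ 2))^-1.
Proof.
move=> u0; rewrite /normal_peak -mulrnAr sqrtrM ?sqr_ge0//.
by rewrite sqrtr_sqr gtr0_norm.
Qed.

(** Bayes' rule for the sum z of two independent normals: the density of z times the conditional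
    density of the first summand, whose mean and deviation come from completing the square in x. *)
Lemma normal_pdfM (a b x z : R) : 0 < a -> 0 < b ->
  let s := Num.sqrt (a ^+ 2 + b ^+ 2) in
  normal_pdf 0 a x * normal_pdf 0 b (z - x) =
  normal_pdf 0 s z * normal_pdf (z * a ^+ 2 / (a ^+ 2 + b ^+ 2)) (a * b / s) x.
Proof.
move=> a0 b0 s.
have a20 : 0 < a ^+ 2 by rewrite exprn_gt0.
have b20 : 0 < b ^+ 2 by rewrite exprn_gt0.
have ab0 : 0 < a ^+ 2 + b ^+ 2 by rewrite addr_gt0.
have s0 : 0 < s by rewrite sqrtr_gt0.
have s2 : s ^+ 2 = a ^+ 2 + b ^+ 2 by rewrite sqr_sqrtr// ltW.
have t0 : 0 < a * b / s by rewrite divr_gt0// mulr_gt0.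
rewrite !normal_pdfE ?gt_eqF//.
rewrite !normal_peakE// mulrACA [RHS]mulrACA; congr (_ * _).
  have p0 : 0 < Num.sqrt (pi *+ 2 : R).
    by rewrite sqrtr_gt0 mulrn_wgt0// pi_gt0.
  by field; rewrite !gt_eqF.
rewrite /normal_fun -!expRD; congr expR.
rewrite exprMn exprVn s2 !mulr2n.
by field; rewrite !gt_eqF//= ?addr_gt0 ?mulr_gt0.
Qed.

Lemma measurable_translate (A : set R) (x : R) : measurable A ->
  measurable ((fun y => x + y) @^-1` A).
Proof.
move=> mA; rewrite -[X in measurable X]setTI.
have h : measurable_fun setT (fun y : R => x + y) by exact: measurable_funD.
exact: h.
Qed.

(** After Tonelli, [normal_pdfM] pulls out the density of the sum and leaves a conditional density
    of total mass 1. *)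
Lemma normal_prob_convolution (a b : R) (A : set R) : 0 < a -> 0 < b -> measurable A ->
  (\int[normal_prob 0 a]_x normal_prob 0 b ((fun y => x + y)%R @^-1` A) =
   normal_prob 0 (Num.sqrt (a ^+ 2 + b ^+ 2)) A)%E.
Proof.
move=> a0 b0 mA; set s := Num.sqrt _.
have ab0 : 0 < a ^+ 2 + b ^+ 2 by rewrite addr_gt0 ?exprn_gt0.
have s0 : 0 < s by rewrite sqrtr_gt0.
have mpdf m t : measurable_fun setT (fun x : R => (normal_pdf m t x)%:E).
  by apply/measurable_EFinP; exact: measurable_normal_pdf.
have mI : measurable_fun setT (fun x : R => (\1_A x : R)%:E).
  by apply/measurable_EFinP; exact: measurable_indic.
have pE m t (B : set R) : measurable B ->
    normal_prob m t B = (\int[mu]_y ((\1_B y)%:E * (normal_pdf m t y)%:E))%E.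
  move=> mB; rewrite /normal_prob integral_mkcond; apply: eq_integral => y _.
  rewrite patchE indicE; case: ifPn => _; first by rewrite mul1e.
  by rewrite mul0e.
have shiftE x : normal_prob 0 b ((fun y => x + y)%R @^-1` A) =
    (\int[mu]_z ((\1_A z)%:E * (normal_pdf 0 b (z - x))%:E))%E.
  rewrite pE; last exact: measurable_translate.
  rewrite -(@ge0_integral_affine 1 x (fun z => ((\1_A z)%:E * (normal_pdf 0 b (z - x))%:E)%E)).
  - rewrite mul1e; apply: eq_integral => y _.
    rewrite mul1r addrK !indicE; congr (_%:E * _)%E.
    suff -> : (y \in (fun y => x + y) @^-1` A) = (y + x \in A) by [].
    by apply/idP/idP => /set_mem h; apply/mem_set; move: h; rewrite /= addrC.
  - by [].
  - apply: emeasurable_funM => //; apply/measurable_EFinP.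
    by apply: (measurableT_comp (measurable_normal_pdf 0 b)); exact: measurable_funB.
  - by move=> z; rewrite mule_ge0// lee_fin ?normal_pdf_ge0// indicE; case: (_ \in _).
have mk : measurable_fun setT (fun z : R * R => ((\1_A z.2)%:E * (normal_pdf 0 b (z.2 - z.1) * normal_pdf 0 a z.1)%:E)%E).
  apply: emeasurable_funM.
    by apply: (measurableT_comp mI).
  apply/measurable_EFinP; apply: measurable_funM.
    by apply: (measurableT_comp (measurable_normal_pdf 0 b)); exact: measurable_funB.
  by apply: (measurableT_comp (measurable_normal_pdf 0 a)).
have I0 z : (0 <= (\1_A z : R)%:E)%E.
  by rewrite lee_fin indicE; case: (_ \in _).
under eq_integral do rewrite shiftE.
rewrite ge0_integral_normal_prob; last 2 first.
- have mg : measurable_fun setT (fun z : R * R => ((\1_A z.2)%:E * (normal_pdf 0 b (z.2 - z.1))%:E)%E).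
    apply: emeasurable_funM; first by apply: (measurableT_comp mI).
    apply/measurable_EFinP.
    by apply: (measurableT_comp (measurable_normal_pdf 0 b)); exact: measurable_funB.
  apply: (@measurable_fun_fubini_tonelli_F _ _ _ _ R mu _ mg) => z.
  by rewrite mule_ge0// lee_fin normal_pdf_ge0.
- move=> x; apply: integral_ge0 => z _; by rewrite mule_ge0// lee_fin normal_pdf_ge0.
transitivity (\int[mu]_x \int[mu]_z ((\1_A z)%:E * (normal_pdf 0 b (z - x) * normal_pdf 0 a x)%:E))%E.
  apply: eq_integral => x _; rewrite -ge0_integralZr//.
  - by apply: eq_integral => z _; rewrite EFinM muleA.
  - apply: emeasurable_funM => //; apply/measurable_EFinP.
    by apply: (measurableT_comp (measurable_normal_pdf 0 b)); exact: measurable_funB.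
  - by move=> z _; rewrite mule_ge0// lee_fin normal_pdf_ge0.
  - by rewrite lee_fin normal_pdf_ge0.
rewrite (@fubini_tonelli _ _ _ _ R mu mu _ mk); last first.
  by move=> z; rewrite mule_ge0// lee_fin mulr_ge0 ?normal_pdf_ge0.
rewrite pE//; apply: eq_integral => z _ /=.
rewrite ge0_integralZl//; last 2 first.
- apply/measurable_EFinP; apply: measurable_funM; last exact: measurable_normal_pdf.
  by apply: (measurableT_comp (measurable_normal_pdf 0 b)); exact: measurable_funB.
- by move=> x _; rewrite lee_fin mulr_ge0 ?normal_pdf_ge0.
congr (_ * _)%E.
under eq_integral do rewrite mulrC normal_pdfM// EFinM.
rewrite ge0_integralZl//; last 3 first.
- exact: mpdf.
- by move=> x _; rewrite lee_fin normal_pdf_ge0.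
- by rewrite lee_fin normal_pdf_ge0.
by rewrite integral_normal_pdf mule1.
Qed.

Lemma normal_prob_scale (a s : R) (A : set R) : 0 < a -> 0 < s -> measurable A ->
  normal_prob 0 s ((fun x => a * x) @^-1` A) = normal_prob 0 (a * s) A.
Proof.
move=> a0 s0 mA.
have mpdf t : measurable_fun setT (fun x : R => (normal_pdf 0 t x)%:E).
  by apply/measurable_EFinP; exact: measurable_normal_pdf.
have mI (B : set R) : measurable B -> measurable_fun setT (fun x : R => (\1_B x : R)%:E).
  by move=> mB; apply/measurable_EFinP; exact: measurable_indic.
have pE t (B : set R) : measurable B ->
    normal_prob 0 t B = (\int[mu]_y ((\1_B y)%:E * (normal_pdf 0 t y)%:E))%E.
  move=> mB; rewrite /normal_prob integral_mkcond; apply: eq_integral => y _.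
  rewrite patchE indicE; case: ifPn => _; first by rewrite mul1e.
  by rewrite mul0e.
have mA' : measurable ((fun x => a * x) @^-1` A).
  rewrite -[X in measurable X]setTI.
  have h : measurable_fun setT (fun y : R => a * y) by exact: measurable_funM.
  exact: h.
have pdf0 t x : (0 <= (normal_pdf 0 t x : R)%:E)%E by rewrite lee_fin normal_pdf_ge0.
have I0 (B : set R) z : (0 <= (\1_B z : R)%:E)%E.
  by rewrite lee_fin indicE; case: (_ \in _).
pose F z := ((\1_A z)%:E * (normal_pdf 0 (a * s) z)%:E)%E.
have mF : measurable_fun setT F by apply: emeasurable_funM => //; exact: mI.
have F0 z : (0 <= F z)%E by rewrite mule_ge0.
rewrite (pE (a * s) _ mA) -/F -(ge0_integral_affine 0 a0 mF F0) /F.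
rewrite (pE _ _ mA') -ge0_integralZl//.
- apply: eq_integral => x _; rewrite addr0 muleCA.
  suff -> : normal_pdf 0 s x = a * normal_pdf 0 (a * s) (a * x).
    rewrite EFinM; congr (_ * _)%E; congr (_%:E); exact: indic_preimageE.
  have as0 : 0 < a * s by rewrite mulr_gt0.
  rewrite !normal_pdfE ?gt_eqF// mulrA; congr (_ * _).
    have p0 : 0 < Num.sqrt (pi *+ 2 : R).
      by rewrite sqrtr_gt0 mulrn_wgt0// pi_gt0.
    by rewrite !normal_peakE//; field; rewrite !gt_eqF.
  rewrite /normal_fun !subr0; congr expR; rewrite !exprMn !mulr2n.
  by field; rewrite !gt_eqF//= ?addr_gt0 ?mulr_gt0 ?exprn_gt0.
- apply: emeasurable_funM.
    apply: (measurableT_comp (mI _ mA)).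
    by apply: measurable_funD => //; exact: measurable_funM.
  apply: (measurableT_comp (mpdf _)).
  by apply: measurable_funD => //; exact: measurable_funM.
- by move=> x _; rewrite mule_ge0.
- by rewrite lee_fin ltW.
Qed.

Lemma normal_prob_sym (s : R) (A : set R) : 0 < s -> measurable A ->
  normal_prob 0 s (-%R @^-1` A) = normal_prob 0 s A.
Proof.
move=> s0 mA.
have mA' : measurable (-%R @^-1` A).
  rewrite -[X in measurable X]setTI; exact: oppr_measurable.
rewrite /normal_prob.
transitivity (\int[pushforward mu (-%R : _ -> measurableTypeR R)]_(x in A)
   (normal_pdf 0 s x)%:E)%E.
  rewrite ge0_integral_pushforward//.
  - apply: eq_integral => x _ /=; rewrite !normal_pdfE ?gt_eqF//.
    by rewrite /normal_fun !subr0 sqrrN.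
  - apply: measurable_funTS; apply/measurable_EFinP; exact: measurable_normal_pdf.
  - by move=> x _; rewrite lee_fin normal_pdf_ge0.
by apply: eq_measure_integral => B mB _; exact: lebesgue_measureN.
Qed.

End NormalConvolution.

Section SameLaw.
Context {d1 d2 : measure_display} {T1 : measurableType d1} {T2 : measurableType d2}.
Context {R : realType}.
Variables (P1 : probability T1 R) (P2 : probability T2 R).
Variables (X : T1 -> R) (Y : T2 -> R).
Hypotheses (mX : measurable_fun setT X) (mY : measurable_fun setT Y).
Hypothesis XY : forall A, measurable A -> P1 (X @^-1` A) = P2 (Y @^-1` A).

Lemma ge0_integral_same_law (f : R -> \bar R) : measurable_fun setT f ->
  (forall x, 0 <= f x)%E -> (\int[P1]_w f (X w) = \int[P2]_w f (Y w))%E.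
Proof.
move=> mf f0.
pose X' : {mfun T1 >-> R} := HB.pack X (isMeasurableFun.Build _ _ _ _ X mX).
pose Y' : {mfun T2 >-> R} := HB.pack Y (isMeasurableFun.Build _ _ _ _ Y mY).
transitivity (\int[pushforward P1 X']_x f x)%E.
  by rewrite ge0_integral_pushforward.
transitivity (\int[pushforward P2 Y']_x f x)%E; last by rewrite ge0_integral_pushforward.
by apply: eq_measure_integral => A mA _; exact: XY.
Qed.

(** Reduction to nonnegative functions through positive and negative parts. *)
Lemma same_law_Ex (f : R -> R) : measurable_fun setT f -> L1 P1 (f \o X) ->
  L1 P2 (f \o Y) /\ Ex P1 (f \o X) = Ex P2 (f \o Y).
Proof.
move=> mf lf.
have lfY : L1 P2 (f \o Y).
  move: lf => /integrableP[_ h]; apply/integrableP; split.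
    by apply/measurable_EFinP; exact: measurableT_comp.
  rewrite -(ge0_integral_same_law (f := fun x => `|(f x)%:E|%E))//.
  by apply: measurableT_comp => //; exact/measurable_EFinP.
split=> //.
have mp : measurable_fun setT (fun x => Num.max (f x) 0) by exact: measurable_maxr.
have mn : measurable_fun setT (fun x => Num.max (- f x) 0).
  by apply: measurable_maxr => //; exact: measurable_funN.
have dec x : f x = Num.max (f x) 0 - Num.max (- f x) 0.
  by rewrite /Num.max; case: ltP => h1; case: ltP => h2; lra.
have ge0E (g : R -> R) : measurable_fun setT g -> (forall x, 0 <= g x) ->
    Ex P1 (g \o X) = Ex P2 (g \o Y).
  move=> mg g0; rewrite /Ex /Rintegral; congr fine.
  by apply: (ge0_integral_same_law (f := fun x => (g x)%:E)) => //; exact/measurable_EFinP.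
have absmax (y : R) : `|Num.max y 0| <= `|y|.
  by rewrite ger0_norm ?ge_max ?normr_ge0 ?ler_norm// le_max lexx orbT.
have lp (P : probability T1 R) : L1 P (f \o X) -> L1 P (fun w => Num.max (f (X w)) 0) /\
    L1 P (fun w => Num.max (- f (X w)) 0).
  move=> l; split; apply: L1_le (L1_norm l) _.
  - exact: measurableT_comp mp mX.
  - by move=> w; exact: absmax.
  - exact: measurableT_comp mn mX.
  - by move=> w; rewrite (le_trans (absmax _))// normrN.
have lq (P : probability T2 R) : L1 P (f \o Y) -> L1 P (fun w => Num.max (f (Y w)) 0) /\
    L1 P (fun w => Num.max (- f (Y w)) 0).
  move=> l; split; apply: L1_le (L1_norm l) _.
  - exact: measurableT_comp mp mY.
  - by move=> w; exact: absmax.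
  - exact: measurableT_comp mn mY.
  - by move=> w; rewrite (le_trans (absmax _))// normrN.
have [l1 l2] := lp P1 lf; have [l3 l4] := lq P2 lfY.
transitivity (Ex P1 (fun w => Num.max (f (X w)) 0 - Num.max (- f (X w)) 0)).
  by congr (Ex P1 _); apply/funext => w; exact: dec.
transitivity (Ex P2 (fun w => Num.max (f (Y w)) 0 - Num.max (- f (Y w)) 0)); last first.
  by congr (Ex P2 _); apply/funext => w; rewrite -dec.
rewrite !ExB//; congr (_ - _).
  by apply: (ge0E (fun x => Num.max (f x) 0)) => // x; rewrite le_max lexx orbT.
by apply: (ge0E (fun x => Num.max (- f x) 0)) => // x; rewrite le_max lexx orbT.
Qed.

End SameLaw.

(** * Centred normal laws indexed by the variance *)

Section GaussLaw.
Context {R : realType}.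

(** With the point mass at v = 0, variances add under convolution and scale by squares with no
    exception for degenerate laws. Negative v has no meaning and is excluded by hypotheses where it
    matters. *)
Definition gauss_law (v : R) : probability (measurableTypeR R) R :=
  if v == 0 then (\d_(0 : measurableTypeR R) : probability (measurableTypeR R) R)
  else (normal_prob 0 (Num.sqrt v) : probability (measurableTypeR R) R).

Lemma gauss_law0 : gauss_law 0 = (\d_(0 : measurableTypeR R) : probability (measurableTypeR R) R).
Proof. by rewrite /gauss_law eqxx. Qed.

Lemma gauss_lawN0 v : v != 0 -> gauss_law v = (normal_prob 0 (Num.sqrt v) : probability (measurableTypeR R) R).
Proof. by rewrite /gauss_law => /negbTE ->. Qed.

Definition is_gauss {d} {T : measurableType d} (P : probability T R) (X : T -> R) v :=
  measurable_fun setT X /\ forall A, measurable A -> P (X @^-1` A) = gauss_law v A.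

Lemma is_gauss_univariate_normal {d} {T : measurableType d} (P : probability T R) X v :
  0 <= v -> is_gauss P X v -> univariate_normal P X.
Proof.
move=> v0 [mX lX]; split=> //; have [v00|vN0] := eqVneq v 0.
  by left; exists 0 => A mA; rewrite lX// v00 gauss_law0.
right; exists 0, (Num.sqrt v); split; first by rewrite sqrtr_gt0 lt_def vN0.
by move=> A mA; rewrite lX// gauss_lawN0.
Qed.

(** The shifted sets are the sections of the planar event that x + y lies in A. *)
Lemma measurable_gauss_shift v (A : set R) : measurable A ->
  measurable_fun setT (fun x : measurableTypeR R => gauss_law v ((fun y : R => x + y) @^-1` A)).
Proof.
move=> mA; pose S := (fun z : measurableTypeR R * measurableTypeR R => z.1 + z.2 : R) @^-1` A.
have mS : measurable S.
  rewrite -[X in measurable X]setTI.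
  have h : measurable_fun setT (fun z : measurableTypeR R * measurableTypeR R => z.1 + z.2 : R).
    exact: measurable_funD.
  exact: h.
have := measurable_fun_xsection (gauss_law v) mS.
suff -> : gauss_law v \o xsection S = (fun x => gauss_law v ((fun y : R => x + y) @^-1` A)) by [].
apply/funext => x /=; congr (gauss_law v _); apply/seteqP; split => y; rewrite /xsection/=.
  exact: set_mem.
exact: mem_set.
Qed.

Lemma gauss_law_convolution u v (A : set R) : 0 <= u -> 0 <= v -> measurable A ->
  (\int[gauss_law u]_x gauss_law v ((fun y => x + y)%R @^-1` A) = gauss_law (u + v) A)%E.
Proof.
move=> u0 v0 mA.
have [->|uN0] := eqVneq u 0.
  rewrite gauss_law0 add0r integral_dirac//=; last exact: measurable_gauss_shift.
  rewrite diracT mul1e; congr (gauss_law v _).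
  by apply/seteqP; split => x /=; rewrite add0r.
have [->|vN0] := eqVneq v 0.
  rewrite addr0.
  transitivity (\int[gauss_law u]_x (\1_A x : R)%:E)%E; last by rewrite integral_indic// setIT.
  apply: eq_integral => x _; rewrite gauss_law0/= /dirac; congr (_%:E).
  by rewrite [LHS]indic_preimageE addr0.
have up : 0 < u by rewrite lt_def uN0.
have vp : 0 < v by rewrite lt_def vN0.
have uvN0 : u + v != 0 by rewrite gt_eqF// addr_gt0.
rewrite (gauss_lawN0 uN0) (gauss_lawN0 vN0) (gauss_lawN0 uvN0).
have su : 0 < Num.sqrt u by rewrite sqrtr_gt0.
have sv : 0 < Num.sqrt v by rewrite sqrtr_gt0.
by have := normal_prob_convolution su sv mA; rewrite (sqr_sqrtr u0) (sqr_sqrtr v0).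
Qed.

(** The product measure integrates the measures of sections, here those of shifts of A; transport to
    [gauss_law u] leaves the convolution formula. *)
Lemma is_gaussD {d1 d2} {T1 : measurableType d1} {T2 : measurableType d2}
    (P1 : probability T1 R) (P2 : probability T2 R) X Y u v : 0 <= u -> 0 <= v ->
  is_gauss P1 X u -> is_gauss P2 Y v ->
  is_gauss (P1 \x P2)%E (fun z => X z.1 + Y z.2) (u + v).
Proof.
move=> u0 v0 [mX lX] [mY lY].
have mXY : measurable_fun setT (fun z : T1 * T2 => X z.1 + Y z.2).
  by apply: measurable_funD; exact: measurableT_comp.
split; first exact: mXY.
move=> A mA; rewrite -gauss_law_convolution// [LHS]/(product_measure1 _ _ _) /product_measure1.
transitivity (\int[P1]_x gauss_law v ((fun y => X x + y)%R @^-1` A))%E.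
  apply: eq_integral => x _; rewrite /= -lY.
    congr (P2 _); apply/seteqP; split => y; rewrite /xsection/=; [exact: set_mem|exact: mem_set].
  exact: measurable_translate.
apply: (@ge0_integral_same_law _ _ _ _ _ P1 (gauss_law u) X idfun mX _ _
  (fun x => gauss_law v ((fun y : R => x + y) @^-1` A))).
- exact: measurable_id.
- exact: lX.
- exact: measurable_gauss_shift.
- by move=> x; exact: measure_ge0.
Qed.

Lemma gauss_law_scale a v (A : set R) : 0 <= v -> measurable A ->
  gauss_law v ((fun x => a * x) @^-1` A) = gauss_law (a ^+ 2 * v) A.
Proof.
move=> v0 mA.
have dirac_scale b : gauss_law 0 ((fun x => b * x) @^-1` A) = gauss_law 0 A.
  by rewrite gauss_law0/= /dirac; congr (_%:E); rewrite [LHS]indic_preimageE mulr0.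
have [->|vN0] := eqVneq v 0; first by rewrite mulr0.
have [->|aN0] := eqVneq a 0.
  rewrite expr0n/= mul0r gauss_law0/= diracE.
  have [A0|A0] := boolP (0 \in A).
    rewrite (_ : _ @^-1` _ = setT) ?probability_setT//.
    by apply/seteqP; split => // x _ /=; rewrite mul0r; exact: set_mem.
  rewrite (_ : _ @^-1` _ = set0) ?measure0//.
  by apply/seteqP; split => // x /=; rewrite mul0r => /mem_set; rewrite (negbTE A0).
have vp : 0 < v by rewrite lt_def vN0.
have sp : 0 < Num.sqrt v by rewrite sqrtr_gt0.
have avN0 : a ^+ 2 * v != 0 by rewrite mulf_neq0// expf_neq0.
rewrite (gauss_lawN0 vN0) (gauss_lawN0 avN0).
rewrite sqrtrM ?sqr_ge0// sqrtr_sqr.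
have [a0|a0|a0] := ltrgt0P a; last by rewrite a0 eqxx in aN0.
  exact: normal_prob_scale.
have na : 0 < - a by rewrite oppr_gt0.
have mA' : measurable (-%R @^-1` A).
  rewrite -[X in measurable X]setTI; exact: oppr_measurable.
transitivity (normal_prob 0 (- a * Num.sqrt v) (-%R @^-1` A)); last first.
  exact: normal_prob_sym (mulr_gt0 na sp) mA.
transitivity (normal_prob 0 (Num.sqrt v) ((fun x => - a * x) @^-1` (-%R @^-1` A))); last first.
  exact: normal_prob_scale na sp mA'.
by congr (normal_prob _ _ _); apply/seteqP; split => x /=; rewrite mulNr opprK.
Qed.

Lemma is_gaussZ {d} {T : measurableType d} (P : probability T R) X a v : 0 <= v ->
  is_gauss P X v -> is_gauss P (fun w => a * X w) (a ^+ 2 * v).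
Proof.
move=> v0 [mX lX]; split; first exact: measurable_funM.
move=> A mA; rewrite -gauss_law_scale// -lX//.
rewrite -[X in measurable X]setTI.
have h : measurable_fun setT (fun x : R => a * x) by exact: measurable_funM.
exact: h.
Qed.

(** Stated for all linear combinations, which is what the induction preserves. Each new coordinate
    is adjoined by a product with a line, hence the existential space. *)
Lemma std_normal_vector (k : nat) : exists (d : measure_display) (T : measurableType d)
  (P : probability T R) (z : 'I_k -> T -> R),
  forall a : 'I_k -> R, is_gauss P (fun w => \sum_i a i * z i w) (\sum_i a i ^+ 2).
Proof.
elim: k => [|k [d [T [P [z hz]]]]].
  exists _, (measurableTypeR R), (gauss_law 0), (fun i w => 0) => a.
  under eq_fun do rewrite big_ord0.
  rewrite big_ord0; split; first exact: measurable_cst.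
  move=> A mA; rewrite gauss_law0/= /dirac.
  by congr (_%:E); rewrite [LHS]indic_preimageE.
exists _, (measurableTypeR R * T)%type, (gauss_law 1 \x P)%E,
  (fun i (w : R * T) => if unlift ord0 i is Some j then z j w.2 else w.1) => a.
have h1 : is_gauss (gauss_law 1) (fun x => a ord0 * x) (a ord0 ^+ 2).
  rewrite -[X in is_gauss _ _ X]mulr1; apply: is_gaussZ => //; split => //.
have := is_gaussD (sqr_ge0 _) _ h1 (hz (fun j => a (lift ord0 j))).
rewrite big_ord_recl; set e1 := (X in is_gauss _ X _); set e2 := (X in _ -> is_gauss _ X _).
suff -> : e1 = e2 by apply; apply: sumr_ge0 => i _; exact: sqr_ge0.
rewrite /e1 /e2; apply/funext => w; rewrite big_ord_recl unlift_none; congr (_ + _).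
by apply: eq_bigr => i _; rewrite liftK.
Qed.

End GaussLaw.

(** * Moments and characteristic function of centred normal laws *)

Section GaussMoments.
Context {R : realType}.

Lemma expR_taylor1 (u : R) : `|expR u - 1 - u| <= u ^+ 2 * expR `|u|.
Proof.
have h1 := expR_ge1Dx u; have h2 := expR_ge1Dx (- u).
have e0 := expR_gt0 u; have a0 := expR_gt0 `|u|.
have uv : expR u * expR (- u) = 1 by rewrite -expRD subrr expR0.
have le_u : expR u <= expR `|u| by rewrite ler_expR ler_norm.
have one_le : 1 <= expR `|u| by have := expR_ge1Dx `|u|; have := normr_ge0 u; lra.
rewrite ger0_norm; last by lra.
have h3 : expR u - 1 <= u * expR u by nra.
have h4 : expR u - 1 - u <= u * (expR u - 1) by lra.
have [u0|u0] := leP 0 u; first by nra.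
have : u * (expR u - 1) <= u ^+ 2 by nra.
by have := sqr_ge0 u; nra.
Qed.

(* The symmetric difference quotient of [t |-> expR (t * x)] at 0. *)
Definition sinh_quot (h x : R) : R := (expR (h * x / 2) - expR (- (h * x / 2))) / h.

Lemma sinh_quot_approx h x : 0 < h -> h <= 1 ->
  `|sinh_quot h x - x| <= h * (x ^+ 2 / 2 * expR `|x|).
Proof.
move=> h0 h1; rewrite /sinh_quot; set u := h * x / 2.
have hx : x = (2 * u) / h by rewrite /u; field; rewrite gt_eqF.
have -> : (expR u - expR (- u)) / h - x =
    ((expR u - 1 - u) - (expR (- u) - 1 - (- u))) / h.
  by rewrite [X in _ / h - X]hx; field; rewrite gt_eqF.
rewrite normrM normfV (gtr0_norm h0) ler_pdivrMr//.
apply: le_trans (ler_normB _ _) _.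
apply: le_trans (lerD (expR_taylor1 u) (expR_taylor1 (- u))) _.
rewrite normrN sqrrN.
have hu : `|u| <= `|x|.
  rewrite /u 2!normrM (gtr0_norm h0) (_ : `|2^-1| = 2^-1); last by rewrite gtr0_norm.
  by have := normr_ge0 x; nra.
have he : expR `|u| <= expR `|x| by rewrite ler_expR.
have -> : h * (x ^+ 2 / 2 * expR `|x|) * h = 2 * (u ^+ 2 * expR `|x|) by rewrite /u; field.
by have := sqr_ge0 u; nra.
Qed.

(** A bound free of h and with finite Gaussian expectation: it dominates the quotients as h tends to
    0. *)
Lemma sinh_quot_bound h x : 0 < h -> h <= 1 ->
  `|sinh_quot h x| <= 2 * (expR (2 * x) + expR (- (2 * x))).
Proof.
move=> h0 h1.
have ha := sinh_quot_approx x h0 h1.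
have x1 := expR_ge1Dx `|x|; have x0 := normr_ge0 x.
have h2 : expR `|x| * expR `|x| = expR (2 * `|x|) by rewrite -expRD; congr expR; lra.
have h3 : expR (2 * `|x|) <= expR (2 * x) + expR (- (2 * x)).
  have e1 := expR_ge0 (2 * x); have e2 := expR_ge0 (- (2 * x)).
  by have [hx|hx] := leP 0 x; [rewrite ger0_norm//; lra|rewrite ltr0_norm// mulrN; lra].
have h4 : x ^+ 2 / 2 <= expR `|x|.
  have := expR_ge1Dxn 1 x0; rewrite /= real_normK ?num_real// (_ : 2`!%:R = 2 :> R)//; lra.
have h5 : h * (x ^+ 2 / 2 * expR `|x|) <= expR `|x| * expR `|x|.
  have e0 := expR_ge0 `|x|; have s0 := sqr_ge0 x.
  apply: (@le_trans _ _ (x ^+ 2 / 2 * expR `|x|)); last by rewrite ler_wpM2r.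
  by rewrite ler_piMl// mulr_ge0// divr_ge0.
have : `|sinh_quot h x| <= `|sinh_quot h x - x| + `|x|.
  by rewrite -{1}(subrK x (sinh_quot h x)) ler_normD.
have : `|x| <= expR `|x| * expR `|x| by nra.
lra.
Qed.

Lemma sinh_quot_cvg x : sinh_quot n.+1%:R^-1 x @[n --> \oo] --> x.
Proof.
apply: (@cvg_sub0 _ R _ _ _ (fun=> x)); last exact: cvg_cst.
apply/cvgr0Pnorm_le => e e0; near=> n.
have n0 : 0 < n.+1%:R^-1 :> R by rewrite invr_gt0.
have n1 : n.+1%:R^-1 <= 1 :> R by rewrite invf_le1 ?ler1n.
apply: le_trans (sinh_quot_approx x n0 n1) _.
rewrite mulrC ler_pdivrMr//; set a := _ * expR _.
rewrite mulrC -ler_pdivrMr//; apply: (@le_trans _ _ n%:R); last by rewrite ler_nat.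
near: n; exact: nbhs_infty_ger.
Unshelve. all: by end_near. Qed.

Section Moments.
Context {d : measure_display} {T : measurableType d} (P : probability T R).
Variables (X : T -> R) (v : R).
Hypotheses (v0 : 0 <= v) (gX : is_gauss P X v).

Let mX : measurable_fun setT X. Proof. by case: gX. Qed.

Let mexp t : measurable_fun setT (fun w => expR (t * X w)).
Proof.
apply: (measurableT_comp (f := expR)); first exact: measurable_expR.
exact: measurable_funM.
Qed.

(** Completing the square moves the mean of the density to vt and leaves the factor exp(t^2 v/2). *)
Lemma gauss_mgf t : L1 P (fun w => expR (t * X w)) /\
  Ex P (fun w => expR (t * X w)) = expR (t ^+ 2 * v / 2).
Proof.
have mf : measurable_fun setT (fun x : R => (expR (t * x))%:E).
  apply/measurable_EFinP; apply: (measurableT_comp (f := expR)).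
    exact: measurable_expR.
  exact: measurable_funM.
apply: L1_ge0; [exact: mexp|by move=> w; exact: expR_ge0|rewrite unlock].
transitivity (\int[gauss_law v]_x (expR (t * x))%:E)%E.
  apply: (@ge0_integral_same_law _ _ _ _ _ P (gauss_law v) X idfun mX _ _
    (fun x => (expR (t * x))%:E)).
  - exact: measurable_id.
  - by case: gX.
  - exact: mf.
  - by move=> x; rewrite lee_fin expR_ge0.
have [->|vN0] := eqVneq v 0.
  rewrite gauss_law0 integral_dirac//= diracT mul1e !mulr0 mul0r //.
have vp : 0 < v by rewrite lt_def vN0.
have s0 : Num.sqrt v != 0 by rewrite gt_eqF// sqrtr_gt0.
rewrite gauss_lawN0// ge0_integral_normal_prob//.
transitivity (\int[lebesgue_measure]_x ((expR (t ^+ 2 * v / 2))%:E *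
   (normal_pdf (v * t) (Num.sqrt v) x)%:E))%E.
  apply: eq_integral => x _; rewrite -!EFinM !normal_pdfE//; congr (_%:E).
  rewrite mulrCA [RHS]mulrCA; congr (_ * _).
  rewrite /normal_fun -!expRD sqr_sqrtr//; congr expR.
  by rewrite !mulr2n; field; rewrite -mulr2n mulrn_eq0.
rewrite ge0_integralZl//.
- by rewrite integral_normal_pdf mule1.
- by apply/measurable_EFinP; exact: measurable_normal_pdf.
- by move=> x _; rewrite lee_fin normal_pdf_ge0.
Qed.

Let lbound c : L1 P (fun w => 2 * (expR (c * X w) + expR (- (c * X w)))).
Proof.
apply: L1Z; apply: L1D; first exact: (gauss_mgf c).1.
by under eq_fun do rewrite -mulNr; exact: (gauss_mgf (- c)).1.
Qed.

Let msinh h : measurable_fun setT (fun w => sinh_quot h (X w)).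
Proof.
apply: measurable_funM => //; apply: measurable_funB.
  by under eq_fun do rewrite mulrAC; exact: mexp.
by under eq_fun do rewrite mulrAC -mulNr; exact: mexp.
Qed.

Let hn0 n : 0 < n.+1%:R^-1 :> R. Proof. by rewrite invr_gt0. Qed.

Let hn1 n : n.+1%:R^-1 <= 1 :> R. Proof. by rewrite invf_le1 ?ler1n. Qed.

(** The moment generating function is even, so the symmetric quotients have mean 0; dominated
    convergence passes to X. *)
Lemma gauss_mean : Ex P X = 0.
Proof.
have := @Ex_dominated _ _ _ P (fun n w => sinh_quot n.+1%:R^-1 (X w)) X _
  (fun n => msinh _) mX (lbound 2) (fun w : T => @sinh_quot_cvg (X w))
  (fun n (w : T) => sinh_quot_bound (X w) (hn0 n) (hn1 n)).
have E0 n : Ex P (fun w => sinh_quot n.+1%:R^-1 (X w)) = 0.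
  set h := n.+1%:R^-1.
  have [l1 e1] := gauss_mgf (h / 2); have [l2 e2] := gauss_mgf (- (h / 2)).
  transitivity (Ex P (fun w => h^-1 * (expR (h / 2 * X w) - expR (- (h / 2) * X w)))).
    congr (Ex P _); apply/funext => w; rewrite /sinh_quot mulrC.
    by congr (_ * (expR _ - expR _)); ring.
  by rewrite ExZ ?ExB ?e1 ?e2 ?sqrrN ?subrr ?mulr0//; exact: L1B.
under eq_fun do rewrite E0.
by move=> /cvg_unique; apply; [exact: norm_hausdorff|exact: cvg_cst].
Qed.

Lemma gauss_sqr_L1 : L1 P (fun w => X w ^+ 2).
Proof.
apply: L1_le (lbound 1) _ => [|w]; first exact: measurable_funX.
rewrite ger0_norm ?sqr_ge0// mul1r.
have x0 := normr_ge0 (X w).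
have h4 : X w ^+ 2 / 2 <= expR `|X w|.
  have := expR_ge1Dxn 1 x0; rewrite /= real_normK ?num_real// (_ : 2`!%:R = 2 :> R)//; lra.
have e1 := expR_ge0 (X w); have e2 := expR_ge0 (- X w).
move: h4; have [hx|hx] := leP 0 (X w); [rewrite ger0_norm// => h4; lra|].
by rewrite ltr0_norm// => h4; lra.
Qed.

(** The squared quotient has expectation (M(h) + M(-h) - 2)/h^2 for the moment generating function
    M, that is 2(exp(h^2 v/2) - 1)/h^2, which tends to v. *)
Lemma gauss_variance : Ex P (fun w => X w ^+ 2) = v.
Proof.
have mX2 : measurable_fun setT (fun w => X w ^+ 2) by exact: measurable_funX.
have bnd n w : `|sinh_quot n.+1%:R^-1 (X w) ^+ 2| <=
    4 * (2 * (expR (4 * X w) + expR (- (4 * X w)))).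
  rewrite normrX.
  have := sinh_quot_bound (X w) (hn0 n) (hn1 n).
  have -> : expR (4 * X w) = expR (2 * X w) ^+ 2 by rewrite expr2 -expRD; congr expR; lra.
  have -> : expR (- (4 * X w)) = expR (- (2 * X w)) ^+ 2 by rewrite expr2 -expRD; congr expR; lra.
  set q := `|_|; set a := expR _; set b := expR _ => h.
  have q0 : 0 <= q by exact: normr_ge0.
  have a0 : 0 <= a by exact: expR_ge0.
  have b0 : 0 <= b by exact: expR_ge0.
  by have := sqr_ge0 (a - b); nra.
have := @Ex_dominated _ _ _ P (fun n w => sinh_quot n.+1%:R^-1 (X w) ^+ 2) _ _
  (fun n => measurable_funX _ (msinh _)) mX2 (L1Z 4 (lbound 4)) _ bnd.
have pw w : sinh_quot n.+1%:R^-1 (X w) ^+ 2 @[n --> \oo] --> X w ^+ 2.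
  under eq_fun do rewrite expr2.
  by rewrite expr2; apply: cvgM; exact: sinh_quot_cvg.
move=> /(_ pw).
pose u n : R := n.+1%:R^-1 ^+ 2 * v / 2.
have EE n : Ex P (fun w => sinh_quot n.+1%:R^-1 (X w) ^+ 2) =
    (n.+1%:R^-1 ^+ 2)^-1 * (2 * (expR (u n) - 1)).
  set h := n.+1%:R^-1.
  have [l1 e1] := gauss_mgf h; have [l2 e2] := gauss_mgf (- h).
  transitivity (Ex P (fun w => (h ^+ 2)^-1 * (expR (h * X w) + expR (- h * X w) - 2))).
    congr (Ex P _); apply/funext => w; rewrite /sinh_quot expr_div_n mulrC; congr (_ * _).
    have -> : expR (h * X w) = expR (h * X w / 2) ^+ 2 by rewrite expr2 -expRD; congr expR; lra.
    have -> : expR (- h * X w) = expR (- (h * X w / 2)) ^+ 2 by rewrite expr2 -expRD; congr expR; lra.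
    have : expR (h * X w / 2) * expR (- (h * X w / 2)) = 1 by rewrite -expRD subrr expR0.
    by rewrite sqrrB => ->; rewrite mulr2n; lra.
  rewrite ExZ; last by apply: L1B; [exact: L1D|exact: L1_cst].
  rewrite ExB; [|exact: L1D|exact: L1_cst].
  by rewrite ExD// Ex_cst e1 e2 sqrrN /u -/h; congr (_ * _); lra.
under eq_fun do rewrite EE.
move=> /cvg_unique; apply; first exact: norm_hausdorff.
apply: (@cvg_sub0 _ R _ _ _ (fun=> v)); last exact: cvg_cst.
apply/cvgr0Pnorm_le => e e0; near=> n.
set h := n.+1%:R^-1 : R.
have h0 : 0 < h by exact: hn0.
have h1 : h <= 1 by exact: hn1.
have -> : (h ^+ 2)^-1 * (2 * (expR (u n) - 1)) - v =
   2 * (h ^+ 2)^-1 * (expR (u n) - 1 - u n).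
  by rewrite /u -/h; field; rewrite gt_eqF.
rewrite normrM ger0_norm; last by rewrite mulr_ge0// invr_ge0 sqr_ge0.
apply: (@le_trans _ _ (2 * (h ^+ 2)^-1 * (u n ^+ 2 * expR `|u n|))).
  rewrite ler_wpM2l ?expR_taylor1// mulr_ge0// invr_ge0 sqr_ge0//.
have un0 : 0 <= u n by rewrite divr_ge0// mulr_ge0// sqr_ge0.
have unv : u n <= v.
  have h21 : h ^+ 2 <= 1 by rewrite expr_le1// ltW.
  have hv : h ^+ 2 * v <= v by rewrite ler_piMl.
  have hu : u n + u n = h ^+ 2 * v by rewrite /u -splitr.
  by rewrite (le_trans _ hv)// -hu lerDl.
rewrite (ger0_norm un0).
have eu : expR (u n) <= expR v by rewrite ler_expR.
apply: (@le_trans _ _ (h * (v ^+ 2 / 2 * expR v))).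
  have -> : 2 * (h ^+ 2)^-1 * (u n ^+ 2 * expR (u n)) = h ^+ 2 * (v ^+ 2 / 2 * expR (u n)).
    by rewrite /u -/h; field; rewrite gt_eqF.
  have v2 : 0 <= v ^+ 2 / 2 by rewrite divr_ge0// sqr_ge0.
  apply: (@le_trans _ _ (h ^+ 2 * (v ^+ 2 / 2 * expR v))).
    by rewrite ler_wpM2l ?sqr_ge0// ler_wpM2l.
  have hh : h ^+ 2 <= h by rewrite expr2 ler_piMl// ltW.
  by rewrite ler_wpM2r// mulr_ge0// expR_ge0.
rewrite /h mulrC ler_pdivrMr//; set a := _ * expR _.
rewrite mulrC -ler_pdivrMr//; apply: (@le_trans _ _ n%:R); last by rewrite ler_nat.
near: n; exact: nbhs_infty_ger.
Unshelve. all: by end_near. Qed.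

End Moments.

Lemma exp_dist (a b : R) n : `|a| <= 1 -> `|b| <= 1 -> `|a ^+ n - b ^+ n| <= n%:R * `|a - b|.
Proof.
move=> a1 b1; elim: n => [|n ih]; first by rewrite !expr0 subrr normr0 mul0r.
rewrite !exprS.
have -> : a * a ^+ n - b * b ^+ n = a * (a ^+ n - b ^+ n) + (a - b) * b ^+ n by ring.
apply: le_trans (ler_normD _ _) _; rewrite !normrM normrX -natr1 mulrDl mul1r.
apply: lerD.
  by apply: le_trans ih; rewrite ler_piMl.
by rewrite ler_piMr// exprn_ile1.
Qed.

Section ProductMarginals.
Context {d1 d2 : measure_display} {T1 : measurableType d1} {T2 : measurableType d2}.
Variables (P1 : probability T1 R) (P2 : probability T2 R).

Lemma product_rect A B : measurable A -> measurable B ->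
  ((P1 \x P2) (A `*` B) = P1 A * P2 B)%E.
Proof. exact: product_measure1E. Qed.

Lemma product_marginal1 A : measurable A -> ((P1 \x P2) (fst @^-1` A) = P1 A)%E.
Proof.
move=> mA; rewrite (_ : fst @^-1` A = A `*` setT); last first.
  by apply/seteqP; split => z //= [].
by rewrite product_rect// probability_setT mule1.
Qed.

Lemma product_marginal2 A : measurable A -> ((P1 \x P2) (snd @^-1` A) = P2 A)%E.
Proof.
move=> mA; rewrite (_ : snd @^-1` A = setT `*` A); last first.
  by apply/seteqP; split => z //= [].
by rewrite product_rect// probability_setT mul1e.
Qed.

Lemma indep_product (X : T1 -> R) (Y : T2 -> R) : measurable_fun setT X ->
  measurable_fun setT Y ->
  indep_rv (P1 \x P2)%E (fun z => X z.1) (fun z => Y z.2).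
Proof.
move=> mX mY A B mA mB.
have mA' : measurable (X @^-1` A) by rewrite -[X in measurable X]setTI; exact: mX.
have mB' : measurable (Y @^-1` B) by rewrite -[X in measurable X]setTI; exact: mY.
transitivity (P1 (X @^-1` A) * P2 (Y @^-1` B))%E; first exact: product_rect.
by congr (_ * _)%E; apply/esym; [exact: (product_marginal1 mA')|exact: (product_marginal2 mB')].
Qed.

Lemma is_gauss_fst (X : T1 -> R) v : is_gauss P1 X v ->
  is_gauss (P1 \x P2)%E (fun z => X z.1) v.
Proof.
move=> [mX lX]; split; first exact: measurableT_comp.
move=> A mA; rewrite -lX//.
have mA' : measurable (X @^-1` A) by rewrite -[X in measurable X]setTI; exact: mX.
exact: (product_marginal1 mA').
Qed.

Lemma is_gauss_snd (Y : T2 -> R) v : is_gauss P2 Y v ->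
  is_gauss (P1 \x P2)%E (fun z => Y z.2) v.
Proof.
move=> [mY lY]; split; first exact: measurableT_comp.
move=> A mA; rewrite -lY//.
have mA' : measurable (Y @^-1` A) by rewrite -[X in measurable X]setTI; exact: mY.
exact: (product_marginal2 mA').
Qed.

End ProductMarginals.

Section Characteristic.

(** The characteristic function at frequency 1, as a function of the variance; by scaling it covers
    every frequency. It turns sums of variances into products, and its behaviour near 0 then
    determines it. *)
Let C v := Ex (gauss_law v) (fun x : R => cos x).

Let is_gauss_id v : is_gauss (gauss_law v) (fun x : R => x) v.
Proof. by split=> //; exact: measurable_id. Qed.

Lemma is_gauss_Ex {d} {T : measurableType d} (P : probability T R) X v (f : R -> R) :
  is_gauss P X v -> measurable_fun setT f -> L1 P (f \o X) ->
  Ex P (f \o X) = Ex (gauss_law v) f.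
Proof.
move=> [mX lX] mf lf.
have [_ ->] := @same_law_Ex _ _ _ _ _ P (gauss_law v) X idfun mX (@measurable_id _ _ _) lX f mf lf.
by [].
Qed.

Let mcosD b : measurable_fun setT (fun x : R => cos (b + x)).
Proof. by apply: continuous_measurable_fun; exact: continuous_cosD. Qed.

Let msinD b : measurable_fun setT (fun x : R => sin (b + x)).
Proof. by apply: continuous_measurable_fun; exact: continuous_sinD. Qed.

(** The law is invariant under x -> -x while the sine is odd. *)
Let gauss_sin v : 0 <= v -> Ex (gauss_law v) (fun x : R => sin (0 + x)) = 0.
Proof.
move=> v0; have g := is_gaussZ (-1) v0 (is_gauss_id v).
rewrite sqrrN expr1n mul1r in g.
have ms : measurable_fun setT (fun x : measurableTypeR R => sin (0 + x)) by exact: msinD.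
have l : L1 (gauss_law v) (fun x : R => sin (0 + -1 * x)).
  by apply: (L1_sinD _ 0); case: g.
have := is_gauss_Ex g (msinD 0) l.
rewrite (_ : (_ \o _) = (fun x : measurableTypeR R => -1 * sin (0 + x))); last first.
  by apply/funext => x /=; rewrite !add0r !mulN1r sinN.
rewrite ExZ; last by apply: (L1_sinD _ 0); exact: measurable_id.
by move: (Ex _ _) => e; lra.
Qed.

Let gauss_cosD {d} {T : measurableType d} (P : probability T R) X v b : 0 <= v ->
  is_gauss P X v -> Ex P (fun w => cos (b + X w)) = cos b * C v.
Proof.
move=> v0 gX; have mX : measurable_fun setT X by case: gX.
rewrite (is_gauss_Ex gX (mcosD b)); last exact: L1_cosD.
have mi : measurable_fun setT (fun x : measurableTypeR R => x : R) by exact: measurable_id.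
have lc := L1_cosD (gauss_law v) 0 mi; have ls := L1_sinD (gauss_law v) 0 mi.
transitivity (Ex (gauss_law v) (fun x : measurableTypeR R =>
    cos b * cos (0 + x) - sin b * sin (0 + x))).
  by congr Ex; apply/funext => x; rewrite !add0r cosD.
rewrite ExB ?ExZ//; try exact: L1Z.
rewrite gauss_sin// mulr0 subr0; congr (_ * Ex _ _).
by apply/funext => x; rewrite add0r.
Qed.

(** On the product of two Gaussian lines the coordinates are independent and their sum has variance
    u + v; the sine term of the addition formula vanishes. *)
Let C_add u v : 0 <= u -> 0 <= v -> C (u + v) = C u * C v.
Proof.
move=> u0 v0.
have g := is_gaussD u0 v0 (is_gauss_id u) (is_gauss_id v).
have := gauss_cosD 0 (addr_ge0 u0 v0) g; rewrite cos0 mul1r => <-.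
have m1 : measurable_fun setT (fun z : measurableTypeR R * measurableTypeR R => z.1 : R).
  exact: measurable_fst.
have m2 : measurable_fun setT (fun z : measurableTypeR R * measurableTypeR R => z.2 : R).
  exact: measurable_snd.
have i12 := indep_product (gauss_law u) (gauss_law v)
  (@measurable_id _ (measurableTypeR R) setT) (@measurable_id _ (measurableTypeR R) setT).
rewrite (Ex_cosD_indep 0 m1 m2 i12).
have law1 := is_gauss_fst (gauss_law v) (is_gauss_id u).
have law2 := is_gauss_snd (gauss_law u) (is_gauss_id v).
rewrite (gauss_cosD 0 u0 law1) cos0 mul1r.
have s2 : Ex (gauss_law u \x gauss_law v)%E
    (fun z : measurableTypeR R * measurableTypeR R => sin z.2) = 0.
  rewrite -(gauss_sin v0) -(is_gauss_Ex law2 (msinD 0)); last exact: (L1_sinD _ 0 m2).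
  by congr Ex; apply/funext => z /=; rewrite add0r.
rewrite s2 mulr0 subr0; congr (_ * _).
rewrite -[RHS]mul1r -cos0 -(gauss_cosD 0 v0 law2).
by congr Ex; apply/funext => z /=; rewrite add0r.
Qed.

Let C0 : C 0 = 1.
Proof.
have mc : measurable_fun setT (fun x : measurableTypeR R => (cos x)%:E).
  by apply/measurable_EFinP; apply: continuous_measurable_fun; exact: continuous_cos.
have h : (\int[\d_(0%R : measurableTypeR R)]_x (cos x)%:E = (cos 0)%:E)%E.
  by rewrite integral_dirac// diracT mul1e.
rewrite /C /Ex /Rintegral gauss_law0.
by transitivity (fine ((cos 0)%:E : \bar R)); [congr fine; exact: h|rewrite cos0].
Qed.

Let C_muln u n : 0 <= u -> C (n%:R * u) = C u ^+ n.
Proof.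
move=> u0; elim: n => [|n ih]; first by rewrite mul0r C0 expr0.
by rewrite -natr1 mulrDl mul1r C_add ?mulr_ge0// ih exprSr.
Qed.

Let C_le1 v : `|C v| <= 1.
Proof.
have mi : measurable_fun setT (fun x : measurableTypeR R => x : R) by exact: measurable_id.
have := Ex_cos_le1 (gauss_law v) 0 mi.
by under eq_fun do rewrite add0r.
Qed.

(** With N for [n.+1], the sequence is the expectation of N(cos(X/sqrt N) - 1), which tends
    pointwise to -X^2/2 and is dominated by X^2/2. *)
Let C_quadratic v : 0 <= v ->
  n.+1%:R * (C (n.+1%:R^-1 * v) - 1) @[n --> \oo] --> - (v / 2).
Proof.
move=> v0; pose X : measurableTypeR R -> R := idfun.
have N0 n : n.+1%:R != 0 :> R by rewrite pnatr_eq0.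
have gX : is_gauss (gauss_law v) X v := is_gauss_id v.
have mX : measurable_fun setT X by case: gX.
pose q n : R := (Num.sqrt n.+1%:R)^-1.
have q2 n : q n ^+ 2 = n.+1%:R^-1 by rewrite exprVn sqr_sqrtr.
have q0 n : 0 < q n by rewrite invr_gt0 sqrtr_gt0.
have mqX n : measurable_fun setT (fun w => q n * X w) by exact: measurable_funM.
have lc n : L1 (gauss_law v) (fun w => cos (q n * X w)).
  by apply: eq_L1 (L1_cosD _ 0 (mqX n)) => w; rewrite add0r.
have E n : n.+1%:R * (C (n.+1%:R^-1 * v) - 1) =
    Ex (gauss_law v) (fun w => n.+1%:R * (cos (q n * X w) - 1)).
  rewrite ExZ; last by apply: L1B => //; exact: L1_cst.
  rewrite ExB//; last exact: L1_cst.
  have qv0 : 0 <= q n ^+ 2 * v by rewrite mulr_ge0// sqr_ge0.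
  have := gauss_cosD 0 qv0 (is_gaussZ (q n) v0 gX); rewrite cos0 mul1r q2 => <-.
  by rewrite Ex_cst; under eq_fun do rewrite add0r.
under eq_fun do rewrite E.
have lX2 := gauss_sqr_L1 v0 gX.
have lX22 : L1 (gauss_law v) (fun w => 2^-1 * X w ^+ 2) by exact: L1Z.
have -> : - (v / 2) = Ex (gauss_law v) (fun w => - (2^-1 * X w ^+ 2)).
  transitivity (Ex (gauss_law v) (fun w => - 2^-1 * X w ^+ 2)).
    by rewrite ExZ// (gauss_variance v0 gX) mulNr mulrC.
  by congr Ex; apply/funext => w; rewrite mulNr.
apply: (Ex_dominated _ _ lX22).
- move=> n; apply: measurable_funM => //; apply: measurable_funB => //.
  exact: L1_measurable (lc n).
- by apply: measurable_funN; exact: L1_measurable lX22.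
- move=> w; apply: (@cvg_sub0 _ R _ _ _ (fun=> - (2^-1 * X w ^+ 2))); last exact: cvg_cst.
  apply/cvgr0Pnorm_le => e e0; near=> n.
  have -> : n.+1%:R * (cos (q n * X w) - 1) - - (2^-1 * X w ^+ 2) =
     n.+1%:R * (cos (q n * X w) - 1 + (q n * X w) ^+ 2 / 2).
    by rewrite exprMn q2; move: (n.+1%:R) (N0 n) => N NN0; field.
  rewrite normrM ger0_norm//.
  apply: le_trans (ler_wpM2l (ler0n _ _) (cos_taylor_cube _)) _.
  rewrite normrM (gtr0_norm (q0 n)) exprMn exprS q2.
  rewrite (_ : _ * _ = q n * `|X w| ^+ 3); last by move: (n.+1%:R) (N0 n) => N NN0; field.
  rewrite mulrC ler_pdivrMr ?sqrtr_gt0// mulrC -ler_pdivrMr//.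
  set t := _ / e.
  apply: (@le_trans _ _ (Num.sqrt (t ^+ 2))); first by rewrite sqrtr_sqr ler_norm.
  rewrite ler_sqrt//; apply: (@le_trans _ _ n%:R); last by rewrite ler_nat.
  near: n; exact: nbhs_infty_ger.
- move=> n w; rewrite normrM ger0_norm// distrC.
  have /andP[c0 c1] := one_sub_cos (q n * X w).
  rewrite ger0_norm//; apply: le_trans (ler_wpM2l (ler0n _ _) c1) _.
  by rewrite exprMn q2 le_eqVlt; apply/orP; left; apply/eqP; move: (n.+1%:R) (N0 n) => N NN0; field.
Unshelve. all: by end_near. Qed.

(* [C v = C (v / n) ^+ n] and [C (v / n) = 1 - v / (2 n) + o(1 / n)]. *)
Let C_exp v : 0 <= v -> C v = expR (- v / 2).
Proof.
move=> v0; apply/eqP; rewrite -subr_eq0 -normr_le0; apply/ler_addgt0Pl => e e0.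
rewrite addr0.
have e2 : 0 < e / 2 by rewrite divr_gt0.
have /cvgrPdist_le/(_ _ e2) hn := C_quadratic v0.
near \oo => n.
have n0 : 0 < n.+1%:R :> R by [].
have h : `|n.+1%:R * (C (n.+1%:R^-1 * v) - 1) + v / 2| <= e / 2.
  have hn' : `| - (v / 2) - n.+1%:R * (C (n.+1%:R^-1 * v) - 1)| <= e / 2.
    near: n; exact: hn.
  by move: hn'; rewrite -normrN opprB opprK.
set u := n.+1%:R^-1 * v in h *.
have u0 : 0 <= u by rewrite mulr_ge0.
have nu : n.+1%:R * u = v by rewrite /u mulrA divff ?mul1r// gt_eqF.
have := C_muln n.+1 u0; rewrite nu => ->.
have -> : expR (- v / 2) = expR (- u / 2) ^+ n.+1.
  by rewrite -expRM_natl; congr expR; rewrite -nu; ring.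
have e1 : `|expR (- u / 2)| <= 1.
  by rewrite ger0_norm ?expR_ge0// expR_le1; lra.
apply: le_trans (exp_dist _ (C_le1 u) e1) _.
rewrite -[X in X * _](ger0_norm (ltW n0)) -normrM.
have -> : n.+1%:R * (C u - expR (- u / 2)) = (n.+1%:R * (C u - 1) + v / 2) -
    n.+1%:R * (expR (- u / 2) - (1 - u / 2)).
  by rewrite -nu; ring.
apply: le_trans (ler_normB _ _) _; rewrite [leRHS]splitr; apply: lerD => //.
rewrite normrM (ger0_norm (ltW n0)).
apply: le_trans (ler_wpM2l (ltW n0) (expRN_taylor u0)) _.
rewrite expr2 mulrA nu /u mulrCA mulrC ler_pdivrMr//.
rewrite -ler_pdivrMl ?divr_gt0//; apply: (@le_trans _ _ n%:R); last by rewrite ler_nat.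
near: n; exact: nbhs_infty_ger.
Unshelve. all: by end_near. Qed.

Lemma gauss_characteristic {d} {T : measurableType d} (P : probability T R) X v b :
  0 <= v -> is_gauss P X v -> Ex P (fun w => cos (b + X w)) = cos b * expR (- v / 2).
Proof. by move=> v0 gX; rewrite (gauss_cosD b v0 gX) C_exp. Qed.

End Characteristic.

End GaussMoments.

(** * Positive semidefinite matrices and Gaussian vectors *)

Section PSDFactor.
Context {R : rcfType}.

Definition psd k (S : 'M[R]_k) := S^T = S /\ forall c : 'rV[R]_k, 0 <= (c *m S *m c^T) 0 0.

(** Cholesky factorization by the Schur complement of the first diagonal entry a. If a = 0 the rest
    of its row vanishes, and the convention 1/0 = 0 keeps the same formulas correct. *)
Lemma psd_factor k (S : 'M[R]_k) : psd S -> exists L : 'M[R]_k, S = L *m L^T.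
Proof.
elim: k S => [|k ih] S [symS posS].
  by exists 0; rewrite [LHS]flatmx0 [RHS]flatmx0.
pose S1 : 'M[R]_(1 + k) := S.
pose a := S1 0 0; pose b : 'rV[R]_k := ursubmx S1; pose D : 'M[R]_k := drsubmx S1.
have SE : S1 = block_mx a%:M b b^T D.
  rewrite -[LHS]submxK; congr block_mx.
    by rewrite [LHS]mx11_scalar !mxE; congr (_%:M); congr (S1 _ _); exact/val_inj.
  by rewrite /b trmx_ursub (_ : S1^T = S1).
have symD : D^T = D by rewrite /D trmx_drsub (_ : S1^T = S1).
(* The form at the row (x, y), as a quadratic polynomial in x. *)
have quad (x : R) (y : 'rV[R]_k) :
    0 <= x ^+ 2 * a + 2 * x * (b *m y^T) 0 0 + (y *m D *m y^T) 0 0.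
  have posS1 : forall c : 'rV[R]_(1 + k), 0 <= (c *m S1 *m c^T) 0 0 := posS.
  have := posS1 (row_mx x%:M y); rewrite SE.
  rewrite mul_row_block tr_row_mx tr_scalar_mx mul_row_col !mulmxDl.
  rewrite !mul_mx_scalar !mul_scalar_mx -scalemxAl.
  have yb : (y *m b^T) 0 0 = (b *m y^T) 0 0.
    by rewrite -[y *m b^T]trmxK trmx_mul trmxK mxE.
  have tD (M N : 'M[R]_1) : (M + N) 0 0 = M 0 0 + N 0 0 by rewrite mxE.
  have tZ (t : R) (M : 'M[R]_1) : (t *: M) 0 0 = t * M 0 0 by rewrite mxE.
  rewrite !tD !tZ yb (_ : x%:M 0 0 = x); last by rewrite mxE.
  move=> h; apply: le_trans h _; rewrite le_eqVlt; apply/orP; left; apply/eqP; ring.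
have a0 : 0 <= a.
  by have := quad 1 0; rewrite trmx0 mulmx0 mul0mx mul0mx !mxE mulr0 !addr0 expr1n mul1r.
(* With a = 0 the form is affine in x; if b had a nonzero entry, the chosen x would bring it to
   -1. *)
have b0 : a = 0 -> b = 0.
  move=> az; apply/rowP => j; rewrite [RHS]mxE; apply/eqP; apply: contraT => bj.
  have := quad (- (((delta_mx 0 j : 'rV_k) *m D *m (delta_mx 0 j : 'rV_k)^T) 0 0 + 1) / (2 * b 0 j))
    (delta_mx 0 j).
  have -> : (b *m (delta_mx 0 j : 'rV_k)^T) 0 0 = b 0 j.
    by rewrite trmx_delta -colE mxE.
  rewrite az mulr0 add0r; move: (_ 0 0) => t.
  have -> : 2 * (- (t + 1) / (2 * b 0 j)) * b 0 j + t = -1 by field.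
  by rewrite lerNr oppr0 ler10.
pose E := D - a^-1 *: (b^T *m b).
have psdE : psd E.
  split; first by rewrite /E linearB linearZ/= trmx_mul trmxK symD.
  (* For a nonzero this x minimizes the form, and the minimum is the Schur complement at y. *)
  move=> y; have := quad (- a^-1 * (b *m y^T) 0 0) y.
  set q := (b *m y^T) 0 0.
  have h11 : (y *m b^T *m (b *m y^T)) 0 0 = q ^+ 2.
    rewrite [LHS]mxE big_ord1 expr2; congr (_ * _).
    by rewrite -[y *m b^T]trmxK trmx_mul trmxK mxE.
  have -> : (y *m E *m y^T) 0 0 = (y *m D *m y^T) 0 0 - a^-1 * q ^+ 2.
    rewrite /E mulmxBr mulmxBl -scalemxAr -scalemxAl mulmxA -(mulmxA (y *m b^T)).
    by rewrite [LHS]mxE [X in _ + X]mxE [X in - X]mxE h11.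
  have [az|aN] := eqVneq a 0.
    by rewrite az invr0 oppr0 !(mul0r, mulr0) !add0r subr0.
  move=> h; apply: le_trans h _; rewrite le_eqVlt; apply/orP; left; apply/eqP.
  by field.
have [L' EL] := ih _ psdE.
pose L1 : 'M[R]_(1 + k) := block_mx (Num.sqrt a)%:M 0 ((Num.sqrt a)^-1 *: b^T) L'.
suff SL : S1 = L1 *m L1^T by exists L1.
rewrite SE /L1 tr_block_mx mulmx_block.
rewrite !trmx0 !mulmx0 !mul0mx !addr0 tr_scalar_mx -scalar_mxM -expr2 sqr_sqrtr//.
rewrite linearZ/= trmxK mul_scalar_mx mul_mx_scalar !scalerA.
have [az|aN] := eqVneq a 0.
  rewrite (b0 az) az sqrtr0 trmx0 !scaler0 !mul0mx add0r -EL /E (b0 az) trmx0 mul0mx scaler0 subr0 //.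
have sa : Num.sqrt a != 0 by rewrite sqrtr_eq0 -ltNge lt_def aN.
rewrite divff// !scale1r -scalemxAr -scalemxAl scalerA -invfM -expr2 sqr_sqrtr//.
by rewrite -EL /E addrC subrK.
Qed.

End PSDFactor.

Section GaussianVector.
Context {R : realType}.

Lemma gaussian_vector_exists k (S : 'M[R]_k) : psd S ->
  exists (d : measure_display) (T : measurableType d) (P : probability T R)
    (V : T -> 'cV[R]_k),
    forall c : 'rV[R]_k, is_gauss P (fun w => (c *m V w) 0 0) ((c *m S *m c^T) 0 0).
Proof.
move=> /psd_factor[L SL]; have [d [T [P [z hz]]]] := std_normal_vector (R := R) k.
exists d, T, P, (fun w => L *m \col_i z i w) => c.
have := hz (fun i => (c *m L) 0 i).
have -> : \sum_i (c *m L) 0 i ^+ 2 = (c *m S *m c^T) 0 0.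
  rewrite SL mulmxA -mulmxA -trmx_mul [RHS]mxE; apply: eq_bigr => i _.
  by rewrite expr2; congr (_ * _); rewrite [RHS]mxE.
congr (is_gauss _ _ _); apply/funext => w; rewrite mulmxA [RHS]mxE.
by apply: eq_bigr => i _; congr (_ * _); rewrite mxE.
Qed.

Section Properties.
Context {d : measure_display} {T : measurableType d} (P : probability T R).
Variables (k : nat) (S : 'M[R]_k) (V : T -> 'cV[R]_k).
Hypothesis psdS : psd S.
Hypothesis gV : forall c : 'rV[R]_k, is_gauss P (fun w => (c *m V w) 0 0) ((c *m S *m c^T) 0 0).

Lemma gaussian_coord i : is_gauss P (fun w => V w i 0) (S i i).
Proof.
have := gV (delta_mx 0 i).
rewrite -rowE trmx_delta -colE !mxE; congr (is_gauss _ _ _).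
by apply/funext => w; rewrite -rowE mxE.
Qed.

Let S0 i : 0 <= S i i.
Proof. by have := psdS.2 (delta_mx 0 i); rewrite -rowE trmx_delta -colE !mxE. Qed.

Lemma gaussian_coord_sqr i :
  L1 P (fun w => V w i 0 ^+ 2) /\ Ex P (fun w => V w i 0 ^+ 2) = S i i.
Proof.
split; first exact: gauss_sqr_L1 (S0 i) (gaussian_coord i).
exact: gauss_variance (S0 i) (gaussian_coord i).
Qed.

Lemma gaussian_multivariate_normal : multivariate_normal P V 0 S.
Proof.
have mV i : measurable_fun setT (fun w => V w i 0) by have [] := gaussian_coord i.
have lV i := (gaussian_coord_sqr i).1.
have l1 i : L1 P (fun w => V w i 0) by exact: integrable_sqr_L1.
have E0 i : Ex P (fun w => V w i 0) = 0 := gauss_mean (S0 i) (gaussian_coord i).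
split.
- by move=> i j; rewrite ord1.
- by move=> c; apply: is_gauss_univariate_normal (gV c); exact: psdS.2.
- by move=> i; rewrite expectationE// E0 mxE.
move=> i j; rewrite unlock (expectationE (l1 i)) (expectationE (l1 j)) /= !E0.
have -> : ((fun w => V w i 0) \- cst 0) * ((fun w => V w j 0) \- cst 0) =
    (fun w => V w i 0 * V w j 0).
  by apply/funext => w; rewrite fctE /= !subr0.
have lij : L1 P (fun w => V w i 0 * V w j 0) by exact: L1M_sqr.
rewrite (expectationE lij); congr (_%:E).
(* Covariances by polarization: the variance of V_i + V_j is known from its Gaussian law. *)
pose c : 'rV[R]_k := delta_mx 0 i + delta_mx 0 j.
have cV w : (c *m V w) 0 0 = V w i 0 + V w j 0.
  by rewrite mulmxDl -!rowE !mxE.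
have cS : (c *m S *m c^T) 0 0 = S i i + S j j + 2 * S i j.
  have Sji : S j i = S i j by rewrite -[in LHS]psdS.1 mxE.
  rewrite /c linearD/= !trmx_delta !mulmxDl !mulmxDr -!rowE -!colE !mxE Sji; ring.
have := gauss_variance (psdS.2 c) (gV c).
rewrite cS (_ : (fun w => _) = (fun w => V w i 0 ^+ 2 + V w j 0 ^+ 2 + 2 * (V w i 0 * V w j 0))); last first.
  by apply/funext => w; rewrite cV; ring.
rewrite ExD; [|exact: L1D|exact: L1Z].
rewrite ExD// ExZ// !(gaussian_coord_sqr _).2.
by move: (Ex _ _) => e; lra.
Qed.

End Properties.
End GaussianVector.

(** * Approximation by trigonometric polynomials *)

Section Bernstein.
Context {R : realType}.
Implicit Types (y : R) (N k : nat).

(* The binomial weights, through the Pascal recursion: the moments below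
   then need no identities on binomial coefficients. *)
Fixpoint bern (N k : nat) (y : R) : R :=
  if N is N'.+1 then y * (if k is k'.+1 then bern N' k' y else 0) + (1 - y) * bern N' k y
  else (k == 0)%:R.

Lemma bern_ge0 N k y : 0 <= y <= 1 -> 0 <= bern N k y.
Proof.
move=> /andP[y0 y1]; elim: N k => [|N ih] k /=; first exact: ler0n.
by rewrite addr_ge0// mulr_ge0 ?subr_ge0//; case: k.
Qed.

Lemma bern_out N k y : (N < k)%N -> bern N k y = 0.
Proof.
elim: N k => [|N ih] [|k] //=; rewrite ltnS => Nk.
by rewrite ih// ih ?mulr0 ?addr0// ltnW.
Qed.

(** Conditioning on one further trial, whose success moves the argument of g up by one; the moments
    below are inductions on this identity. *)
Lemma sum_bernS (g : nat -> R) N y :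
  \sum_(k < N.+2) g k * bern N.+1 k y =
  y * \sum_(k < N.+1) g k.+1 * bern N k y + (1 - y) * \sum_(k < N.+1) g k * bern N k y.
Proof.
under eq_bigr do rewrite /= mulrDr mulrCA [X in _ + X]mulrCA.
rewrite big_split/= -!mulr_sumr; congr (_ * _ + _ * _).
  by rewrite big_ord_recl/= mulr0 add0r.
by rewrite big_ord_recr/= bern_out// mulr0 addr0.
Qed.

Lemma sum_bern N y : \sum_(k < N.+1) bern N k y = 1.
Proof.
under eq_bigr do rewrite -[bern _ _ _]mul1r.
elim: N => [|N ih]; first by rewrite big_ord1 mul1r.
by rewrite (sum_bernS (fun=> 1)) ih !mulr1 addrC subrK.
Qed.

(** The centre c is left free because a success shifts it by one in the induction. *)
Lemma sum_bern_sqr N y c :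
  \sum_(k < N.+1) (k%:R - c) ^+ 2 * bern N k y = N%:R * y * (1 - y) + (N%:R * y - c) ^+ 2.
Proof.
elim: N c => [|N ih] c; first by rewrite big_ord1 /=; ring.
rewrite (sum_bernS (fun k => (k%:R - c) ^+ 2)) ih.
have -> : \sum_(k < N.+1) (k.+1%:R - c) ^+ 2 * bern N k y =
    \sum_(k < N.+1) (k%:R - (c - 1)) ^+ 2 * bern N k y.
  by apply: eq_bigr => k _; rewrite -natr1; congr (_ ^+ 2 * _); ring.
rewrite ih -natr1; ring.
Qed.

Lemma sum_bern_variance N y : (0 < N)%N -> 0 <= y <= 1 ->
  \sum_(k < N.+1) (k%:R / N%:R - y) ^+ 2 * bern N k y <= N%:R^-1.
Proof.
move=> N0 /andP[y0 y1]; have NN : N%:R != 0 :> R by rewrite pnatr_eq0 -lt0n.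
have -> : \sum_(k < N.+1) (k%:R / N%:R - y) ^+ 2 * bern N k y =
    N%:R ^- 2 * \sum_(k < N.+1) (k%:R - N%:R * y) ^+ 2 * bern N k y.
  rewrite mulr_sumr; apply: eq_bigr => k _; rewrite mulrA; congr (_ * _).
  by field.
rewrite sum_bern_sqr subrr expr0n/= addr0.
have -> : N%:R ^- 2 * (N%:R * y * (1 - y)) = N%:R^-1 * (y * (1 - y)) by field.
by rewrite ler_piMr ?invr_ge0//; nra.
Qed.

(** For v <= u, with A half the difference and B half the sum, the two sides are 2 sin^2 A and 2 cos
    B sin A, and |B| + A <= pi/2 gives sin A <= cos B. *)
Lemma sin_separation (u v : R) : - (pi / 2) <= u <= pi / 2 -> - (pi / 2) <= v <= pi / 2 ->
  1 - cos (u - v) <= `|sin u - sin v|.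
Proof.
wlog vu : u v / v <= u.
  move=> h hu hv; have [vu|uv] := leP v u; first exact: h.
  by rewrite -cosN opprB distrC; apply: h => //; exact: ltW.
move=> /andP[u1 u2] /andP[v1 v2].
pose A := (u - v) / 2; pose B := (u + v) / 2.
have pi0 := @pi_gt0 R.
have A0 : 0 <= A by rewrite divr_ge0// subr_ge0.
have Ap : A <= pi / 2 by rewrite /A; lra.
have BA : `|B| + A <= pi / 2 by rewrite /A /B -lerBrDr ler_norml; apply/andP; split; lra.
have sA : 0 <= sin A by apply: sin_ge0_pi; rewrite A0/=; lra.
have cB : sin A <= cos B.
  have -> : sin A = cos (pi / 2 - A) by rewrite -cosN opprB cosBpihalf.
  rewrite -(cos_norm B); have [->//|ne] := eqVneq `|B| (pi / 2 - A).
  apply: ltW; rewrite ltr_cos ?in_itv/=; first by rewrite lt_neqAle ne; lra.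
    by have := normr_ge0 B; move=> ?; apply/andP; split; lra.
  by apply/andP; split; lra.
have -> : u = B + A by rewrite /A /B; lra.
have -> : v = B - A by rewrite /A /B; lra.
rewrite sinD sinB.
have -> : sin B * cos A + cos B * sin A - (sin B * cos A - cos B * sin A) =
    2 * (cos B * sin A) by ring.
have -> : B + A - (B - A) = A *+ 2 by rewrite mulr2n; ring.
rewrite cos_mulr2n cos2sin2 ger0_norm; last first.
  by rewrite mulr_ge0// mulr_ge0// (le_trans sA).
by rewrite mulr2n expr2; nra.
Qed.

End Bernstein.

(** * Uniform approximation on boxes *)

Section TrigPolynomials.
Context {R : realType} {K : nat}.
Implicit Types (g h : 'rV[R]_K -> R) (t : 'rV[R]_K).

(** The phases make sines available and, by the product-to-sum formula, the class closed under
    products. The inductive form lets convergence on cosines pass to the whole class. *)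
Inductive trig_poly : ('rV[R]_K -> R) -> Prop :=
| trig_cos b t : trig_poly (fun x => cos (b + (t *m x^T) 0 0))
| trig_add g h : trig_poly g -> trig_poly h -> trig_poly (fun x => g x + h x)
| trig_scale c g : trig_poly g -> trig_poly (fun x => c * g x).

Lemma trig_cst c : trig_poly (fun=> c).
Proof.
have := trig_scale c (trig_cos 0 0).
by congr trig_poly; apply/funext => x; rewrite mul0mx mxE addr0 cos0 mulr1.
Qed.

Lemma trig_mul g h : trig_poly g -> trig_poly h -> trig_poly (fun x => g x * h x).
Proof.
move=> tg; elim: tg h => [b t|g1 g2 _ ih1 _ ih2|c g1 _ ih] h th.
- elim: th => [b' t'|h1 h2 _ ih1 _ ih2|c h1 _ ih].
  + have := trig_add (trig_scale 2^-1 (trig_cos (b + b') (t + t')))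
                     (trig_scale 2^-1 (trig_cos (b - b') (t - t'))).
    congr trig_poly; apply/funext => x; rewrite mulmxDl mulmxBl.
    have -> : (t *m x^T + t' *m x^T) 0 0 = (t *m x^T) 0 0 + (t' *m x^T) 0 0 by rewrite mxE.
    have -> : (t *m x^T - t' *m x^T) 0 0 = (t *m x^T) 0 0 - (t' *m x^T) 0 0 by rewrite !mxE.
    set p := (t *m x^T) 0 0; set q := (t' *m x^T) 0 0.
    have -> : b + b' + (p + q) = (b + p) + (b' + q) by ring.
    have -> : b - b' + (p - q) = (b + p) - (b' + q) by ring.
    by rewrite cosD cosB; lra.
  + by have := trig_add ih1 ih2; congr trig_poly; apply/funext => x; rewrite mulrDr.
  + by have := trig_scale c ih; congr trig_poly; apply/funext => x; rewrite mulrCA.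
- by have := trig_add (ih1 h th) (ih2 h th); congr trig_poly; apply/funext => x; rewrite mulrDl.
- by have := trig_scale c (ih h th); congr trig_poly; apply/funext => x; rewrite mulrA.
Qed.

Lemma trig_sum (I : Type) (s : seq I) (g : I -> 'rV[R]_K -> R) :
  (forall i, trig_poly (g i)) -> trig_poly (fun x => \sum_(i <- s) g i x).
Proof.
move=> tg; elim: s => [|i s ih].
  by have := trig_cst 0; congr trig_poly; apply/funext => x; rewrite big_nil.
by have := trig_add (tg i) ih; congr trig_poly; apply/funext => x; rewrite big_cons.
Qed.

Lemma trig_prod (I : Type) (s : seq I) (g : I -> 'rV[R]_K -> R) :
  (forall i, trig_poly (g i)) -> trig_poly (fun x => \prod_(i <- s) g i x).
Proof.
move=> tg; elim: s => [|i s ih].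
  by have := trig_cst 1; congr trig_poly; apply/funext => x; rewrite big_nil.
by have := trig_mul (tg i) ih; congr trig_poly; apply/funext => x; rewrite big_cons.
Qed.

Lemma trig_bern g N k : trig_poly g -> trig_poly (fun x => bern N k (g x)).
Proof.
move=> tg; elim: N k => [|N ih] k /=; first exact: trig_cst.
apply: trig_add; apply: trig_mul => //.
  by case: k => [|k]; [exact: trig_cst|exact: ih].
by apply: trig_add; [exact: trig_cst|have := trig_scale (-1) tg; congr trig_poly;
  apply/funext => x; rewrite mulN1r].
Qed.

(** A sine moved into [0, 1], where Bernstein weights are nonnegative; injective as long as |w u| <=
    pi/2. *)
Definition squash (w : R) (u : R) : R := (1 + sin (w * u)) / 2.

Lemma squash01 w u : 0 <= squash w u <= 1.
Proof. by rewrite /squash; have := sin_geN1 (w * u); have := sin_le1 (w * u); lra. Qed.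

Lemma trig_squash w i : trig_poly (fun x => squash w (x 0 i)).
Proof.
have := trig_add (trig_cst 2^-1) (trig_scale 2^-1 (trig_cos (- (pi / 2)) (w *: delta_mx 0 i))).
congr trig_poly; apply/funext => x.
rewrite -scalemxAl -rowE [X in cos (_ + X)]mxE [row i _ 0 0]mxE [x^T i 0]mxE.
by rewrite [- (pi / 2) + _]addrC cosBpihalf /squash; lra.
Qed.

(** Heine-Cantor by the near-covering form of compactness; only one of the two points is confined to
    the box. *)
Lemma box_unif_continuous (f : 'rV[R]_K -> R) (L e : R) : continuous f -> 0 < e ->
  exists2 d, 0 < d & forall x x' : 'rV[R]_K, (forall i, `|x 0 i| <= L) ->
    (forall i, `|x 0 i - x' 0 i| < d) -> `|f x - f x'| <= e.
Proof.
move=> cf e0.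
pose A := [set v : 'rV[R]_K | forall i, `[- L, L]%classic (v ord0 i)].
have cA : compact A by apply: (@rV_compact R K (fun=> `[- L, L]%classic)) => i; exact: segment_compact.
pose Q (d : R) (x : 'rV[R]_K) := forall x' : 'rV[R]_K,
  (forall i, `|x 0 i - x' 0 i| < d) -> `|f x - f x'| <= e.
have /compact_near_coveringP/(_ _ (0 : R)^'+ Q) := cA.
have step x : A x -> \forall x' \near x & d \near (0 : R)^'+, Q d x'.
  move=> _; have /cvgrPdist_lt/(_ _ (divr_gt0 e0 (ltr0Sn R 1))) := cf x.
  move=> /nbhs_ballP[r /= r0 hr].
  (* Half the radius for the distance from x to y, half for that from y to x'. *)
  have r20 : 0 < r / 2 by rewrite divr_gt0.
  exists (ball x (r / 2), [set d | d <= r / 2]) => /=.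
    split; first exact: nbhsx_ballx.
    by near=> d; near: d; exact: nbhs_right_le.
  move=> [y d] /= [xy dr] x' yx'.
  have hy : ball x r y by apply: le_ball xy; lra.
  have hx' : ball x r x'.
    case: xy => _ xy; split => // i j; rewrite !ord1.
    have := xy 0 j; have := yx' j; rewrite /ball/= => h1 h2.
    have -> : x 0 j - x' 0 j = (x 0 j - y 0 j) + (y 0 j - x' 0 j) by ring.
    by apply: le_lt_trans (ler_normD _ _) _; lra.
  have h1 := hr _ hy; have h2 := hr _ hx'; rewrite /= in h1 h2.
  have -> : f y - f x' = (f x - f x') - (f x - f y) by ring.
  by apply: le_trans (ler_normB _ _) _; lra.
move=> /(_ _ step) H; near (0 : R)^'+ => d.
exists d => // x x' xL xx'.
have HQ : A `<=` Q d by near: d; exact: H.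
by apply: HQ => // i; rewrite /= in_itv/= -ler_norml.
Unshelve. all: by end_near. Qed.

(** The approximant is an average of values of f, which gives the bound C on the whole space and
    makes points outside the box harmless in expectations. *)
Theorem trig_approx (f : 'rV[R]_K -> R) (C L e : R) : continuous f ->
  (forall x, `|f x| <= C) -> 0 < L -> 0 < e ->
  exists g, [/\ trig_poly g, forall x, `|g x| <= C
    & forall x : 'rV[R]_K, (forall i, `|x 0 i| <= L) -> `|f x - g x| <= e].
Proof.
move=> cf fC L0 e0.
have e20 : 0 < e / 2 by rewrite divr_gt0.
have [d0 d00 hd0] := box_unif_continuous L cf e20.
have pi0 := @pi_gt0 R.
(* The frequency that maps [-L, L] onto [-pi/2, pi/2], where the sine is injective. *)
pose w := pi / 2 / L; have w0 : 0 < w by rewrite divr_gt0// divr_gt0.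
(* Capped at L so that w d stays where the cosine decreases. *)
pose d := Num.min d0 L.
have dp : 0 < d by rewrite lt_min d00.
have wd0 : 0 < w * d by rewrite mulr_gt0.
have wdpi : w * d <= pi / 2.
  apply: (@le_trans _ _ (w * L)); first by rewrite ler_wpM2l ?(ltW w0)// ge_min lexx orbT.
  by rewrite /w divfK// gt_eqF.
(* By [sin_separation], points of [-L, L] at distance at least d have [squash] values at least eta
   apart. *)
pose eta := (1 - cos (w * d)) / 2.
have eta0 : 0 < eta.
  rewrite divr_gt0// subr_gt0 -[ltRHS]cos0 ltr_cos// in_itv/=; first by rewrite lexx ltW.
  by rewrite (ltW wd0)/=; lra.
have C0 : 0 <= C by apply: le_trans (fC 0); exact: normr_ge0.
(* N >= M makes the Chebyshev term (2C/eta^2)(K/N) at most e/2. *)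
pose M := 2 * C / eta ^+ 2 * K%:R / (e / 2).
have M0 : 0 <= M.
  by rewrite !mulr_ge0 ?invr_ge0 ?sqr_ge0// ltW.
pose N := (Num.truncn M).+1.
have N0 : (0 < N)%N by [].
have MN : M <= N%:R by apply: ltW; exact: truncnS_gt.
(* The node whose [squash] value is k/N. *)
pose X (k : nat) : R := asin (2 * (k%:R / N%:R) - 1) / w.
have XN (k : 'I_N.+1) : (-1 : R) <= 2 * (k%:R / N%:R) - 1 <= (1 : R).
  have k0 : 0 <= k%:R / N%:R :> R by rewrite divr_ge0.
  have k1 : k%:R / N%:R <= 1 :> R by rewrite ler_pdivrMr ?ltr0n// mul1r ler_nat -ltnS.
  by lra.
have sX (k : 'I_N.+1) : squash w (X k) = k%:R / N%:R.
  rewrite /squash /X [w * _]mulrC divfK ?gt_eqF// asinK ?in_itv ?XN//=; lra.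
have sep (u : R) (k : 'I_N.+1) : `|u| <= L -> d <= `|u - X k| ->
    eta <= `|squash w u - k%:R / N%:R|.
  move=> uL duX; rewrite -sX /squash.
  have -> : (1 + sin (w * u)) / 2 - (1 + sin (w * X k)) / 2 = (sin (w * u) - sin (w * X k)) / 2 by lra.
  rewrite normrM (_ : `|2^-1| = 2^-1); last by rewrite gtr0_norm.
  rewrite /eta ler_pM2r ?invr_gt0//.
  have wu : - (pi / 2) <= w * u <= pi / 2.
    rewrite -ler_norml normrM (gtr0_norm w0).
    have -> : pi / 2 = w * L by rewrite /w divfK// gt_eqF.
    by rewrite ler_pM2l.
  have wX : - (pi / 2) <= w * X k <= pi / 2.
    rewrite /X [w * _]mulrC divfK ?gt_eqF// asin_geNpi2 ?asin_lepi2//; exact: XN.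
  apply: le_trans (sin_separation wu wX); rewrite lerD2l lerN2 -mulrBr.
  rewrite -(cos_norm (w * (u - X k))).
  have hn : w * d <= `|w * (u - X k)| by rewrite normrM (gtr0_norm w0) ler_pM2l.
  have hp : `|w * (u - X k)| <= pi.
    rewrite mulrBr; apply: le_trans (ler_normB _ _) _.
    by move: wu wX; rewrite -!ler_norml; lra.
  have [->//|ne] := eqVneq (w * d) `|w * (u - X k)|.
  apply: ltW; rewrite ltr_cos ?in_itv/=; first by rewrite lt_neqAle ne.
    by rewrite (ltW wd0)/=; lra.
  by rewrite normr_ge0.
pose pt (j : {ffun 'I_K -> 'I_N.+1}) : 'rV[R]_K := \row_i X (j i).
pose W (j : {ffun 'I_K -> 'I_N.+1}) (x : 'rV[R]_K) : R :=
  \prod_i bern N (j i) (squash w (x 0 i)).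
(* The Bernstein polynomial of [f] in the variables [squash w (x 0 i)]: on the box, these separate
   points, so that the weights [W j x] concentrate on the [j] with [pt j] close to [x]. *)
pose g x := \sum_j f (pt j) * W j x.
have W0 j x : 0 <= W j x by apply: prodr_ge0 => i _; apply: bern_ge0; exact: squash01.
have W1 x : \sum_j W j x = 1.
  rewrite /W -(bigA_distr_bigA (fun i k => bern N (nat_of_ord k) (squash w (x 0 i)))).
  by rewrite big1// => i _; exact: sum_bern.
exists g; split.
- apply: trig_sum => j; apply: trig_mul; first exact: trig_cst.
  by apply: trig_prod => i; apply: trig_bern; exact: trig_squash.
- move=> x; rewrite /g; apply: le_trans (ler_norm_sum _ _ _) _.
  rewrite -[leRHS]mulr1 -(W1 x) mulr_sumr; apply: ler_sum => j _.
  by rewrite normrM (ger0_norm (W0 j x)) ler_wpM2r.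
move=> x xL.
have -> : f x - g x = \sum_j (f x - f (pt j)) * W j x.
  under [RHS]eq_bigr do rewrite mulrBl.
  by rewrite sumrB -mulr_sumr W1 mulr1.
apply: le_trans (ler_norm_sum _ _ _) _.
pose q (j : {ffun 'I_K -> 'I_N.+1}) i : R := ((j i)%:R / N%:R - squash w (x 0 i)) ^+ 2.
(* Near nodes fall under uniform continuity. A far node is far in some coordinate i, where q j i >=
   eta^2, so the sum absorbs the trivial bound 2C. *)
have fq j : `|f x - f (pt j)| <= e / 2 + 2 * C / eta ^+ 2 * \sum_i q j i.
  have q0 i : 0 <= q j i by exact: sqr_ge0.
  have c0 : 0 <= 2 * C / eta ^+ 2 by rewrite divr_ge0 ?mulr_ge0 ?sqr_ge0.
  have [near|/existsNP[i /negP]] := pselect (forall i, `|x 0 i - pt j 0 i| < d0).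
    by rewrite (le_trans (hd0 _ _ xL near))// lerDl mulr_ge0// sumr_ge0.
  rewrite -leNgt mxE => far.
  have far' : d <= `|x 0 i - X (j i)| by apply: le_trans far; rewrite ge_min lexx.
  have hsep := sep _ _ (xL i) far'.
  have hq : eta ^+ 2 <= q j i.
    by rewrite /q -[leRHS]real_normK ?num_real// distrC ler_sqr ?nnegrE ?(ltW eta0).
  have hs : eta ^+ 2 <= \sum_i q j i.
    by rewrite (bigD1 i)//= (le_trans hq)// lerDl sumr_ge0.
  apply: (@le_trans _ _ (2 * C)).
    by apply: le_trans (ler_normB _ _) _; have := fC x; have := fC (pt j); lra.
  apply: (@le_trans _ _ (2 * C / eta ^+ 2 * \sum_i q j i)); last by rewrite lerDr ltW.
  rewrite -mulrA ler_peMr ?mulr_ge0// mulrC ler_pdivlMr ?exprn_gt0// mul1r //.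
apply: (@le_trans _ _ (\sum_j (e / 2 + 2 * C / eta ^+ 2 * \sum_i q j i) * W j x)).
  by apply: ler_sum => j _; rewrite normrM (ger0_norm (W0 j x)) ler_wpM2r.
under eq_bigr do rewrite mulrDl -[X in _ + X]mulrA.
rewrite big_split/= -!mulr_sumr W1 mulr1 [leRHS]splitr lerD2l.
under eq_bigr do rewrite mulr_suml.
rewrite exchange_big/=.
have qW i : \sum_j q j i * W j x <= N%:R^-1.
  (* Only the factor at i carries the squared deviation, so the sum over j is one binomial variance
     times sums equal to 1. *)
  pose F (i' : 'I_K) (k : 'I_N.+1) :=
    (if i' == i then (k%:R / N%:R - squash w (x 0 i)) ^+ 2 else 1) *
    bern N k (squash w (x 0 i')).
  have -> : \sum_j q j i * W j x = \sum_(j : {ffun 'I_K -> 'I_N.+1}) \prod_i' F i' (j i').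
    apply: eq_bigr => j _; rewrite /F big_split/=; congr (_ * _).
    by rewrite -big_mkcond/= big_pred1_eq.
  rewrite -bigA_distr_bigA (bigD1 i)//= [X in _ * X]big1 ?mulr1; last first.
    move=> i' /negbTE ne; rewrite /F ne.
    by under eq_bigr do rewrite mul1r; exact: sum_bern.
  by rewrite /F eqxx; apply: sum_bern_variance => //; exact: squash01.
apply: (@le_trans _ _ (2 * C / eta ^+ 2 * \sum_(i < K) N%:R^-1)).
  by rewrite ler_wpM2l ?divr_ge0 ?mulr_ge0 ?sqr_ge0//; apply: ler_sum => i _; exact: qW.
rewrite sumr_const card_ord -[_ *+ K]mulr_natl mulrA ler_pdivrMr ?ltr0n// mulrC.
by move: MN; rewrite /M ler_pdivrMr// [K%:R * _]mulrC [e / 2 * _]mulrC.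
Qed.

End TrigPolynomials.

(** * Convergence in probability and tightness *)

Section AsymptoticFilter.
Context {d : measure_display} {T : measurableType d} {R : realType}.
Variable P : probability T R.

(** Outer probability at most e: B need not be measurable, which spares measurability proofs for the
    events that express convergence. *)
Definition small (e : R) (B : set T) :=
  exists2 E, measurable E & (P E <= e%:E)%E /\ B `<=` E.

Lemma small_subset e B C : B `<=` C -> small e C -> small e B.
Proof. by move=> BC [E mE [PE CE]]; exists E => //; split=> //; exact: subset_trans CE. Qed.

Lemma small_setU e e' B C : small e B -> small e' C -> small (e + e') (B `|` C).
Proof.
move=> [E mE [PE BE]] [F mF [PF CF]]; exists (E `|` F); first exact: measurableU.
split; last exact: setUSS.
apply: le_trans (measureU2 _ _ _) _ => //.
by rewrite EFinD; exact: leeD.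
Qed.

Lemma small_set0 e : 0 <= e -> small e set0.
Proof. by move=> e0; exists set0 => //; split=> //; rewrite measure0 lee_fin. Qed.

Lemma small_bigcup (I : finType) e (B : I -> set T) : 0 <= e ->
  (forall i, small e (B i)) -> small (e *+ #|I|) [set w | ~ forall i, ~ B i w].
Proof.
move=> e0 sB; have : small (e *+ size (enum I)) [set w | ~ forall i, i \in enum I -> ~ B i w].
  elim: (enum I) => [|i s ih].
    by apply: small_subset (small_set0 _) => //= w; apply.
  rewrite /= mulrS; apply: small_subset (small_setU (sB i) ih) => w /=.
  apply: contra_notP => /not_orP[nB /contrapT h] j.
  by rewrite inE => /predU1P[->//|]; exact: h.
rewrite -cardE; apply: small_subset => w /=; apply: contra_not => h i; apply: h.
by rewrite mem_enum.
Qed.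

Lemma small_sqr (X : T -> R) e L : measurable_fun setT X -> L1 P (fun w => X w ^+ 2) ->
  0 < L -> Ex P (fun w => X w ^+ 2) <= e * L ^+ 2 -> small e [set w | ~ `|X w| <= L].
Proof.
move=> mX lX L0 hX; pose E := [set w | L < `|X w|].
have mE : measurable E.
  rewrite -[E]setTI; apply: (measurable_fun_ltr (measurable_cst L)) => //.
  exact: measurableT_comp.
exists E => //; split; last by move=> w /= /negP; rewrite -ltNge.
rewrite -(@fineK _ (P E)) ?fin_num_measure// lee_fin -Ex_indic//.
rewrite -(ler_pM2r (exprn_gt0 2 L0)); apply: le_trans hX.
rewrite mulrC -ExZ; last by apply: integrable_indic => //.
apply: le_Ex => //; first by apply: L1Z; exact: integrable_indic.
move=> w; rewrite indicE; have [|] := boolP (w \in E).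
  rewrite in_setE /E/= mulr1 => /ltW h.
  by rewrite -(real_normK (num_real (X w))) ler_sqr// nnegrE ltW.
by rewrite mulr0 sqr_ge0.
Qed.

(** Off the exceptional event the difference is at most e, on it at most 2C. *)
Lemma Ex_small_diff (f g : T -> R) C e e' : measurable_fun setT f -> measurable_fun setT g ->
  (forall w, `|f w| <= C) -> (forall w, `|g w| <= C) -> 0 <= e ->
  small e' [set w | ~ `|f w - g w| <= e] -> `|Ex P f - Ex P g| <= e + 2 * C * e'.
Proof.
move=> mf mg fC gC e0 [E mE [PE sE]].
have C0 : 0 <= C by apply: le_trans (fC point); exact: normr_ge0.
have lf := L1_bounded P mf fC; have lg := L1_bounded P mg gC.
rewrite -ExB//.
have lE : L1 P (\1_E) by apply: integrable_indic.
apply: (@le_trans _ _ (Ex P (fun w => e + 2 * C * \1_E w))).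
  apply: Ex_norm_le; first exact: L1B.
    by apply: L1D; [exact: L1_cst|exact: L1Z].
  move=> w; rewrite indicE; have [|] := boolP (w \in E).
    rewrite mulr1 => _; apply: le_trans (ler_normB _ _) _.
    by have := fC w; have := gC w; lra.
  rewrite notin_setE mulr0 addr0 => nE.
  by apply: contrapT => h; apply: nE; apply: sE.
rewrite ExD ?Ex_cst ?ExZ ?Ex_indic//; [|exact: L1_cst|exact: L1Z].
rewrite lerD2l ler_wpM2l ?mulr_ge0//.
by rewrite -lee_fin fineK// fin_num_measure.
Qed.

(* A limit along [asym] is a limit in probability of a sequence of random variables,
   seen as a function of the pair (sample size, sample point). *)
Definition asym : set_system (nat * T) :=
  [set A | forall e, 0 < e -> \forall n \near \oo, small e [set w | ~ A (n, w)]].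

(** Through this instance the general rules for limits along a filter become the calculus of
    convergence in probability. *)
Global Instance asym_filter : Filter asym.
Proof.
split => [e e0|A B hA hB e e0|A B AB hA e e0].
- near=> n; apply: small_subset (small_set0 (ltW e0)) => w /=; exact.
- near=> n; rewrite (splitr e).
  have sA : small (e / 2) [set w | ~ A (n, w)] by near: n; apply: hA; rewrite divr_gt0.
  have sB : small (e / 2) [set w | ~ B (n, w)] by near: n; apply: hB; rewrite divr_gt0.
  apply: small_subset (small_setU sA sB) => w /= /not_andP[]; by [left|right].
- near=> n; have : small e [set w | ~ A (n, w)] by near: n; exact: hA.
  by apply: small_subset => w /=; apply: contra_not; exact: AB.
Unshelve. all: by end_near. Qed.

Lemma asym_fst (A : set nat) : (\forall n \near \oo, A n) -> \forall x \near asym, A x.1.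
Proof.
move=> hA e e0; near=> n; apply: small_subset (small_set0 (ltW e0)) => w /=; apply.
by near: n.
Unshelve. all: by end_near. Qed.

Lemma asym_cvg_fst (U : topologicalType) (u : nat -> U) (l : U) : u n @[n --> \oo] --> l ->
  u x.1 @[x --> asym] --> l.
Proof. by move=> ul A /ul hA; exact: (@asym_fst (u @^-1` A)). Qed.

Lemma asym_ae (A : nat -> set T) : (\forall n \near \oo, {ae P, forall w, A n w}) ->
  \forall x \near asym, A x.1 x.2.
Proof.
move=> hA e e0; near=> n.
have : {ae P, forall w, A n w} by near: n.
move=> [E [mE PE sE]]; exists E => //; split=> //.
by rewrite PE lee_fin ltW.
Unshelve. all: by end_near. Qed.

(** Boundedness in probability, O_P(1), asked for large n only. *)
Definition tight (g : nat * T -> R) := forall e, 0 < e ->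
  exists L, \forall n \near \oo, small e [set w | ~ `|g (n, w)| <= L].

(** The rule o_P(1) O_P(1) = o_P(1). *)
Lemma asym0_tightM (f g : nat * T -> R) : f x @[x --> asym] --> 0 -> tight g ->
  f x * g x @[x --> asym] --> 0.
Proof.
move=> /cvgr0Pnorm_lt f0 tg; apply/cvgr0Pnorm_lt => r r0 e e0.
have e20 : 0 < e / 2 by rewrite divr_gt0.
have [L hL] := tg _ e20.
(* Kept positive so that r / L' is a valid threshold whatever L is. *)
pose L' := Num.max L 1; have L'0 : 0 < L' by rewrite lt_max ltr01 orbT.
near=> n; rewrite (splitr e).
have s1 : small (e / 2) [set w | ~ `|f (n, w)| < r / L'].
  by near: n; apply: f0 => //; rewrite divr_gt0.
have s2 : small (e / 2) [set w | ~ `|g (n, w)| <= L] by near: n.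
apply: small_subset (small_setU s1 s2) => w /=.
apply: contra_notP => /not_orP[/contrapT h1 /contrapT h2].
rewrite normrM; apply: (@le_lt_trans _ _ (`|f (n, w)| * L')).
  by rewrite ler_wpM2l// le_max h2.
by rewrite -ltr_pdivlMr.
Unshelve. all: by end_near. Qed.

Lemma asym0_tight (f : nat * T -> R) : f x @[x --> asym] --> 0 -> tight f.
Proof.
move=> /cvgr0Pnorm_lt f0 e e0; exists 1; near=> n.
have : small e [set w | ~ `|f (n, w)| < 1] by near: n; apply: f0.
by apply: small_subset => w /=; apply: contra_not => /ltW.
Unshelve. all: by end_near. Qed.

Lemma tightD f g : tight f -> tight g -> tight (fun x => f x + g x).
Proof.
move=> tf tg e e0; have e20 : 0 < e / 2 by rewrite divr_gt0.
have [L hL] := tf _ e20; have [L' hL'] := tg _ e20; exists (L + L').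
near=> n; rewrite (splitr e).
have s1 : small (e / 2) [set w | ~ `|f (n, w)| <= L] by near: n.
have s2 : small (e / 2) [set w | ~ `|g (n, w)| <= L'] by near: n.
apply: small_subset (small_setU s1 s2) => w /=.
apply: contra_notP => /not_orP[/contrapT h1 /contrapT h2].
by apply: le_trans (ler_normD _ _) _; exact: lerD.
Unshelve. all: by end_near. Qed.

Lemma tightZ c f : tight f -> tight (fun x => c * f x).
Proof.
move=> tf e e0; have [L hL] := tf _ e0; exists (`|c| * L).
near=> n.
have : small e [set w | ~ `|f (n, w)| <= L] by near: n.
apply: small_subset => w /=; apply: contra_not => h.
by rewrite normrM ler_wpM2l.
Unshelve. all: by end_near. Qed.

Lemma tight_cst c : tight (fun=> c).
Proof.
move=> e e0; exists `|c|; near=> n; apply: small_subset (small_set0 (ltW e0)) => w /=; exact.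
Unshelve. all: by end_near. Qed.

Lemma tight_sum (I : Type) (s : seq I) (f : I -> nat * T -> R) :
  (forall i, tight (f i)) -> tight (fun x => \sum_(i <- s) f i x).
Proof.
move=> tf; elim: s => [|i s ih].
  by under eq_fun do rewrite big_nil; exact: tight_cst.
by have := tightD (tf i) ih; congr tight; apply/funext => x; rewrite big_cons.
Qed.

Lemma tight_sqr_bounded (X : nat -> T -> R) C : (forall n, measurable_fun setT (X n)) ->
  (forall n, L1 P (fun w => X n w ^+ 2)) -> (forall n, Ex P (fun w => X n w ^+ 2) <= C) ->
  tight (fun x => X x.1 x.2).
Proof.
move=> mX lX hX e e0.
have C0 : 0 <= C by apply: le_trans (hX 0%N); apply: Ex_ge0 => w; exact: sqr_ge0.
(* Chebyshev's inequality with L = C/e + 1: then e L^2 >= C, and L > 0 also when C = 0. *)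
exists (C / e + 1); near=> n; apply: (@small_sqr (X n)) => //.
  by rewrite ltr_wpDl// divr_ge0// ltW.
apply: le_trans (hX n) _.
have -> : e * (C / e + 1) ^+ 2 = C * (C / e) + 2 * C + e by field; rewrite gt_eqF.
have : 0 <= C * (C / e) by rewrite mulr_ge0// divr_ge0// ltW.
by move=> ?; lra.
Unshelve. all: by end_near. Qed.

(** A Slutsky argument: bounded functionals whose difference is controlled by a quantity tending to
    0 in probability. *)
Lemma Ex_asym_diff (f g : nat -> T -> R) (D : nat * T -> R) C :
  (forall n, measurable_fun setT (f n)) -> (forall n, measurable_fun setT (g n)) ->
  (forall n w, `|f n w| <= C) -> (forall n w, `|g n w| <= C) ->
  D x @[x --> asym] --> 0 -> (forall n w, `|f n w - g n w| <= `|D (n, w)|) ->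
  Ex P (f n) - Ex P (g n) @[n --> \oo] --> 0.
Proof.
move=> mf mg fC gC /cvgr0Pnorm_le D0 fgD; apply/cvgr0Pnorm_le => r r0.
have C0 : 0 <= C by apply: le_trans (fC 0%N point); exact: normr_ge0.
pose e := r / 2 / (2 * C + 1).
have e0 : 0 < e by rewrite divr_gt0 ?divr_gt0// ltr_wpDl// mulr_ge0.
near=> n.
apply: (@le_trans _ _ (r / 2 + 2 * C * e)).
  apply: Ex_small_diff => //; first by rewrite divr_ge0// ltW.
  have : small e [set w | ~ `|D (n, w)| <= r / 2] by near: n; apply: D0 => //; rewrite divr_gt0.
  by apply: small_subset => w /=; apply: contra_not; exact: le_trans.
rewrite [leRHS]splitr lerD2l /e mulrCA -[leRHS]mulr1 ler_wpM2l ?divr_ge0 ?(ltW r0)//.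
by rewrite ler_pdivrMr ?mul1r; lra.
Unshelve. all: by end_near. Qed.

End AsymptoticFilter.

(** * From cosines to bounded continuous functions *)

Section TrigConvergence.
Context {R : realType}.

Lemma rV_coord_measurable d (T : measurableType d) K (t : 'rV[R]_K) (S : T -> 'rV[R]_K) :
  (forall i, measurable_fun setT (fun w => S w 0 i)) ->
  measurable_fun setT (fun w => (t *m (S w)^T) 0 0).
Proof.
move=> mS.
rewrite (_ : (fun w => _) = (fun w => \sum_i t 0 i * S w 0 i)).
  apply: measurable_sum => i; apply: measurable_funM => //.
by apply/funext => w; rewrite mxE; apply: eq_bigr => i _; rewrite mxE.
Qed.

Lemma trig_poly_measurable d (T : measurableType d) K (g : 'rV[R]_K -> R) (S : T -> 'rV[R]_K) :
  trig_poly g -> (forall i, measurable_fun setT (fun w => S w 0 i)) ->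
  measurable_fun setT (g \o S).
Proof.
move=> tg mS; elim: tg => [b t|g1 g2 _ ih1 _ ih2|c g1 _ ih].
- apply: measurable_cosD; exact: rV_coord_measurable.
- exact: measurable_funD.
- exact: measurable_funM.
Qed.

Lemma trig_poly_L1 d (T : measurableType d) (P : probability T R) K (g : 'rV[R]_K -> R)
    (S : T -> 'rV[R]_K) :
  trig_poly g -> (forall i, measurable_fun setT (fun w => S w 0 i)) -> L1 P (g \o S).
Proof.
move=> tg mS; elim: tg => [b t|g1 g2 _ ih1 _ ih2|c g1 _ ih].
- apply: L1_cosD; exact: rV_coord_measurable.
- exact: L1D.
- exact: L1Z.
Qed.

(** A pointwise limit of trigonometric polynomials, the n-th within 1/(n+1) on the box of size n+1;
    so measurable coordinates are enough. *)
Lemma continuous_rV_measurable d (T : measurableType d) K (f : 'rV[R]_K -> R) C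
    (S : T -> 'rV[R]_K) : continuous f -> (forall x, `|f x| <= C) ->
  (forall i, measurable_fun setT (fun w => S w 0 i)) -> measurable_fun setT (f \o S).
Proof.
move=> cf fC mS.
have H (n : nat) : exists g, trig_poly g /\
    forall x : 'rV[R]_K, (forall i, `|x 0 i| <= n.+1%:R) -> `|f x - g x| <= n.+1%:R^-1.
  have [||g [tg _ hg]] := @trig_approx R K f C n.+1%:R n.+1%:R^-1 cf fC; rewrite ?invr_gt0//.
  by exists g.
have [g hg] := choice H.
apply: (@measurable_fun_cvg _ _ _ _ (fun n => g n \o S)) => [n|w _].
  by apply: trig_poly_measurable => //; have [] := hg n.
apply/cvgrPdist_le => e e0; near=> n => /=.
pose M := \sum_i `|S w 0 i|.
have hM i : `|S w 0 i| <= M by rewrite /M (bigD1 i)//= lerDl sumr_ge0.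
have [_ hn] := hg n.
apply: le_trans (hn _ _) _ => [i|].
  apply: le_trans (hM i) _; apply: (@le_trans _ _ n%:R); last by rewrite ler_nat.
  by near: n; exact: nbhs_infty_ger.
apply: ltW; near: n; exact: near_infty_natSinv_lt (PosNum e0).
Unshelve. all: by end_near. Qed.

Theorem trig_cvg_distribution d (T : measurableType d) (P : probability T R)
    d' (T' : measurableType d') (P' : probability T' R) K
    (S : nat -> T -> 'rV[R]_K) (Y : T' -> 'rV[R]_K) (f : 'rV[R]_K -> R) C :
  (forall n i, measurable_fun setT (fun w => S n w 0 i)) ->
  (forall i, measurable_fun setT (fun w => Y w 0 i)) ->
  (forall i, tight P (fun x => S x.1 x.2 0 i)) ->
  (forall i, L1 P' (fun w => Y w 0 i ^+ 2)) ->
  (forall b (t : 'rV[R]_K), Ex P (fun w => cos (b + (t *m (S n w)^T) 0 0)) @[n --> \oo] -->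
    Ex P' (fun w => cos (b + (t *m (Y w)^T) 0 0))) ->
  continuous f -> (forall x, `|f x| <= C) ->
  Ex P (f \o S n) @[n --> \oo] --> Ex P' (f \o Y).
Proof.
move=> mS mY tS lY cS cf fC.
have C0 : 0 <= C by apply: le_trans (fC 0); exact: normr_ge0.
have trig_cvg g : trig_poly g -> Ex P (g \o S n) @[n --> \oo] --> Ex P' (g \o Y).
  move=> tg; elim: tg => [b t|g1 g2 t1 ih1 t2 ih2|c g1 t1 ih1]; first exact: cS.
    have -> : (fun n => Ex P ((fun x => g1 x + g2 x) \o S n)) =
        (fun n => Ex P (g1 \o S n) + Ex P (g2 \o S n)).
      by apply/funext => n; rewrite -ExD//; exact: trig_poly_L1.
    have -> : Ex P' ((fun x => g1 x + g2 x) \o Y) = Ex P' (g1 \o Y) + Ex P' (g2 \o Y).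
      by rewrite -ExD//; exact: trig_poly_L1.
    exact: cvgD.
  have -> : (fun n => Ex P ((fun x => c * g1 x) \o S n)) = (fun n => c * Ex P (g1 \o S n)).
    by apply/funext => n; rewrite -ExZ//; exact: trig_poly_L1.
  have -> : Ex P' ((fun x => c * g1 x) \o Y) = c * Ex P' (g1 \o Y).
    by rewrite -ExZ//; exact: trig_poly_L1.
  by apply: cvgM => //; exact: cvg_cst.
have tY i : tight P' (fun x : nat * T' => Y x.2 0 i).
  exact: (@tight_sqr_bounded _ _ _ _ (fun _ w => Y w 0 i) (Ex P' (fun w => Y w 0 i ^+ 2))).
apply/cvgrPdist_le => e e0.
(* One e1 for the limit at the approximant and, for each of [S n] and [Y], one for the error on the
   box and one for leaving it. *)
pose e1 := e / 5; have e10 : 0 < e1 by rewrite divr_gt0.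
(* Each of K coordinates may leave the box; the denominators 2C + 1 and K + 1 cannot vanish. *)
pose e2 := e1 / (2 * C + 1) / K.+1%:R.
have e20 : 0 < e2 by rewrite !divr_gt0// ltr_wpDl// mulr_ge0.
have e2C : 2 * C * (e2 *+ K) <= e1.
  have -> : 2 * C * (e2 *+ K) = e1 * (2 * C / (2 * C + 1)) * (K%:R / K.+1%:R).
    have : K.+1%:R != 0 :> R by rewrite pnatr_eq0.
    have : 2 * C + 1 != 0 by rewrite gt_eqF// ltr_wpDl// mulr_ge0.
    have alg (u v a k : R) : u != 0 -> v != 0 ->
      2 * C * (a / u / v * k) = a * (2 * C / u) * (k / v).
      by move=> u0 v0; field; rewrite ?u0 ?v0.
    by move=> h1 h2; rewrite -[e2 *+ K]mulr_natr; exact: alg.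
  have K1 : K%:R / K.+1%:R <= 1 :> R by rewrite ler_pdivrMr// mul1r ler_nat.
  have C1 : 2 * C / (2 * C + 1) <= 1.
    rewrite ler_pdivrMr ?mul1r ?lerDl// ltr_wpDl// mulr_ge0//.
  have K2 : 0 <= K%:R / K.+1%:R :> R by rewrite divr_ge0.
  have C2 : 0 <= 2 * C / (2 * C + 1) by rewrite divr_ge0// ?addr_ge0// mulr_ge0.
  rewrite -mulrA ler_piMr ?(ltW e10)//; apply: mulr_ile1 => //.
have HS i : exists L, \forall n \near \oo, small P e2 [set w | ~ `|S n w 0 i| <= L].
  exact: tS i _ e20.
have [LS hLS] := choice HS.
have HY i : exists L, small P' e2 [set w | ~ `|Y w 0 i| <= L].
  have [L [n _ hn]] := tY i _ e20; exists L; exact: (hn n (leqnn n)).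
have [LY hLY] := choice HY.
pose L := 1 + \sum_i (`|LS i| + `|LY i|).
have L0 : 0 < L by rewrite ltr_pwDl// sumr_ge0// => i _; rewrite addr_ge0.
have LSL i : LS i <= L.
  rewrite /L (bigD1 i)//= (le_trans (ler_norm _))//.
  have : 0 <= \sum_(j | j != i) (`|LS j| + `|LY j|) by rewrite sumr_ge0// => j _; rewrite addr_ge0.
  by have := normr_ge0 (LY i); lra.
have LYL i : LY i <= L.
  rewrite /L (bigD1 i)//= (le_trans (ler_norm _))//.
  have : 0 <= \sum_(j | j != i) (`|LS j| + `|LY j|) by rewrite sumr_ge0// => j _; rewrite addr_ge0.
  by have := normr_ge0 (LS i); lra.
have [g [tg gC hg]] := trig_approx cf fC L0 e10.
have close d0 (T0 : measurableType d0) (P0 : probability T0 R) (Z : T0 -> 'rV[R]_K) l :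
    (forall i, measurable_fun setT (fun w => Z w 0 i)) -> (forall i, l i <= L) ->
    (forall i, small P0 e2 [set w | ~ `|Z w 0 i| <= l i]) ->
    `|Ex P0 (f \o Z) - Ex P0 (g \o Z)| <= e1 + e1.
  move=> mZ lL sZ.
  apply: (@le_trans _ _ (e1 + 2 * C * (e2 *+ K))); last by rewrite lerD2l.
  apply: Ex_small_diff => //; first exact: (continuous_rV_measurable cf fC).
  - exact: trig_poly_measurable.
  - by move=> w; exact: fC.
  - by move=> w; exact: gC.
  - exact: ltW.
  rewrite -[in X in _ *+ X](card_ord K).
  apply: small_subset (small_bigcup (ltW e20) sZ) => w /=.
  apply: contra_not => h; apply: hg => i; apply: le_trans (lL i).
  by apply: contrapT; exact: h.
have /cvgrPdist_le/(_ _ e10) hgc := trig_cvg g tg.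
near=> n.
have h1 : `|Ex P (f \o S n) - Ex P (g \o S n)| <= e1 + e1.
  apply: (close _ _ _ _ LS) => // i; move: i.
  near: n; apply: filter_forall => i; exact: hLS.
have h2 : `|Ex P' (f \o Y) - Ex P' (g \o Y)| <= e1 + e1 by exact: (close _ _ _ _ LY).
have h3 : `|Ex P' (g \o Y) - Ex P (g \o S n)| <= e1 by near: n.
have -> : Ex P' (f \o Y) - Ex P (f \o S n) = (Ex P' (f \o Y) - Ex P' (g \o Y)) +
  (Ex P' (g \o Y) - Ex P (g \o S n)) - (Ex P (f \o S n) - Ex P (g \o S n)) by ring.
apply: le_trans (ler_normB _ _) _; apply: (@le_trans _ _ (e1 + e1 + e1 + (e1 + e1))).
  by apply: lerD => //; apply: le_trans (ler_normD _ _) _; exact: lerD.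
by rewrite /e1; lra.
Unshelve. all: by end_near. Qed.

End TrigConvergence.

(** * Limits and measurability of matrices *)

Section MatrixLimits.
Context {R : realType} {U : Type} (F : set_system U) {FF : Filter F}.

(** Along any filter: [\oo] for deterministic sequences, [asym P] for limits in probability. *)
Definition mcvg a b (S : U -> 'M[R]_(a, b)) (A : 'M[R]_(a, b)) :=
  forall i j, S x i j @[x --> F] --> A i j.

Lemma cvg_bigsum (I : Type) (s : seq I) (f : I -> U -> R) (l : I -> R) :
  (forall i, f i x @[x --> F] --> l i) ->
  \sum_(i <- s) f i x @[x --> F] --> \sum_(i <- s) l i.
Proof. by move=> fl; apply: cvg_big => //; exact: add_continuous. Qed.

Lemma cvg_bigprod (I : Type) (s : seq I) (f : I -> U -> R) (l : I -> R) :
  (forall i, f i x @[x --> F] --> l i) ->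
  \prod_(i <- s) f i x @[x --> F] --> \prod_(i <- s) l i.
Proof. by move=> fl; apply: cvg_big => //; exact: mul_continuous. Qed.

Lemma mcvg_cst a b (A : 'M[R]_(a, b)) : mcvg (fun=> A) A.
Proof. by move=> i j; exact: cvg_cst. Qed.

Lemma mcvgD a b (S S' : U -> 'M[R]_(a, b)) A A' : mcvg S A -> mcvg S' A' ->
  mcvg (fun x => S x + S' x) (A + A').
Proof.
move=> SA SA' i j; rewrite mxE; under eq_fun do rewrite mxE; exact: cvgD.
Qed.

Lemma mcvgN a b (S : U -> 'M[R]_(a, b)) A : mcvg S A -> mcvg (fun x => - S x) (- A).
Proof.
move=> SA i j; rewrite mxE; under eq_fun do rewrite mxE; exact: cvgN.
Qed.

Lemma mcvgB a b (S S' : U -> 'M[R]_(a, b)) A A' : mcvg S A -> mcvg S' A' ->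
  mcvg (fun x => S x - S' x) (A - A').
Proof. by move=> SA /mcvgN; exact: mcvgD. Qed.

Lemma mcvgM a b c (S : U -> 'M[R]_(a, b)) (S' : U -> 'M[R]_(b, c)) A A' :
  mcvg S A -> mcvg S' A' -> mcvg (fun x => S x *m S' x) (A *m A').
Proof.
move=> SA SA' i j; rewrite mxE; under eq_fun do rewrite mxE.
by apply: cvg_bigsum => k; exact: cvgM.
Qed.

Lemma mcvgT a b (S : U -> 'M[R]_(a, b)) A : mcvg S A -> mcvg (fun x => (S x)^T) A^T.
Proof. by move=> SA i j; rewrite mxE; under eq_fun do rewrite mxE; exact: SA. Qed.

Lemma cvg_det a (S : U -> 'M[R]_a) A : mcvg S A -> \det (S x) @[x --> F] --> \det A.
Proof.
move=> SA; apply: cvg_bigsum => s; apply: cvgM; first exact: cvg_cst.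
by apply: cvg_bigprod => i; exact: SA.
Qed.

Lemma mcvg_adj a (S : U -> 'M[R]_a) A : mcvg S A -> mcvg (fun x => \adj (S x)) (\adj A).
Proof.
move=> SA i j; rewrite mxE; under eq_fun do rewrite mxE.
apply: cvgM; first exact: cvg_cst.
apply: cvg_det => k l; rewrite !mxE; under eq_fun do rewrite !mxE; exact: SA.
Qed.

Lemma mcvg_unit a (S : U -> 'M[R]_a) A : mcvg S A -> A \in unitmx ->
  \forall x \near F, S x \in unitmx.
Proof.
move=> /cvg_det SA; rewrite unitmxE unitfE => A0.
have /(_ FF) := cvgr_neq0 (\det A) SA A0.
by apply: filterS => x; rewrite unitmxE unitfE.
Qed.

(** Cramer's rule: the inverse is the adjugate over the determinant, and this holds near the limit
    because the determinant stays away from 0. *)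
Lemma mcvgV a (S : U -> 'M[R]_a) A : mcvg S A -> A \in unitmx ->
  mcvg (fun x => invmx (S x)) (invmx A).
Proof.
move=> SA Au i j.
have H : (\det (S x))^-1 * \adj (S x) i j @[x --> F] --> (\det A)^-1 * \adj A i j.
  apply: cvgM; last exact: mcvg_adj.
  by apply: cvgV; [rewrite -unitfE -unitmxE|exact: cvg_det].
rewrite /invmx Au mxE; apply: cvg_trans H; apply: near_eq_cvg.
by apply: filterS (mcvg_unit SA Au) => x Sx /=; rewrite Sx [RHS]mxE.
Qed.

Lemma mcvg_near a b (S S' : U -> 'M[R]_(a, b)) A : (\forall x \near F, S x = S' x) ->
  mcvg S A -> mcvg S' A.
Proof.
move=> SS SA i j; apply: cvg_trans (SA i j); apply: near_eq_cvg.
by apply: filterS SS => x ->.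
Qed.

End MatrixLimits.

Section RandomMatrices.
Context {d : measure_display} {T : measurableType d} {R : realType}.
Variable P : probability T R.

(** Writing 1/f = f (f^2)^(-1) reduces the inverse to a real power of a nonnegative function; both
    sides are 0 where f vanishes. *)
Lemma measurable_inv (f : T -> R) : measurable_fun setT f -> measurable_fun setT (fun w => (f w)^-1).
Proof.
move=> mf; rewrite (_ : (fun w => _) = (fun w => f w * (f w ^+ 2) `^ (-1))).
  apply: measurable_funM => //; apply: (measurableT_comp (measurable_powR _)).
  exact: measurable_funX.
apply/funext => w; rewrite powR_inv1 ?sqr_ge0//.
have [->|f0] := eqVneq (f w) 0; first by rewrite invr0 mul0r.
by rewrite expr2 invfM mulrA divff// mul1r.
Qed.

Lemma random_mx_cst a b (A : 'M[R]_(a, b)) : random_mx (fun=> A : 'M[R]_(a, b)) (T := T).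
Proof. by move=> i j; exact: measurable_cst. Qed.

Lemma random_mxD a b (S S' : T -> 'M[R]_(a, b)) : random_mx S -> random_mx S' ->
  random_mx (fun w => S w + S' w).
Proof.
by move=> mS mS' i j; under eq_fun do rewrite mxE; exact: measurable_funD.
Qed.

Lemma random_mxN a b (S : T -> 'M[R]_(a, b)) : random_mx S -> random_mx (fun w => - S w).
Proof.
by move=> mS i j; under eq_fun do rewrite mxE; exact: measurable_funN.
Qed.

Lemma random_mxZ a b c (S : T -> 'M[R]_(a, b)) : random_mx S -> random_mx (fun w => c *: S w).
Proof.
by move=> mS i j; under eq_fun do rewrite mxE; apply: measurable_funM.
Qed.

Lemma random_mxM a b c (S : T -> 'M[R]_(a, b)) (S' : T -> 'M[R]_(b, c)) :
  random_mx S -> random_mx S' -> random_mx (fun w => S w *m S' w).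
Proof.
move=> mS mS' i j; under eq_fun do rewrite mxE.
by apply: measurable_sum => k; apply: measurable_funM.
Qed.

Lemma random_mxT a b (S : T -> 'M[R]_(a, b)) : random_mx S -> random_mx (fun w => (S w)^T).
Proof. by move=> mS i j; under eq_fun do rewrite mxE; exact: mS. Qed.

Lemma measurable_det a (S : T -> 'M[R]_a) : random_mx S ->
  measurable_fun setT (fun w => \det (S w)).
Proof.
move=> mS; apply: measurable_sum => s; apply: measurable_funM => //.
by apply: measurable_prod => i _; exact: mS.
Qed.

Lemma random_mxV a (S : T -> 'M[R]_a) : random_mx S -> random_mx (fun w => invmx (S w)).
Proof.
move=> mS i j; have md := measurable_det mS.
(* [invmx] returns a singular matrix unchanged, hence the case split. *)
rewrite (_ : (fun w => _) = (fun w => if \det (S w) == 0 then S w i j else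
    (\det (S w))^-1 * ((-1) ^+ (j + i) * \det (row' j (col' i (S w)))))); last first.
  by apply/funext => w; rewrite /invmx unitmxE unitfE; case: eqP => //= _; rewrite !mxE.
apply: measurable_fun_ifT.
- by apply: measurable_fun_eqr.
- exact: mS.
- apply: measurable_funM; first exact: measurable_inv.
  apply: measurable_funM => //; apply: measurable_det => k l.
  by under eq_fun do rewrite !mxE; exact: mS.
Qed.

Definition mtight a b (S : nat * T -> 'M[R]_(a, b)) := forall i j, tight P (fun x => S x i j).

Lemma mcvg0_mtight a b (S : nat * T -> 'M[R]_(a, b)) : mcvg (asym P) S 0 -> mtight S.
Proof. by move=> S0 i j; apply: asym0_tight; have := S0 i j; rewrite mxE. Qed.

Lemma mtightD a b (S S' : nat * T -> 'M[R]_(a, b)) : mtight S -> mtight S' ->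
  mtight (fun x => S x + S' x).
Proof.
move=> tS tS' i j; have := tightD (tS i j) (tS' i j).
by congr tight; apply/funext => x; rewrite mxE.
Qed.

Lemma mtightMl a b c (A : 'M[R]_(a, b)) (S : nat * T -> 'M[R]_(b, c)) : mtight S ->
  mtight (fun x => A *m S x).
Proof.
move=> tS i j.
have := tight_sum (index_enum 'I_b) (fun k => tightZ (A i k) (tS k j)).
by congr tight; apply/funext => x; rewrite mxE.
Qed.

Lemma mtightMr a b c (S : nat * T -> 'M[R]_(a, b)) (A : 'M[R]_(b, c)) : mtight S ->
  mtight (fun x => S x *m A).
Proof.
move=> tS i j.
have := tight_sum (index_enum 'I_b) (fun k => tightZ (A k j) (tS i k)).
by congr tight; apply/funext => x; rewrite mxE; apply: eq_bigr => k _; rewrite mulrC.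
Qed.

Lemma mcvg0_mtightM a b c (S : nat * T -> 'M[R]_(a, b)) (S' : nat * T -> 'M[R]_(b, c)) :
  mcvg (asym P) S 0 -> mtight S' -> mcvg (asym P) (fun x => S x *m S' x) 0.
Proof.
move=> S0 tS i j; rewrite mxE; under eq_fun do rewrite mxE.
have : \sum_k S x i k * S' x k j @[x --> asym P] --> \sum_(k : 'I_b) (0 : R).
  apply: cvg_bigsum => k; apply: asym0_tightM; last exact: tS.
  by have := S0 i k; rewrite mxE.
by rewrite big1_eq.
Qed.

End RandomMatrices.

(** * Independence of the rows and row contributions *)

Section FiniteFamilies.
Context {d : measure_display} {T : measurableType d} {R : realType}.
Variable P : probability T R.

Lemma mutually_independent_fin (I : choiceType) (F : I -> set (set T)) (K : finType)
    (g : K -> I) (A : K -> set T) : mutually_independent P F -> injective g ->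
  (forall k, F (g k) (A k)) -> P (\bigcap_k A k) = (\prod_k P (A k))%E.
Proof.
move=> Find gI FA.
pose A' i := if [pick k | g k == i] is Some k then A k else setT.
have A'g k : A' (g k) = A k.
  rewrite /A'; case: pickP => [k' /eqP/gI -> //|/(_ k)].
  by rewrite eqxx.
pose J := [fset g k | k in {: K}]%fset.
have FJ i : i \in J -> F i (A' i) by move=> /imfsetP[k _ ->]; rewrite A'g.
have := Find J A' FJ.
have -> : \bigcap_(i in [set` J]) A' i = \bigcap_k A k.
  apply/seteqP; split=> w /= h.
    by move=> k _; rewrite -A'g; apply: h => /=; apply/imfsetP; exists k.
  by move=> _ /= /imfsetP[k _ ->]; rewrite A'g; exact: h.
move=> ->; rewrite big_imfset/=; last by move=> ? ? _ _; exact: gI.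
by rewrite big_enum; apply: eq_bigr => k _; rewrite A'g.
Qed.

(** A finite set of indices fits in the first n rows, where missing positions receive the whole
    space. This matches the independence of the three arrays, which is assumed sample by sample. *)
Lemma mutually_independent_rows (V : finType) (F : nat * V -> set (set T)) :
  (forall i, F i setT) ->
  (forall n (A : 'I_n * V -> set T), (forall x, F (val x.1, x.2) (A x)) ->
    P (\bigcap_x A x) = (\prod_x P (A x))%E) ->
  mutually_independent P F.
Proof.
move=> FT Frows J A FA.
pose n := (\max_(i <- J) i.1).+1.
have Jn i : i \in J -> (i.1 < n)%N by move=> iJ; rewrite ltnS; exact: leq_bigmax_seq.
pose g (x : 'I_n * V) : nat * V := (val x.1, x.2).
have gI : injective g by move=> [a b] [a' b'] [/val_inj -> ->].
pose A' i := if i \in J then A i else setT.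
have A'J i : i \in J -> A' i = A i by rewrite /A' => ->.
pose B := [fset g x | x in {: 'I_n * V}]%fset.
have JB : (J `<=` B)%fset.
  apply/fsubsetP => i iJ; apply/imfsetP; exists (Ordinal (Jn i iJ), i.2) => //.
  by rewrite /g /=; case: i {iJ}.
have := Frows n (A' \o g) _.
have -> : \bigcap_x (A' \o g) x = \bigcap_(i in [set` J]) A i.
  apply/seteqP; split=> w h.
    move=> i iJ; rewrite -A'J//; have /imfsetP[x _ ->] := fsubsetP JB _ iJ.
    exact: (h x).
  by move=> x _; rewrite /= /A'; case: ifPn => // xJ; exact: h.
move=> ->; last by move=> x; rewrite /= /A'; case: ifPn => //; exact: FA.
have -> : (\prod_x P ((A' \o g) x) = \prod_(i <- B) P (A' i))%E.
  by rewrite big_imfset/= ?big_enum// => ? ? _ _; exact: gI.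
rewrite -(big_fset_incl _ JB) => [|i _ iJ]; last first.
  by rewrite /A' (negbTE iJ) probability_setT.
by rewrite big_seq [RHS]big_seq; apply: eq_bigr => i iJ; rewrite A'J.
Qed.

Lemma sigma_mx_bigcap a b (Y : T -> 'M[R]_(a, b)) (A : 'I_a * 'I_b -> set T) :
  (forall x, sigma_rv (fun w => Y w x.1 x.2) (A x)) -> sigma_mx Y (\bigcap_x A x).
Proof.
move=> YA; pose G := \bigcup_(ij in [set: 'I_a * 'I_b]) sigma_rv (fun w => Y w ij.1 ij.2).
apply: (@fin_bigcap_measurable _ (g_sigma_algebraType G)); first exact: finite_finset.
by move=> x _; apply: sub_sigma_algebra; exists x.
Qed.

End FiniteFamilies.

Section ModelArray.
Context {d : measure_display} {T : measurableType d} {R : realType}.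
Context {P : probability T R} {p q : nat}.
Variable m : eiv_model P p q.
Hypothesis Hm : eiv_assumptions m.

(** All scalar errors as one family with the row as first index, so that distinct rows are disjoint
    blocks of variables. *)
Definition errors (iv : nat * ('I_q + ('I_p + 'I_p))) : T -> R :=
  match iv.2 with
  | inl j => eps m iv.1 j
  | inr (inl k) => psi m iv.1 k
  | inr (inr k) => del m iv.1 k
  end.

Lemma measurable_errors iv : measurable_fun setT (errors iv).
Proof. by case: iv => i [j|[k|k]]; exact: measurable_funPT. Qed.

(** On the first n rows, independence between the arrays splits an event into three parts, and
    independence within each array splits these further. *)
Lemma errors_independent : mutually_independent P (fun iv => sigma_rv (errors iv)).
Proof.
apply: mutually_independent_rows => [iv|n A HA]; first exact: sigma_rvT.
pose Ae (x : 'I_n * 'I_q) := A (x.1, inl x.2).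
pose Ap (x : 'I_n * 'I_p) := A (x.1, inr (inl x.2)).
pose Ad (x : 'I_n * 'I_p) := A (x.1, inr (inr x.2)).
have inj k : injective (fun x : 'I_n * 'I_k => (val x.1, x.2)).
  by move=> [a b] [a' b'] [/val_inj -> ->].
have Ee : P (\bigcap_x Ae x) = (\prod_x P (Ae x))%E.
  apply: mutually_independent_fin (eps_indep Hm) (inj q) _ => x.
  exact: (HA (x.1, inl x.2)).
have Ep : P (\bigcap_x Ap x) = (\prod_x P (Ap x))%E.
  apply: mutually_independent_fin (psi_indep Hm) (inj p) _ => x.
  exact: (HA (x.1, inr (inl x.2))).
have Ed : P (\bigcap_x Ad x) = (\prod_x P (Ad x))%E.
  apply: mutually_independent_fin (del_indep Hm) (inj p) _ => x.
  exact: (HA (x.1, inr (inr x.2))).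
have Se : sigma_mx (@smpE _ _ _ _ _ _ m n) (\bigcap_x Ae x).
  apply: sigma_mx_bigcap => x; have := HA (x.1, inl x.2).
  by congr sigma_rv; apply/funext => w; rewrite mxE.
have Sp : sigma_mx (@smpPsi _ _ _ _ _ _ m n) (\bigcap_x Ap x).
  apply: sigma_mx_bigcap => x; have := HA (x.1, inr (inl x.2)).
  by congr sigma_rv; apply/funext => w; rewrite mxE.
have Sd : sigma_mx (@smpDelta _ _ _ _ _ _ m n) (\bigcap_x Ad x).
  apply: sigma_mx_bigcap => x; have := HA (x.1, inr (inr x.2)).
  by congr sigma_rv; apply/funext => w; rewrite mxE.
have := mutually_independent_fin (K := 'I_3) (g := id)
  (A := tnth [tuple \bigcap_x Ad x; \bigcap_x Ap x; \bigcap_x Ae x]) (@arrays_indep _ _ _ _ _ _ _ Hm n) (@inj_id _) _.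
have -> : \bigcap_k tnth [tuple \bigcap_x Ad x; \bigcap_x Ap x; \bigcap_x Ae x] k = \bigcap_x A x.
  apply/seteqP; split => w h.
    move=> [i [j|[k|k]]] _.
    - exact: (h (@Ordinal 3 2 isT) I (i, j)).
    - exact: (h (@Ordinal 3 1 isT) I (i, k)).
    - exact: (h (@Ordinal 3 0 isT) I (i, k)).
  by move=> [[|[|[|//]]] ?] _; rewrite (tnth_nth setT)/= => x _; exact: h.
move=> ->; last by move=> [[|[|[|//]]] ?]; rewrite !(tnth_nth setT) ?(tnth_nth set0)/=.
rewrite !big_ord_recl big_ord0 mule1 !(tnth_nth setT)/= Ed Ep Ee.
have pairs (W : finType) (B : 'I_n * W -> set T) :
    (\prod_x P (B x) = \prod_i \prod_v P (B (i, v)))%E.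
  by rewrite pair_bigA; apply: eq_bigr => -[].
rewrite !pairs -!big_split/=.
apply: eq_bigr => i _; rewrite !big_sumType/=.
by rewrite muleA muleC; congr (_ * _)%E; exact: muleC.
Qed.

End ModelArray.

(** * Uniform integrability of squares *)

Section UniformSquareIntegrability.
Context {d : measure_display} {T : measurableType d} {R : realType}.
Variable P : probability T R.
Implicit Types (y : nat -> T -> R).

Lemma unif_sqr_int_pow4 y M : (forall i, measurable_fun setT (y i)) ->
  (forall i, L1 P (fun w => y i w ^+ 4)) -> (forall i, Ex P (fun w => y i w ^+ 4) <= M) ->
  unif_sqr_int P y.
Proof.
move=> my ly yM.
have ly2 i : L1 P (fun w => y i w ^+ 2).
  apply: integrable_sqr_L1; first exact: measurable_funX.
  by apply: eq_L1 (ly i) => w; rewrite -exprM.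
split=> // e e0.
have M0 : 0 <= M by apply: le_trans (yM 0%N); apply: Ex_ge0 => w; rewrite (exprM _ 2 2) sqr_ge0.
(* K >= 1 and e K >= M give M/K^2 <= e. *)
pose K := 1 + M / e; have K1 : 1 <= K by rewrite lerDl divr_ge0// ltW.
have K0 : 0 < K by apply: lt_le_trans K1.
exists K => // i; apply: (@le_trans _ _ (Ex P (fun w => K ^- 2 * y i w ^+ 4))).
  apply: le_Ex => [||w]; first by apply: L1_excess => //; exact: ltW.
    exact: L1Z.
  by rewrite (exprM _ 2 2); exact: excess_le_pow4.
rewrite ExZ// mulrC ler_pdivrMr ?exprn_gt0//.
apply: le_trans (yM i) _; apply: (@le_trans _ _ (e * K)).
  by rewrite /K mulrDr mulr1 mulrC divfK ?gt_eqF// lerDr ltW.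
by rewrite ler_pM2l// expr2 ler_peMl// ltW.
Qed.

Lemma Ex_excess_cvg0 (f : T -> R) : measurable_fun setT f -> L1 P (fun w => f w ^+ 2) ->
  Ex P (fun w => excess n.+1%:R (f w)) @[n --> \oo] --> 0.
Proof.
move=> mf lf; rewrite -(Ex_cst P 0).
apply: (@Ex_dominated _ _ _ P (fun n w => excess n.+1%:R (f w)) _ (fun w => f w ^+ 2)) => //.
- by move=> n; exact: (measurableT_comp (measurable_excess _)).
- move=> w; apply: cvg_near_cst; near=> n.
  rewrite /excess max_r ?expr0n// subr_le0.
  apply: (@le_trans _ _ n%:R); last by rewrite ler_nat.
  by near: n; exact: nbhs_infty_ger.
- by move=> n w; rewrite ger0_norm ?excess_ge0// excess_le_sqr.
Unshelve. all: by end_near. Qed.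

(** Equal laws reduce uniformity to a single variable. This serves the squares of errors, whose
    fourth moments would be eighth moments of the errors. *)
Lemma unif_sqr_int_same_law y : (forall i, measurable_fun setT (y i)) ->
  (forall i A, measurable A -> P (y i @^-1` A) = P (y 0%N @^-1` A)) ->
  L1 P (fun w => y 0%N w ^+ 2) -> unif_sqr_int P y.
Proof.
move=> my law l0.
have sl i (f : R -> R) : measurable_fun setT f -> L1 P (f \o y 0%N) ->
    L1 P (f \o y i) /\ Ex P (f \o y 0%N) = Ex P (f \o y i).
  by move=> mf lf; apply: same_law_Ex => // A mA; rewrite law.
split=> //.
  by move=> i; have [] := sl i (fun x => x ^+ 2) (measurable_funX _ (@measurable_id _ _ _)) l0.
move=> e e0; have /cvgr0Pnorm_le/(_ _ e0)[n _ hn] := Ex_excess_cvg0 (my 0%N) l0.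
exists n.+1%:R => // i.
have [_ <-] := sl i _ (measurable_excess n.+1%:R) (L1_excess (ler0n R n.+1) (my 0%N) l0).
by apply: le_trans (ler_norm _) _; exact: (hn n (leqnn n)).
Qed.

Lemma unif_sqr_intD y y' : unif_sqr_int P y -> unif_sqr_int P y' ->
  unif_sqr_int P (fun i w => y i w + y' i w).
Proof.
move=> [my ly uy] [my' ly' uy'].
have mD i : measurable_fun setT (fun w => y i w + y' i w) by exact: measurable_funD.
have lD i : L1 P (fun w => (y i w + y' i w) ^+ 2).
  apply: L1_le (L1Z 2 (L1D (ly i) (ly' i))) _ => [|w]; first exact: measurable_funX.
  by rewrite ger0_norm ?sqr_ge0//; have := sqr_ge0 (y i w - y' i w); nra.
(* [excessD] puts a factor 2 on each of two terms. *)
split=> // e e0; have e40 : 0 < e / 4 by rewrite divr_gt0.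
have [K K0 hK] := uy _ e40; have [K' K'0 hK'] := uy' _ e40.
pose M := Num.max K K'; have M0 : 0 < M by rewrite lt_max K0.
exists (M + M) => [|i]; first by rewrite addr_gt0.
have ex (f : T -> R) : measurable_fun setT f -> L1 P (fun w => f w ^+ 2) -> L1 P (fun w => excess M (f w)).
  by apply: L1_excess; exact: ltW.
apply: (@le_trans _ _ (Ex P (fun w => 2 * excess M (y i w) + 2 * excess M (y' i w)))).
  apply: le_Ex => [||w]; last exact: excessD.
    by apply: L1_excess => //; rewrite addr_ge0// ltW.
  by apply: L1D; apply: L1Z; exact: ex.
rewrite ExD; [|by apply: L1Z; exact: ex..].
rewrite !ExZ; [|by exact: ex..].
have lev (f : T -> R) c : measurable_fun setT f -> L1 P (fun w => f w ^+ 2) -> 0 < c -> c <= M ->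
    Ex P (fun w => excess M (f w)) <= Ex P (fun w => excess c (f w)).
  move=> mf lf c0 cM; apply: le_Ex => [||w]; [exact: ex|by apply: L1_excess => //; exact: ltW|].
  exact: le_excess_level.
have h1 := lev _ K (my i) (ly i) K0 _; have h2 := lev _ K' (my' i) (ly' i) K'0 _.
have {}h1 := le_trans (h1 _) (hK i); have {}h2 := le_trans (h2 _) (hK' i).
by move: h1 h2; rewrite /M !le_max !lexx ?orbT => /(_ isT) h1 /(_ isT) h2; lra.
Qed.

Lemma unif_sqr_intZ y (c : nat -> R) C : (forall i, `|c i| <= C) -> unif_sqr_int P y ->
  unif_sqr_int P (fun i w => c i * y i w).
Proof.
move=> cC [my ly uy].
have mZ i : measurable_fun setT (fun w => c i * y i w) by exact: measurable_funM.
have lZ i : L1 P (fun w => (c i * y i w) ^+ 2).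
  by apply: eq_L1 (L1Z (c i ^+ 2) (ly i)) => w; rewrite exprMn.
have C0 : 0 <= C by apply: le_trans (cC 0%N).
pose D := C + 1; have D0 : 0 < D by rewrite ltr_wpDl.
split=> // e e0.
have [|K K0 hK] := uy (e / D ^+ 2); first by rewrite divr_gt0// exprn_gt0.
exists (D * K) => [|i]; first exact: mulr_gt0.
have lE : L1 P (fun w => excess K (y i w)) by apply: L1_excess => //; exact: ltW.
apply: (@le_trans _ _ (Ex P (fun w => D ^+ 2 * excess K (y i w)))).
  apply: le_Ex => [||w]; first by apply: L1_excess => //; rewrite mulr_ge0// ltW.
    exact: L1Z.
  rewrite -excessM ?(ltW D0)//; apply: le_excess.
  rewrite !normrM ler_wpM2r// (le_trans (cC i))// (gtr0_norm D0) lerDl//.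
by rewrite ExZ// -ler_pdivlMl ?exprn_gt0// mulrC.
Qed.

Lemma unif_sqr_int_cst (c : R) : unif_sqr_int P (fun _ _ => c).
Proof.
apply: unif_sqr_int_same_law => //; exact: L1_cst.
Qed.

Lemma unif_sqr_int_sum (I : Type) (s : seq I) (y : I -> nat -> T -> R) :
  (forall a, unif_sqr_int P (y a)) -> unif_sqr_int P (fun i w => \sum_(a <- s) y a i w).
Proof.
move=> uy; elim: s => [|a s ih].
  have := unif_sqr_int_cst 0; congr unif_sqr_int.
  by apply/funext => i; apply/funext => w; rewrite big_nil.
have := unif_sqr_intD (uy a) ih; congr unif_sqr_int.
by apply/funext => i; apply/funext => w; rewrite big_cons.
Qed.

End UniformSquareIntegrability.

(** * Monomials in the errors of a row and their normalized sums *)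

Section RowFeatures.
Context {d : measure_display} {T : measurableType d} {R : realType}.
Variable P : probability T R.
Variables (V : finType) (z : nat * V -> T -> R) (iid : pred V).
Hypothesis mz : forall iv, measurable_fun setT (z iv).
Hypothesis z_indep : mutually_independent P (fun iv => sigma_rv (z iv)).
Hypothesis z_L4 : forall iv, L1 P (fun w => z iv w ^+ 4).
Hypothesis z_moments : forall i v k, (k <= 4)%N ->
  Ex P (fun w => z (i, v) w ^+ k) = Ex P (fun w => z (0%N, v) w ^+ k).
Hypothesis z_law : forall i v A, iid v -> measurable A ->
  P (z (i, v) @^-1` A) = P (z (0%N, v) @^-1` A).

Lemma L1_power (f : T -> R) k : measurable_fun setT f -> L1 P (fun w => f w ^+ 4) -> (k <= 4)%N ->
  L1 P (fun w => f w ^+ k).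
Proof.
move=> mf l4 k4; apply: L1_le (L1D (L1_cst P 1) l4) _ => [|w]; first exact: measurable_funX.
rewrite normrX -[f w ^+ 4]ger0_norm ?(exprM _ 2 2) ?sqr_ge0// -exprM normrX.
have [f1|f1] := leP `|f w| 1.
  by apply: le_trans (exprn_ile1 k (normr_ge0 _) f1) _; rewrite lerDl exprn_ge0.
apply: (@le_trans _ _ (`|f w| ^+ 4)); last by rewrite lerDr.
exact: ler_weXn2l (ltW f1) _ _ k4.
Qed.

Definition mono (s : seq V) i w : R := \prod_(v <- s) z (i, v) w.

(** Equal letters are grouped into powers, so that the factors are independent; with at most four
    letters only moments up to order four occur, and these are the same in all rows. *)
Lemma mono_Ex s i : (size s <= 4)%N -> L1 P (mono s i) /\
  Ex P (mono s i) = \prod_(v <- undup s) Ex P (fun w => z (0%N, v) w ^+ count_mem v s).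
Proof.
move=> s4; pose g (iv : nat * V) (x : R) := x ^+ count_mem iv.2 s.
have c4 v : (count_mem v s <= 4)%N by rewrite (leq_trans (count_size _ _)).
have -> : mono s i = fun w => \prod_(iv <- [seq (i, v) | v <- undup s]) g iv (z iv w).
  apply/funext => w; rewrite big_map /g/= /mono.
  by rewrite -[LHS](prodr_undup_exp_count s xpredT (fun v => z (i, v) w)).
have [||iv|l1 _ ->] := vars_Ex_prod (s := [seq (i, v) | v <- undup s]) (g := g) mz z_indep.
- by rewrite map_inj_uniq ?undup_uniq// => ? ? [].
- by move=> iv; exact: measurable_funX.
- exact: L1_power.
by split=> //; rewrite big_map; apply: eq_bigr => v _; exact: z_moments.
Qed.

(** Only the mean is asked to be the same in all rows: some variables share moments across rows, not
    laws. *)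
Definition row_stable (f : nat -> T -> R) :=
  (forall i, L1 P (f i)) /\ (forall i, Ex P (f i) = Ex P (f 0%N)).

Lemma row_stable_mono s : (size s <= 4)%N -> row_stable (mono s).
Proof. by move=> s4; split=> i; have [] := mono_Ex i s4 => // _ ->; have [_ ->] := mono_Ex 0 s4. Qed.

Lemma row_stable_cst c : row_stable (fun _ _ => c).
Proof. by split=> // i; exact: L1_cst. Qed.

Lemma row_stableD f g : row_stable f -> row_stable g -> row_stable (fun i w => f i w + g i w).
Proof.
move=> [lf ef] [lg eg]; split=> i; first exact: L1D.
by rewrite !ExD// ef eg.
Qed.

Lemma row_stableZ c f : row_stable f -> row_stable (fun i w => c * f i w).
Proof.
by move=> [lf ef]; split=> i; [exact: L1Z|rewrite !ExZ// ef].
Qed.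

Let word (a : V + V * V) : seq V :=
  match a with inl v => [:: v] | inr (v, u) => [:: v; u] end.

Let keep (a : V + V * V) : bool :=
  match a with inl v => true | inr (v, u) => (v != u) || iid v end.

(* The square of a variable is a feature only when its law does not depend on
   the row: fourth moments alone do not make squares uniformly square integrable. *)
Definition feature (a : V + V * V) (i : nat) (w : T) : R :=
  (keep a)%:R * (mono (word a) i w - Ex P (mono (word a) 0)).

Let word2 a : (size (word a) <= 2)%N.
Proof. by case: a => [|[]]. Qed.

Let word4 a : (size (word a) <= 4)%N.
Proof. by rewrite (leq_trans (word2 a)). Qed.

Lemma mono_cat s t i w : mono (s ++ t) i w = mono s i w * mono t i w.
Proof. exact: big_cat. Qed.

Lemma feature_stable a : row_stable (feature a).
Proof.
apply: row_stableZ; apply: row_stableD; first exact: row_stable_mono.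
exact: row_stable_cst.
Qed.

Lemma feature_mean a i : Ex P (feature a i) = 0.
Proof.
have [l0 _] := row_stable_mono (word4 a).
have [lf ->] := feature_stable a.
rewrite ExZ; last by apply: L1B => //; exact: L1_cst.
by rewrite ExB ?Ex_cst ?subrr ?mulr0//; exact: L1_cst.
Qed.

(** The product has degree at most four: this is where third and fourth moments enter. *)
Lemma feature_cross a b : row_stable (fun i w => feature a i w * feature b i w).
Proof.
set ca := Ex P (mono (word a) 0); set cb := Ex P (mono (word b) 0).
have -> : (fun i w => feature a i w * feature b i w) = (fun i w =>
    (keep a)%:R * (keep b)%:R * (mono (word a ++ word b) i w +
      ((- cb) * mono (word a) i w + ((- ca) * mono (word b) i w + ca * cb)))).
  apply/funext => i; apply/funext => w; rewrite mono_cat /feature -/ca -/cb; ring.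
apply: row_stableZ; apply: row_stableD.
  apply: row_stable_mono; rewrite size_cat.
  exact: leq_add (word2 a) (word2 b).
apply: row_stableD; first by apply: row_stableZ; exact: row_stable_mono.
apply: row_stableD; first by apply: row_stableZ; exact: row_stable_mono.
exact: row_stable_cst.
Qed.

Lemma mono_vars (J : set (nat * V)) s i : (forall v, J (i, v)) -> vars_fun z J (mono s i).
Proof.
move=> Ji; rewrite /mono; elim: s => [|v s ih].
  by under eq_fun do rewrite big_nil; exact: vars_fun_cst.
under eq_fun do rewrite big_cons.
by apply: vars_funM => //; exact: vars_fun_var.
Qed.

Lemma feature_vars (J : set (nat * V)) a i : (forall v, J (i, v)) -> vars_fun z J (feature a i).
Proof.
move=> Ji; apply: vars_funM; first exact: vars_fun_cst.
by apply: vars_funD; [exact: mono_vars|exact: vars_fun_cst].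
Qed.

Lemma vars_measurable J f : vars_fun z J f -> measurable_fun setT f.
Proof. exact: vars_fun_measurable. Qed.

Lemma mono_measurable s i : measurable_fun setT (mono s i).
Proof. by apply: (vars_measurable (J := setT)); exact: mono_vars. Qed.

Lemma mono1_unif v : unif_sqr_int P (mono [:: v]).
Proof.
have e i w : mono [:: v] i w = z (i, v) w by rewrite /mono big_seq1.
have -> : mono [:: v] = fun i => z (i, v) by apply/funext => i; apply/funext => w.
apply: (@unif_sqr_int_pow4 _ _ _ _ _ (Ex P (fun w => z (0%N, v) w ^+ 4))) => // i.
by rewrite z_moments.
Qed.

(** For distinct variables the fourth moment of the product factorizes into fourth moments. *)
Lemma mono2_unif v u : v != u -> unif_sqr_int P (mono [:: v; u]).
Proof.
move=> vu.
have H i : L1 P (fun w => mono [:: v; u] i w ^+ 4) /\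
    Ex P (fun w => mono [:: v; u] i w ^+ 4) =
    Ex P (fun w => z (0%N, v) w ^+ 4) * Ex P (fun w => z (0%N, u) w ^+ 4).
  pose g (iv : nat * V) (x : R) := x ^+ 4.
  have [||iv|+ _] := vars_Ex_prod (s := [:: (i, v); (i, u)]) (g := g) mz z_indep.
  - by rewrite /= inE xpair_eqE eqxx/= vu.
  - by move=> iv; exact: measurable_funX.
  - exact: z_L4.
  rewrite (_ : (fun w => _) = (fun w => mono [:: v; u] i w ^+ 4)).
    by move=> h ->; rewrite big_cons big_seq1 -!(z_moments i).
  by apply/funext => w; rewrite /mono !big_cons !big_nil !mulr1 exprMn.
apply: (@unif_sqr_int_pow4 _ _ _ _ _ (Ex P (fun w => z (0%N, v) w ^+ 4) *
  Ex P (fun w => z (0%N, u) w ^+ 4))) => i; first exact: mono_measurable.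
  by have [] := H i.
by have [_ ->] := H i.
Qed.

Lemma mono_sqr_unif v : iid v -> unif_sqr_int P (mono [:: v; v]).
Proof.
move=> iv.
have e i w : mono [:: v; v] i w = z (i, v) w ^+ 2 by rewrite /mono big_cons big_seq1.
have -> : mono [:: v; v] = fun i w => z (i, v) w ^+ 2 by apply/funext => i; apply/funext => w.
apply: unif_sqr_int_same_law => [i|i A mA|].
- exact: measurable_funX.
- have mA' : measurable ((fun x : R => x ^+ 2) @^-1` A).
    by rewrite -[X in measurable X]setTI; exact: (measurable_funX 2 (@measurable_id _ _ _)).
  exact: (z_law i iv mA').
- by apply: eq_L1 (z_L4 (0%N, v)) => w; rewrite -exprM.
Qed.

Lemma feature_unif a : unif_sqr_int P (feature a).
Proof.
have [ka|ka] := boolP (keep a); last first.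
  have := unif_sqr_int_cst P 0; congr unif_sqr_int.
  by apply/funext => i; apply/funext => w; rewrite /feature (negbTE ka) mul0r.
have um : unif_sqr_int P (mono (word a)).
  case: a ka => [v _|[v u] /= ]; first exact: mono1_unif.
  by have [->/=|vu _] := eqVneq v u; [exact: mono_sqr_unif|exact: mono2_unif].
have := unif_sqr_intD um (unif_sqr_int_cst P (- Ex P (mono (word a) 0))).
congr unif_sqr_int; apply/funext => i; apply/funext => w.
by rewrite /feature ka mul1r.
Qed.

(* The class of row contributions that obey the central limit theorem: M enters them
   through the coefficients only, and these converge. *)
Definition row_lin (y : nat -> T -> R) := exists (c : nat -> V + V * V -> R) (l : V + V * V -> R),
  (forall a, c i a @[i --> \oo] --> l a) /\
  forall i w, y i w = \sum_a c i a * feature a i w.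

Lemma row_lin_feature a : row_lin (feature a).
Proof.
exists (fun _ b => (b == a)%:R), (fun b => (b == a)%:R); split=> [b|i w]; first exact: cvg_cst.
rewrite (bigD1 a)//= eqxx mul1r big1 ?addr0// => b /negbTE ->; exact: mul0r.
Qed.

Lemma row_linD y y' : row_lin y -> row_lin y' -> row_lin (fun i w => y i w + y' i w).
Proof.
move=> [c [l [cl yc]]] [c' [l' [cl' yc']]].
exists (fun i a => c i a + c' i a), (fun a => l a + l' a); split=> [a|i w].
  by apply: cvgD; [exact: cl|exact: cl'].
by rewrite yc yc' -big_split; apply: eq_bigr => a _; rewrite mulrDl.
Qed.

Lemma row_linZ (t : nat -> R) (t' : R) y : t i @[i --> \oo] --> t' -> row_lin y ->
  row_lin (fun i w => t i * y i w).
Proof.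
move=> tt [c [l [cl yc]]].
exists (fun i a => t i * c i a), (fun a => t' * l a); split=> [a|i w].
  by apply: cvgM => //; exact: cl.
by rewrite yc mulr_sumr; apply: eq_bigr => a _; rewrite mulrA.
Qed.

Lemma row_lin_sum (I : Type) (s : seq I) (y : I -> nat -> T -> R) :
  (forall k, row_lin (y k)) -> row_lin (fun i w => \sum_(k <- s) y k i w).
Proof.
move=> ly; elim: s => [|k s [c [l [cl yc]]]].
  exists (fun _ _ => 0), (fun=> 0); split=> [a|i w]; first exact: cvg_cst.
  by rewrite big_nil big1// => a _; rewrite mul0r.
have [c' [l' [cl' yc']]] := row_linD (ly k) (ex_intro _ c (ex_intro _ l (conj cl yc))).
by exists c', l'; split=> // i w; rewrite big_cons yc'.
Qed.

Lemma row_lin_unif y : row_lin y -> unif_sqr_int P y.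
Proof.
move=> [c [l [cl yc]]].
have -> : y = fun i w => \sum_a c i a * feature a i w.
  by apply/funext => i; apply/funext => w; exact: yc.
apply: unif_sqr_int_sum => a.
have /cvg_seq_bounded [M [_ hM]] : cvgn (c^~ a) by apply/cvg_ex; exists (l a).
apply: (@unif_sqr_intZ _ _ _ _ _ (c^~ a) (`|M| + 1)); last exact: feature_unif.
by move=> i; apply: (hM (`|M| + 1)) => //; rewrite (le_lt_trans (ler_norm _))// ltrDl.
Qed.

Lemma row_lin_vars (J : set (nat * V)) y i : row_lin y -> (forall v, J (i, v)) ->
  vars_fun z J (y i).
Proof.
move=> [c [l [cl yc]]] Ji.
have -> : y i = fun w => \sum_a c i a * feature a i w by apply/funext => w; exact: yc.
apply: vars_fun_sum => a; apply: vars_funM; first exact: vars_fun_cst.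
exact: feature_vars.
Qed.

Lemma row_lin_mean y i : row_lin y -> L1 P (y i) /\ Ex P (y i) = 0.
Proof.
move=> [c [l [cl yc]]].
have -> : y i = fun w => \sum_a c i a * feature a i w by apply/funext => w; exact: yc.
have lf a : L1 P (fun w => c i a * feature a i w) by apply: L1Z; have [] := feature_stable a.
split; first exact: L1_sum.
rewrite Ex_sum// big1// => a _; rewrite ExZ ?feature_mean ?mulr0//.
by have [] := feature_stable a.
Qed.

(** Expanded in features, the cross moment has convergent coefficients and feature moments that do
    not depend on the row. *)
Lemma row_lin_cross y y' : row_lin y -> row_lin y' ->
  (forall i, L1 P (fun w => y i w * y' i w)) /\
  exists v : R, Ex P (fun w => y i w * y' i w) @[i --> \oo] --> v.
Proof.
move=> [c [l [cl yc]]] [c' [l' [cl' yc']]].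
have lab i a b : L1 P (fun w => c i a * c' i b * (feature a i w * feature b i w)).
  by apply: L1Z; have [] := feature_cross a b.
have e i : (fun w => y i w * y' i w) =
    fun w => \sum_a \sum_b c i a * c' i b * (feature a i w * feature b i w).
  apply/funext => w; rewrite yc yc' mulr_suml; apply: eq_bigr => a _.
  by rewrite mulr_sumr; apply: eq_bigr => b _; ring.
split=> [i|]; first by rewrite e; apply: L1_sum => a; exact: L1_sum.
exists (\sum_a \sum_b l a * l' b * Ex P (fun w => feature a 0 w * feature b 0 w)).
under eq_fun => i.
  rewrite e Ex_sum; last by move=> a; exact: L1_sum.
  under eq_bigr => a _.
    rewrite Ex_sum//; under eq_bigr => b _.
      have [lf ef] := feature_cross a b.
      rewrite ExZ// ef; over.
    over.
  over.
apply: cvg_bigsum => a; apply: cvg_bigsum => b.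
apply: cvgM; last exact: cvg_cst.
by apply: cvgM; [exact: cl|exact: cl'].
Qed.

Definition nsum (y : nat -> T -> R) n (w : T) : R := (Num.sqrt n%:R)^-1 * \sum_(i < n) y i w.

Lemma partial_sum_vars y n : row_lin y ->
  vars_fun z [set iv | (iv.1 < n)%N] (fun w => \sum_(i < n) y i w).
Proof. by move=> ly; apply: vars_fun_sum => i; apply: row_lin_vars => // v /=. Qed.

Lemma row_lin_indep y n : row_lin y -> indep_rv P (fun w => \sum_(j < n) y j w) (y n).
Proof.
move=> ly; have vn : vars_fun z [set iv | iv.1 = n] (y n) by exact: row_lin_vars.
apply: (vars_indep_rv mz z_indep _ (partial_sum_vars (n := n) ly) vn).
by apply/seteqP; split => // iv [/= + e]; rewrite e ltnn.
Qed.

Lemma rows_cross0 y y' i j : row_lin y -> row_lin y' -> i != j ->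
  L1 P (fun w => y i w * y' j w) /\ Ex P (fun w => y i w * y' j w) = 0.
Proof.
move=> ly ly' ij.
have vi : vars_fun z [set iv | iv.1 = i] (y i) by exact: row_lin_vars.
have vj : vars_fun z [set iv | iv.1 = j] (y' j) by exact: row_lin_vars.
have [li ei] := row_lin_mean i ly; have [lj ej] := row_lin_mean j ly'.
have [|l ->] := vars_ExM mz z_indep _ vi vj li lj; last by rewrite ei mul0r.
by apply/seteqP; split => // iv [/= -> /eqP]; rewrite (negbTE ij).
Qed.

(** Distinct rows are independent and centred, so the double sum over rows reduces to its
    diagonal. *)
Lemma nsum_cross y y' n : row_lin y -> row_lin y' ->
  L1 P (fun w => nsum y n w * nsum y' n w) /\
  Ex P (fun w => nsum y n w * nsum y' n w) =
  n%:R^-1 * \sum_(i < n) Ex P (fun w => y i w * y' i w).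
Proof.
move=> ly ly'; have [lii _] := row_lin_cross ly ly'.
have lij (i j : 'I_n) : L1 P (fun w => y i w * y' j w).
  by have [->//|ij] := eqVneq (i : nat) j; have [] := rows_cross0 ly ly' ij.
have -> : (fun w => nsum y n w * nsum y' n w) =
    fun w => n%:R^-1 * \sum_(i < n) \sum_(j < n) y i w * y' j w.
  apply/funext => w; rewrite /nsum mulrACA -invfM -expr2 sqr_sqrtr//; congr (_ * _).
  by rewrite mulr_suml; apply: eq_bigr => i _; rewrite mulr_sumr.
have ls : L1 P (fun w => \sum_(i < n) \sum_(j < n) y i w * y' j w).
  by apply: L1_sum => i; exact: L1_sum.
split; first exact: L1Z.
rewrite ExZ// Ex_sum; last by move=> i; exact: L1_sum.
congr (_ * _); apply: eq_bigr => i _; rewrite Ex_sum//.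
rewrite (bigD1 i)//= big1 ?addr0// => j ji.
by have [|_ ->//] := rows_cross0 (i := i) (j := j) ly ly'; rewrite eq_sym.
Qed.

Lemma nsum_cross_cvg y y' (v : R) : row_lin y -> row_lin y' ->
  Ex P (fun w => y i w * y' i w) @[i --> \oo] --> v ->
  Ex P (fun w => nsum y n w * nsum y' n w) @[n --> \oo] --> v.
Proof.
move=> ly ly' /cesaro_mean; apply: cvg_trans; apply: near_eq_cvg; near=> n.
by have [_ ->] := nsum_cross n ly ly'.
Unshelve. all: by end_near. Qed.

Lemma nsum_clt y (v b : R) : row_lin y -> Ex P (fun w => y n w ^+ 2) @[n --> \oo] --> v ->
  Ex P (fun w => cos (b + nsum y n w)) @[n --> \oo] --> cos b * expR (- v / 2).
Proof.
move=> ly yv; apply: trig_clt => //; first exact: row_lin_unif.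
  by move=> i; have [] := row_lin_mean i ly.
by move=> n; exact: row_lin_indep.
Qed.

Lemma nsum_measurable y n : row_lin y -> measurable_fun setT (nsum y n).
Proof.
move=> ly; apply: measurable_funM => //; apply: vars_measurable.
exact: partial_sum_vars.
Qed.

End RowFeatures.

(** * Asymptotics of the model *)

Section ModelRows.
Context {d : measure_display} {T : measurableType d} {R : realType}.
Context {P : probability T R} {p q : nat}.
Variable m : eiv_model P p q.
Hypothesis Hm : eiv_assumptions m.

Local Notation B := (regB m).
Local Notation z := (errors m).
Local Notation V := ('I_q + ('I_p + 'I_p))%type.

Definition identical (v : V) : bool := if v is inr _ then true else false.

Definition scale (v : V) : R :=
  match v with inl _ => sig_eps m | inr (inl _) => sig_psi m | inr (inr _) => sig_del m end.

Lemma moments_Ex (X : {RV P >-> R}) s g1 g2 : moments X s g1 g2 ->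
  [/\ L1 P (fun w => X w ^+ 4), Ex P X = 0, Ex P (fun w => X w ^+ 2) = s ^+ 2,
      Ex P (fun w => X w ^+ 3) = g1 * s ^+ 3 & Ex P (fun w => X w ^+ 4) = (g2 + 3) * s ^+ 4].
Proof.
move=> [e1 e2 e3 e4].
have mX : measurable_fun setT X by exact: measurable_funPT.
have [||l4 E4] := @L1_ge0 _ _ _ P (fun w => X w ^+ 4) ((g2 + 3) * s ^+ 4) _ _ e4.
- exact: measurable_funX.
- by move=> w; rewrite (exprM _ 2 2) sqr_ge0.
split=> //; [by rewrite -fine_expectation e1| |by rewrite -fine_expectation e3].
have -> : Ex P (fun w => X w ^+ 2) = fine ('V_P[X])%E.
  rewrite /variance unlock e1 -[LHS]fine_expectation; congr (fine ('E_P[_])%E).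
  by apply/funext => w; rewrite -[RHS]/((X w - 0) * (X w - 0)) subr0 expr2.
by rewrite e2.
Qed.

Lemma errors_moments iv : exists s g1 g2, exists X : {RV P >-> R},
  [/\ z iv = X, moments X s g1 g2 & s = scale iv.2].
Proof.
case: iv => i [j|[k|k]].
- exists (sig_eps m), (gam1_eps m), (gam2_eps m), (eps m i j); split=> //; exact: eps_moments.
- exists (sig_psi m), (gam1_psi m), (gam2_psi m), (psi m i k); split=> //; exact: psi_moments.
- exists (sig_del m), (gam1_del m), (gam2_del m), (del m i k); split=> //; exact: del_moments.
Qed.

Lemma errors_L4 iv : L1 P (fun w => z iv w ^+ 4).
Proof.
by have [s [g1 [g2 [X [-> /moments_Ex[]]]]]] := errors_moments iv.
Qed.

Lemma errors_mean iv : Ex P (z iv) = 0.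
Proof.
by have [s [g1 [g2 [X [-> /moments_Ex[]]]]]] := errors_moments iv.
Qed.

Lemma errors_sqr iv : Ex P (fun w => z iv w ^+ 2) = scale iv.2 ^+ 2.
Proof.
by have [s [g1 [g2 [X [-> /moments_Ex[_ _ -> _ _ ->]]]]]] := errors_moments iv.
Qed.

Lemma errors_moment_eq i v k : (k <= 4)%N ->
  Ex P (fun w => z (i, v) w ^+ k) = Ex P (fun w => z (0%N, v) w ^+ k).
Proof.
suff H (X Y : {RV P >-> R}) s g1 g2 : moments X s g1 g2 -> moments Y s g1 g2 ->
    (k <= 4)%N -> Ex P (fun w => X w ^+ k) = Ex P (fun w => Y w ^+ k).
  case: v => [j|[j|j]]; rewrite /errors/=.
  - apply: H; exact: eps_moments.
  - apply: H; exact: psi_moments.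
  - apply: H; exact: del_moments.
move=> /moments_Ex[_ x1 x2 x3 x4] /moments_Ex[_ y1 y2 y3 y4].
case: k => [|[|[|[|[|k]]]]]// _.
- by under eq_fun do rewrite expr1; rewrite x1; under eq_fun do rewrite expr1; rewrite y1.
- by rewrite x2.
- by rewrite x3.
- by rewrite x4.
Qed.

Lemma errors_law i v A : identical v -> measurable A ->
  P (z (i, v) @^-1` A) = P (z (0%N, v) @^-1` A).
Proof.
case: v => [j|[j|j]]// _ mA; rewrite /errors/=.
  exact: (psi_ident Hm i j 0%N j mA).
exact: (del_ident Hm i j 0%N j mA).
Qed.

Definition mrow_lin := @row_lin _ _ _ P _ z identical.

Lemma mrow_lin_var v : mrow_lin (fun i => z (i, v)).
Proof.
have := row_lin_feature P z identical (inl v); congr row_lin.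
apply/funext => i; apply/funext => w; rewrite /feature /mono big_seq1 mul1r.
under eq_fun do rewrite big_seq1.
by rewrite errors_mean subr0.
Qed.

Lemma mrow_lin_prod v u : (v != u) || identical v ->
  mrow_lin (fun i w => z (i, v) w * z (i, u) w - (v == u)%:R * scale v ^+ 2).
Proof.
move=> kvu; have := row_lin_feature P z identical (inr (v, u)); congr row_lin.
apply/funext => i; apply/funext => w; rewrite /feature kvu mul1r /mono !big_cons !big_nil mulr1.
congr (_ - _); under eq_fun do rewrite !big_cons big_nil mulr1.
have [<-|vu] := eqVneq v u.
  by rewrite mul1r; under eq_fun do rewrite -expr2; rewrite errors_sqr.
have vi v' : vars_fun z [set (0%N, v')] (z (0%N, v')) by exact: vars_fun_var.
have l1 v' : L1 P (z (0%N, v')).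
  by apply: (L1_power (k := 1) (measurable_errors m _) (errors_L4 _)).
have [|_ ->] := vars_ExM (measurable_errors m) (errors_independent Hm) _ (vi v) (vi u) (l1 v) (l1 u).
  by apply/seteqP; split=> // iv [/= -> [e]]; rewrite e eqxx in vu.
by rewrite errors_mean !mul0r.
Qed.

(** The contribution of row i to [devh]: the centring n^(1/2) sig_del^2 B is n^(-1/2) times n equal
    parts, one for each row. *)
Definition hrow (k : 'I_p) (j : 'I_q) (i : nat) (w : T) : R :=
  (rowM m i k 0 + psi m i k w + del m i k w) *
    (eps m i j w - \sum_l del m i l w * B l j) + sig_del m ^+ 2 * B k j.

Definition Hrow (k l : 'I_p) (i : nat) (w : T) : R :=
  (rowM m i k 0 + psi m i k w + del m i k w) * (rowM m i l 0 + psi m i l w + del m i l w)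
  - rowM m i k 0 * rowM m i l 0 - (k == l)%:R * (sig_psi m ^+ 2 + sig_del m ^+ 2).

Lemma rowM_coord_cvg k : rowM m i k 0 @[i --> \oo] --> sigmaM m k 0.
Proof.
exact: (@cvg_comp _ _ _ (rowM m) (fun A : 'cV[R]_p => A k 0) \oo (nbhs (sigmaM m))
  (nbhs (sigmaM m k 0)) (rowM_cvg Hm) (@coord_continuous _ _ _ k 0 (sigmaM m))).
Qed.

Let ie (j : 'I_q) : V := inl j.
Let ip (k : 'I_p) : V := inr (inl k).
Let id (k : 'I_p) : V := inr (inr k).

(** [eps] is multiplied by M, [psi] and [del] but never by itself, so every monomial is an
    admissible feature; sig_del^2 B cancels the mean of the squares of [del]. *)
Lemma hrow_lin k j : mrow_lin (hrow k j).
Proof.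
pose f i w : R := (rowM m i k 0 * z (i, ie j) w +
  (z (i, ip k) w * z (i, ie j) w - (ip k == ie j)%:R * scale (ip k) ^+ 2) +
  (z (i, id k) w * z (i, ie j) w - (id k == ie j)%:R * scale (id k) ^+ 2)) +
  \sum_l (- B l j) * (rowM m i k 0 * z (i, id l) w +
    (z (i, ip k) w * z (i, id l) w - (ip k == id l)%:R * scale (ip k) ^+ 2) +
    (z (i, id k) w * z (i, id l) w - (id k == id l)%:R * scale (id k) ^+ 2)).
have -> : hrow k j = f.
  apply/funext => i; apply/funext => w; rewrite /hrow /f /errors/= !mul0r !subr0.
  under [X in _ = _ + X]eq_bigr do rewrite subr0.
  have -> : \sum_l - B l j * (rowM m i k 0 * del m i l w + psi m i k w * del m i l w +
      (del m i k w * del m i l w - (id k == id l)%:R * sig_del m ^+ 2)) =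
      - ((rowM m i k 0 + psi m i k w + del m i k w) * (\sum_l del m i l w * B l j)) +
      sig_del m ^+ 2 * B k j.
    rewrite mulr_sumr -sumrN.
    rewrite (_ : sig_del m ^+ 2 * B k j =
        \sum_l (id k == id l)%:R * sig_del m ^+ 2 * B l j); last first.
      rewrite (bigD1 k)//= eqxx mul1r big1 ?addr0// => l lk.
      by rewrite (_ : (id k == id l) = false) ?mul0r//; apply/negbTE; rewrite eq_sym.
    by rewrite -big_split/=; apply: eq_bigr => l _; ring.
  ring.
apply: row_linD.
  apply: row_linD; last exact: mrow_lin_prod.
  apply: row_linD; last exact: mrow_lin_prod.
  by apply: (row_linZ (@rowM_coord_cvg k)); exact: mrow_lin_var.
apply: row_lin_sum => l; apply: (row_linZ (cvg_cst _)).
apply: row_linD; last by apply: mrow_lin_prod; rewrite orbT.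
apply: row_linD; last exact: mrow_lin_prod.
by apply: (row_linZ (@rowM_coord_cvg k)); exact: mrow_lin_var.
Qed.

(** The products of entries of M cancel, which leaves M as coefficient of terms of degree one; the
    squares are those of [psi] and [del]. *)
Lemma Hrow_lin k l : mrow_lin (Hrow k l).
Proof.
pose f i w : R := rowM m i k 0 * (z (i, ip l) w + z (i, id l) w) +
  rowM m i l 0 * (z (i, ip k) w + z (i, id k) w) +
  (z (i, ip k) w * z (i, ip l) w - (ip k == ip l)%:R * scale (ip k) ^+ 2) +
  (z (i, ip k) w * z (i, id l) w - (ip k == id l)%:R * scale (ip k) ^+ 2) +
  (z (i, id k) w * z (i, ip l) w - (id k == ip l)%:R * scale (id k) ^+ 2) +
  (z (i, id k) w * z (i, id l) w - (id k == id l)%:R * scale (id k) ^+ 2).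
have -> : Hrow k l = f.
  apply/funext => i; apply/funext => w; rewrite /Hrow /f /errors/= !mul0r !subr0.
  have -> : (ip k == ip l) = (k == l) by [].
  have -> : (id k == id l) = (k == l) by [].
  ring.
apply: row_linD; last by apply: mrow_lin_prod; rewrite orbT.
apply: row_linD; last exact: mrow_lin_prod.
apply: row_linD; last exact: mrow_lin_prod.
apply: row_linD; last by apply: mrow_lin_prod; rewrite orbT.
apply: row_linD.
  exact: (row_linZ (@rowM_coord_cvg k) (row_linD (mrow_lin_var _) (mrow_lin_var _))).
exact: (row_linZ (@rowM_coord_cvg l) (row_linD (mrow_lin_var _) (mrow_lin_var _))).
Qed.

(** True at n = 0 as well, where both sides are 0. *)
Lemma rootn_divn n : rootn n * n%:R^-1 = (rootn n)^-1 :> R.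
Proof.
rewrite /rootn; case: n => [|n]; first by rewrite sqrtr0 !invr0 mul0r.
have n0 : Num.sqrt n.+1%:R != 0 :> R by rewrite sqrtr_eq0 -ltNge ltr0n.
by rewrite -[in X in X^-1](sqr_sqrtr (ler0n R n.+1)) expr2 invfM mulrA divff// mul1r.
Qed.

Lemma rootn_muln n : (rootn n)^-1 * n%:R = rootn n :> R.
Proof.
rewrite /rootn; case: n => [|n]; first by rewrite sqrtr0 mulr0.
have n0 : Num.sqrt n.+1%:R != 0 :> R by rewrite sqrtr_eq0 -ltNge ltr0n.
by rewrite -[in X in _ * X](sqr_sqrtr (ler0n R n.+1)) expr2 mulKf.
Qed.

Let addmxE a b (A A' : 'M[R]_(a, b)) i j : (A + A') i j = A i j + A' i j.
Proof. exact: mxE. Qed.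

Let scalemxE a b c (A : 'M[R]_(a, b)) i j : (c *: A) i j = c * A i j.
Proof. exact: mxE. Qed.

Let oppmxE a b (A : 'M[R]_(a, b)) i j : (- A) i j = - A i j.
Proof. exact: mxE. Qed.

Lemma devh_nsum n w k j : devh m n w k j = nsum (hrow k j) n w.
Proof.
rewrite /devh /nsum /hrow addmxE !scalemxE.
rewrite big_split/= sumr_const card_ord mulrDr -/(rootn n); congr (_ + _).
  congr (_ * _); rewrite mxE; apply: eq_bigr => i _; rewrite !mxE; congr (_ * (_ - _)).
  by apply: eq_bigr => l _; rewrite mxE.
by rewrite -[(_ * _) *+ n]mulr_natl [RHS]mulrA rootn_muln.
Qed.

Lemma devH_nsum n w k l : devH m n w k l = nsum (Hrow k l) n w.
Proof.
rewrite /devH /nsum /Hrow addmxE oppmxE !scalemxE.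
rewrite -/(rootn n) !sumrB sumr_const card_ord !mulrBr.
rewrite -addrA; congr (_ + _).
  congr (_ * _); rewrite mxE; apply: eq_bigr => i _; by rewrite !mxE.
rewrite -opprD; congr (- _); rewrite /SigmaX -addrA addmxE scalemxE mulrDr; congr (_ + _).
  rewrite mulrA rootn_divn; congr (_ * _); rewrite mxE; apply: eq_bigr => i _; by rewrite !mxE.
rewrite -[(_ * _) *+ n]mulr_natl [RHS]mulrA rootn_muln; congr (_ * _).
by rewrite !mxE -mulrnDl mulr_natl.
Qed.

End ModelRows.

(** * Limits in probability of the sample matrices *)

Section ModelLimits.
Context {d : measure_display} {T : measurableType d} {R : realType}.
Context {P : probability T R} {p q : nat}.
Variable m : eiv_model P p q.
Hypothesis Hm : eiv_assumptions m.
Hypothesis Sigma_inv : Sigmalim m \in unitmx.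

Local Notation B := (regB m).

(** The limit of [KXbar], in which the factor Sigma_X - Sigma_D is exactly sig_del^2 I for every
    n. *)
Definition Kbar : 'M[R]_p := (sig_del m ^+ 2)%:M *m invmx (Sigmalim m).

Lemma gramM_cvg : mcvg \oo (fun n => n%:R^-1 *: ((smpM m n)^T *m smpM m n)) (sigmaM m *m (sigmaM m)^T).
Proof.
move=> k l; rewrite mxE big_ord1 [X in _ * X]mxE.
have h := @cesaro_mean R (fun i => rowM m i k 0 * rowM m i l 0) (sigmaM m k 0 * sigmaM m l 0).
apply: cvg_trans (h _); last by apply: cvgM; exact: rowM_coord_cvg.
apply: near_eq_cvg; near=> n => /=; rewrite mxE; congr (_ * _); rewrite mxE.
by apply: eq_bigr => i _; rewrite !mxE.
Unshelve. all: by end_near. Qed.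

Lemma SigmaX_cvg : mcvg \oo (SigmaX m) (Sigmalim m).
Proof.
apply: mcvgD; last exact: mcvg_cst.
by apply: mcvgD; [exact: gramM_cvg|exact: mcvg_cst].
Qed.

Lemma SigmaD_cvg : mcvg \oo (SigmaD m) (Sigmalim m - (sig_del m ^+ 2)%:M).
Proof.
rewrite /Sigmalim addrK.
by apply: mcvgD; [exact: gramM_cvg|exact: mcvg_cst].
Qed.

Lemma SigmaXD n : SigmaX m n - SigmaD m n = (sig_del m ^+ 2)%:M.
Proof. by rewrite /SigmaX /SigmaD addrC addKr. Qed.

Lemma KX_cvg : mcvg \oo (KX m) (Klim m).
Proof. by apply: mcvgM; [apply: mcvgV => //; exact: SigmaX_cvg|exact: SigmaD_cvg]. Qed.

Lemma KXbar_cvg : mcvg \oo (KXbar m) Kbar.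
Proof.
rewrite /KXbar; under eq_fun do rewrite SigmaXD.
by apply: mcvgM; [exact: mcvg_cst|apply: mcvgV => //; exact: SigmaX_cvg].
Qed.

Lemma mcvg_fst a b (A : nat -> 'M[R]_(a, b)) l : mcvg \oo A l -> mcvg (asym P) (fun x => A x.1) l.
Proof. by move=> Al i j; exact: (@asym_cvg_fst _ _ _ P R (fun n => A n i j) (l i j) (Al i j)). Qed.

(** The second moments converge, hence are bounded, and Chebyshev's inequality applies. *)
Lemma nsum_tight y : mrow_lin m y -> tight P (fun x => nsum y x.1 x.2).
Proof.
move=> ly; have [l [v cv]] := row_lin_cross (measurable_errors m) (errors_independent Hm)
  (errors_L4 Hm) (errors_moment_eq Hm) ly ly.
have cn := nsum_cross_cvg (measurable_errors m) (errors_independent Hm)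
  (errors_L4 Hm) (errors_moment_eq Hm) ly ly cv.
have /cvg_seq_bounded [M [_ hM]] : cvgn (fun n => Ex P (fun w => nsum y n w * nsum y n w)).
  by apply/cvg_ex; exists v.
have ln n : L1 P (fun w => nsum y n w ^+ 2).
  by have [] := nsum_cross (measurable_errors m) (errors_independent Hm)
    (errors_L4 Hm) (errors_moment_eq Hm) n ly ly.
apply: (@tight_sqr_bounded _ _ _ _ _ (`|M| + 1)) => // n.
  exact: (nsum_measurable (measurable_errors m) n ly).
apply: le_trans (ler_norm _) _; apply: (hM (`|M| + 1)) => //.
by rewrite (le_lt_trans (ler_norm _))// ltrDl.
Qed.

Lemma devH_tight : mtight P (fun x => devH m x.1 x.2).
Proof.
move=> k l; have := nsum_tight (Hrow_lin Hm k l); congr tight.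
by apply/funext => x; rewrite devH_nsum.
Qed.

Lemma devh_tight : mtight P (fun x => devh m x.1 x.2).
Proof.
move=> k l; have := nsum_tight (hrow_lin Hm k l); congr tight.
by apply/funext => x; rewrite devh_nsum.
Qed.

Lemma rootn_inv_cvg0 : (@rootn R n)^-1 @[n --> \oo] --> (0 : R).
Proof.
apply/cvgr0Pnorm_lt => e e0; near=> n.
have n0 : 0 < n%:R :> R by rewrite ltr0n; near: n; exact: nbhs_infty_gt.
rewrite ger0_norm ?invr_ge0 ?sqrtr_ge0// invf_plt ?posrE ?sqrtr_gt0//.
have -> : e^-1 = Num.sqrt (e ^- 2) by rewrite -exprVn sqrtr_sqr ger0_norm// invr_ge0 ltW.
rewrite ltr_sqrt//; near: n; exact: nbhs_infty_gtr.
Unshelve. all: by end_near. Qed.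

Definition scaled_gram n w : 'M[R]_p := n%:R^-1 *: gramX m n w.

Lemma scaled_gramE n w : (0 < n)%N -> scaled_gram n w = ((@rootn R n)^-1)%:M *m devH m n w + SigmaX m n.
Proof.
move=> n0; have s0 : @rootn R n != 0 by rewrite sqrtr_eq0 -ltNge ltr0n.
rewrite mul_scalar_mx /devH scalerBr !scalerA mulVf// scale1r subrK; congr (_ *: _).
by rewrite -invfM -expr2 sqr_sqrtr.
Qed.

(** X'X/n = n^(-1/2) H + Sigma_X with H bounded in probability, so the law of large numbers comes
    from second moment bounds. *)
Lemma scaled_gram_cvg : mcvg (asym P) (fun x => scaled_gram x.1 x.2) (Sigmalim m).
Proof.
apply: (@mcvg_near _ _ _ _ _ _ (fun x => ((@rootn R x.1)^-1)%:M *m devH m x.1 x.2 + SigmaX m x.1)).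
  apply: (filterS _ (@asym_fst _ _ _ P [set n | 0 < n]%N (nbhs_infty_gt 0))) => x /= x0.
  by rewrite scaled_gramE.
rewrite -[Sigmalim m]add0r; apply: mcvgD; last exact: (mcvg_fst SigmaX_cvg).
apply: mcvg0_mtightM; last exact: devH_tight.
apply: (@mcvg_fst p p (fun n => ((@rootn R n)^-1)%:M) 0) => i j; rewrite [X in _ --> X]mxE.
have -> : (fun n => ((@rootn R n)^-1)%:M i j) = (fun n => (@rootn R n)^-1 * (i == j)%:R).
  by apply/funext => n; rewrite mxE mulr_natr.
rewrite -(mul0r (i == j)%:R); apply: cvgM; last exact: cvg_cst.
exact: rootn_inv_cvg0.
Qed.

Definition umx n w : 'M[R]_(p, q) := ((devh m n w)^T + B^T *m KXbar m n *m devH m n w)^T.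
(* [umx0] replaces the sample matrix [KXbar] by its limit, which makes it a sum over the rows. *)
Definition umx0 n w : 'M[R]_(p, q) := ((devh m n w)^T + B^T *m Kbar *m devH m n w)^T.

Lemma umx0_tight : mtight P (fun x => umx0 x.1 x.2).
Proof.
move=> i j.
have t1 := mtightMl (B^T *m Kbar) devH_tight j i.
have := tightD (devh_tight i j) t1; congr tight.
by apply/funext => x; rewrite [RHS]mxE [RHS]mxE [X in _ = X + _]mxE.
Qed.

Lemma umx_sub_cvg0 : mcvg (asym P) (fun x => umx x.1 x.2 - umx0 x.1 x.2) 0.
Proof.
have -> : (fun x => umx x.1 x.2 - umx0 x.1 x.2) =
    (fun x => (B^T *m (KXbar m x.1 - Kbar) *m devH m x.1 x.2)^T).
  apply/funext => x; rewrite /umx /umx0 -linearB/=; congr (_^T).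
  by rewrite opprD addrACA subrr add0r -mulmxBl -mulmxBr.
rewrite -[X in mcvg _ _ X]trmx0; apply: mcvgT.
apply: mcvg0_mtightM; last exact: devH_tight.
rewrite -[X in mcvg _ _ X](mulmx0 _ B^T); apply: mcvgM; first exact: mcvg_cst.
rewrite -(subrr Kbar); apply: mcvgB; last exact: mcvg_cst.
exact: (mcvg_fst KXbar_cvg).
Qed.

End ModelLimits.

(** * Row stacking, Kronecker products and block columns *)

Section StackedIndices.

Lemma nth_pairs (S S' : Type) (s : seq S) (t : seq S') n x0 a0 b0 i j :
  size t = n -> (i < size s)%N -> (j < n)%N ->
  nth x0 [seq (x, y) | x <- s, y <- t] (i * n + j) = (nth a0 s i, nth b0 t j).
Proof.
move=> <-; elim: s i => [|a s ih] [|i]//= si jt.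
  by rewrite nth_cat size_map jt (nth_map b0).
by rewrite nth_cat size_map mulSn -addnA ltnNge leq_addr/= addKn ih.
Qed.

(** [mxvec] numbers pairs by their enumeration, Kronecker products by [mxtens_index]; the explicit
    row-major position identifies the two. *)
Lemma val_mxvec_index a b (i : 'I_a) (j : 'I_b) : mxvec_index i j = (i * b + j)%N :> nat.
Proof.
have lt : (i * b + j < #|{: 'I_a * 'I_b}|)%N.
  by rewrite mxvec_cast; exact: (ltn_ord (mxtens_index (i, j))).
have : enum_val (Ordinal lt) = (i, j).
  rewrite (enum_val_nth (i, j)) /= enumT unlock /=.
  by rewrite (nth_pairs _ i j (size_enum_ord b))/= ?size_enum_ord// !nth_ord_enum.
by move=> e; rewrite /mxvec_index -e enum_valK.
Qed.

Lemma mxvec_index_tens a b (i : 'I_a) (j : 'I_b) : mxvec_index i j = mxtens_index (i, j).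
Proof. by apply: ord_inj; rewrite val_mxvec_index. Qed.

Lemma vecE (R : Type) a b (A : 'M[R]_(a, b)) i j : vec A (mxvec_index i j) 0 = A i j.
Proof. by rewrite /vec mxE mxvecE. Qed.

Lemma vecB (R : pzRingType) a b (A C : 'M[R]_(a, b)) : vec (A - C) = vec A - vec C.
Proof. by rewrite /vec !linearB. Qed.

Lemma vec_mulmx (R : comPzRingType) a b c e (A : 'M[R]_(a, b)) (Y : 'M[R]_(b, c)) (C : 'M[R]_(c, e)) :
  vec (A *m Y *m C) = (A *t C^T) *m vec Y.
Proof.
apply/matrixP => k o; rewrite ord1 {o}; case/mxvec_indexP: k => i j; rewrite vecE.
rewrite [RHS]mxE (reindex _ (curry_mxvec_bij b c))/=.
transitivity (\sum_k \sum_l (A *t C^T) (mxvec_index i j) (mxvec_index k l) *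
  vec Y (mxvec_index k l) 0); last by rewrite pair_bigA; apply: eq_bigr => -[].
rewrite exchange_big/= mxE.
apply: eq_bigr => l _; rewrite mxE mulr_suml; apply: eq_bigr => k _.
by rewrite vecE !mxvec_index_tens tensmxE [C^T _ _]mxE mulrAC.
Qed.

Lemma mxcolE (R : Type) N (p_ : 'I_N -> nat) n (X : forall i, 'M[R]_(p_ i, n)) i k l :
  (\mxcol_i X i) (tagnat.Rank i k) l = X i k l.
Proof. by rewrite -[in RHS](mxcolK X i) [RHS]mxE. Qed.

(** Entry (k, j) of block i has position i p q + k q + j on both sides. *)
Lemma vec_mxcol (R : Type) N p q (X : 'I_N -> 'M[R]_(p, q))
    (e : (\sum_(i < N) p * q = (\sum_(i < N) p) * q)%N) :
  vec (\mxcol_i X i) = castmx (e, erefl 1%N) (\mxcol_i vec (X i)).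
Proof.
apply/matrixP => s o; rewrite ord1 {o}; case/mxvec_indexP: s => r j.
rewrite vecE castmxE /= -[r]tagnat.sig2K; set i := tagnat.sig1 r; set k := tagnat.sig2 r.
have -> : cast_ord (esym e) (mxvec_index (tagnat.Rank i k) j) = tagnat.Rank i (mxvec_index k j).
  apply: ord_inj; transitivity (nat_of_ord (mxvec_index (tagnat.Rank i k) j)); first by [].
  rewrite val_mxvec_index tagnat.RankEsum [RHS]tagnat.RankEsum val_mxvec_index.
  by rewrite mulnDl big_distrl/= addnA.
by rewrite (ord1 (cast_ord _ _)) mxcolE [RHS](mxcolE (fun i => vec (X i))) vecE.
Qed.

End StackedIndices.

(** * The covariance [Lambda] and the cosine limits for u_n *)

Section LimitCovariance.
Context {d : measure_display} {T : measurableType d} {R : realType}.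
Context {P : probability T R} {p q : nat}.
Variable m : eiv_model P p q.
Hypothesis Hm : eiv_assumptions m.
Hypothesis Sigma_inv : Sigmalim m \in unitmx.

Local Notation B := (regB m).

Lemma mrow_cross y y' : mrow_lin m y -> mrow_lin m y' ->
  exists v : R, Ex P (fun w => y i w * y' i w) @[i --> \oo] --> v.
Proof.
move=> ly ly'; have [_ //] := row_lin_cross (measurable_errors m) (errors_independent Hm)
  (errors_L4 Hm) (errors_moment_eq Hm) ly ly'.
Qed.

Lemma mrow_nsum_L1 y y' n : mrow_lin m y -> mrow_lin m y' ->
  L1 P (fun w => nsum y n w * nsum y' n w).
Proof.
move=> ly ly'; have [//] := nsum_cross (measurable_errors m) (errors_independent Hm)
    (errors_L4 Hm) (errors_moment_eq Hm) n ly ly'.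
Qed.

Lemma mrow_nsum_cvg y y' (v : R) : mrow_lin m y -> mrow_lin m y' ->
  Ex P (fun w => y i w * y' i w) @[i --> \oo] --> v ->
  Ex P (fun w => nsum y n w * nsum y' n w) @[n --> \oo] --> v.
Proof.
move=> ly ly' yv; exact: (nsum_cross_cvg (measurable_errors m) (errors_independent Hm)
  (errors_L4 Hm) (errors_moment_eq Hm) ly ly' yv).
Qed.

(** The coefficients may vary with the sample size but not with the row, as those made from [KXbar]
    do; being deterministic, they leave the expectation. *)
Lemma comb_cross_cvg (S S' : finType) (y : S -> nat -> T -> R) (y' : S' -> nat -> T -> R)
    (c : nat -> S -> R) (c' : nat -> S' -> R) (g : S -> R) (g' : S' -> R) (v : S -> S' -> R) :
  (forall s, mrow_lin m (y s)) -> (forall s, mrow_lin m (y' s)) ->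
  (forall s, c n s @[n --> \oo] --> g s) -> (forall s, c' n s @[n --> \oo] --> g' s) ->
  (forall s s', Ex P (fun w => nsum (y s) n w * nsum (y' s') n w) @[n --> \oo] --> v s s') ->
  Ex P (fun w => (\sum_s c n s * nsum (y s) n w) * (\sum_s c' n s * nsum (y' s) n w))
    @[n --> \oo] --> \sum_s \sum_s' g s * g' s' * v s s'.
Proof.
move=> ly ly' cg cg' yv.
have e n : Ex P (fun w => (\sum_s c n s * nsum (y s) n w) * (\sum_s c' n s * nsum (y' s) n w)) =
    \sum_s \sum_s' c n s * c' n s' * Ex P (fun w => nsum (y s) n w * nsum (y' s') n w).
  have -> : (fun w => (\sum_s c n s * nsum (y s) n w) * (\sum_s c' n s * nsum (y' s) n w)) =
      fun w => \sum_s \sum_s' c n s * c' n s' * (nsum (y s) n w * nsum (y' s') n w).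
    apply/funext => w; rewrite mulr_suml; apply: eq_bigr => s _.
    by rewrite mulr_sumr; apply: eq_bigr => s' _; ring.
  have ll s s' : L1 P (fun w => c n s * c' n s' * (nsum (y s) n w * nsum (y' s') n w)).
    by apply: L1Z; exact: mrow_nsum_L1.
  rewrite Ex_sum; last by move=> s; exact: L1_sum.
  apply: eq_bigr => s _; rewrite Ex_sum//; apply: eq_bigr => s' _.
  by rewrite ExZ//; exact: mrow_nsum_L1.
under eq_fun do rewrite e.
apply: cvg_bigsum => s; apply: cvg_bigsum => s'.
apply: cvgM; last exact: yv.
by apply: cvgM; [exact: cg|exact: cg'].
Qed.

Definition urow (k : 'I_p) (j : 'I_q) (i : nat) (w : T) : R :=
  hrow m k j i w + \sum_l (B^T *m Kbar m) j l * Hrow m l k i w.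

Lemma urow_lin k j : mrow_lin m (urow k j).
Proof.
apply: row_linD; first exact: hrow_lin.
apply: row_lin_sum => l; apply: (row_linZ (cvg_cst _)); exact: Hrow_lin.
Qed.

(** An entry of u_n as a single sum: [None] is the entry of h, and [Some l] runs over the product
    with H. *)
Let part (k : 'I_p) (j : 'I_q) (s : option 'I_p) : nat -> T -> R :=
  if s is Some l then Hrow m l k else hrow m k j.

Let coef (K : 'M[R]_p) (j : 'I_q) (s : option 'I_p) : R :=
  if s is Some l then (B^T *m K) j l else 1.

Let part_lin k j s : mrow_lin m (part k j s).
Proof. by case: s => [l|]; [exact: Hrow_lin|exact: hrow_lin]. Qed.

Let sum_option (f : option 'I_p -> R) : \sum_s f s = f None + \sum_l f (Some l).
Proof.
rewrite (bigD1 None)//=; congr (_ + _).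
rewrite (reindex_omap Some id)/=; last by case.
by apply: eq_bigl => l; rewrite eqxx.
Qed.

Lemma umx_part n w k j : umx m n w k j = \sum_s coef (KXbar m n) j s * nsum (part k j s) n w.
Proof.
rewrite sum_option /= mul1r mxE [LHS]mxE [X in X + _]mxE -devh_nsum; congr (_ + _).
by rewrite mxE; apply: eq_bigr => l _; rewrite devH_nsum.
Qed.

Lemma umx0_part n w k j : umx0 m n w k j = \sum_s coef (Kbar m) j s * nsum (part k j s) n w.
Proof.
rewrite sum_option /= mul1r mxE [LHS]mxE [X in X + _]mxE -devh_nsum; congr (_ + _).
by rewrite mxE; apply: eq_bigr => l _; rewrite devH_nsum.
Qed.

Lemma umx0_nsum n w k j : umx0 m n w k j = nsum (urow k j) n w.
Proof.
rewrite umx0_part sum_option /= mul1r /nsum /urow [in RHS]big_split/= mulrDr; congr (_ + _).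
rewrite exchange_big/= mulr_sumr; apply: eq_bigr => l _.
by rewrite -mulr_sumr mulrCA.
Qed.

(** [coef] has the same limits for [KXbar] and [Kbar]. Hence [Lambda], defined through the former,
    is also the limit for the row sums, to which the limit theorem applies. *)
Lemma umx_cross_cvg k j k' j' : exists v : R,
  Ex P (fun w => umx m n w k j * umx m n w k' j') @[n --> \oo] --> v /\
  Ex P (fun w => umx0 m n w k j * umx0 m n w k' j') @[n --> \oo] --> v.
Proof.
have H s s' : exists v : R, Ex P (fun w => nsum (part k j s) n w * nsum (part k' j' s') n w)
    @[n --> \oo] --> v.
  have [v hv] := mrow_cross (part_lin k j s) (part_lin k' j' s').
  by exists v; exact: mrow_nsum_cvg hv.
have H' s : exists f : option 'I_p -> R, forall s',
    Ex P (fun w => nsum (part k j s) n w * nsum (part k' j' s') n w) @[n --> \oo] --> f s'.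
  by have [f hf] := choice (H s); exists f.
have [v hv] := choice H'.
have cK jj s : coef (KXbar m n) jj s @[n --> \oo] --> coef (Kbar m) jj s.
  case: s => [l|]; last exact: cvg_cst.
  have h : mcvg \oo (fun n => B^T *m KXbar m n) (B^T *m Kbar m).
    by apply: mcvgM; [exact: mcvg_cst|exact: KXbar_cvg].
  exact: (h jj l).
exists (\sum_s \sum_s' coef (Kbar m) j s * coef (Kbar m) j' s' * v s s'); split.
  have -> : (fun n => Ex P (fun w => umx m n w k j * umx m n w k' j')) =
      (fun n => Ex P (fun w => (\sum_s coef (KXbar m n) j s * nsum (part k j s) n w) *
                     (\sum_s coef (KXbar m n) j' s * nsum (part k' j' s) n w))).
    by apply/funext => n; congr (Ex P _); apply/funext => w; rewrite !umx_part.
  exact: comb_cross_cvg.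
have -> : (fun n => Ex P (fun w => umx0 m n w k j * umx0 m n w k' j')) =
    (fun n => Ex P (fun w => (\sum_s coef (Kbar m) j s * nsum (part k j s) n w) *
                   (\sum_s coef (Kbar m) j' s * nsum (part k' j' s) n w))).
  by apply/funext => n; congr (Ex P _); apply/funext => w; rewrite !umx0_part.
by apply: comb_cross_cvg => // s; exact: cvg_cst.
Qed.

(** The proof also shows that the [lim] in the definition of [Lambda] is a genuine limit. *)
Lemma Lambda_cvg a b : Ex P (fun w => vec (umx0 m n w) a 0 * vec (umx0 m n w) b 0) @[n --> \oo]
  --> Lambda m a b.
Proof.
case/mxvec_indexP: a => k j; case/mxvec_indexP: b => k' j'.
have [v [h h0]] := umx_cross_cvg k j k' j'.
rewrite mxE; have -> : (fun n => fine ('E_P[fun w => (vecu m n w (mxvec_index k j) 0 *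
    vecu m n w (mxvec_index k' j') 0)%R])%E) =
    (fun n => Ex P (fun w => umx m n w k j * umx m n w k' j')).
  apply/funext => n; rewrite fine_expectation; congr (Ex P _); apply/funext => w.
  by rewrite /vecu !vecE.
rewrite (cvg_lim _ h)//.
by under eq_fun do under eq_fun do rewrite !vecE.
Qed.

Definition functional_row (c : 'rV[R]_(p * q)) (i : nat) (w : T) : R :=
  \sum_a c 0 a * vec (\matrix_(k, j) urow k j i w) a 0.

Let vec_urow a : exists2 y, mrow_lin m y &
  forall i w, vec (\matrix_(k, j) urow k j i w) a 0 = y i w.
Proof.
case/mxvec_indexP: a => k j; exists (urow k j); first exact: urow_lin.
by move=> i w; rewrite vecE mxE.
Qed.

Lemma functional_row_lin c : mrow_lin m (functional_row c).
Proof.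
apply: row_lin_sum => a; apply: (row_linZ (cvg_cst _)).
have [y ly e] := vec_urow a.
by have -> : (fun i w => vec (\matrix_(k, j) urow k j i w) a 0) = y
  by apply/funext => i; apply/funext => w.
Qed.

Lemma functional_nsum c n w : (c *m vec (umx0 m n w)) 0 0 = nsum (functional_row c) n w.
Proof.
rewrite mxE /nsum /functional_row exchange_big/= mulr_sumr; apply: eq_bigr => a _.
rewrite -mulr_sumr mulrCA; congr (_ * _).
case/mxvec_indexP: a => k j; rewrite vecE umx0_nsum; congr (_ * _).
by apply: eq_bigr => i _; rewrite vecE mxE.
Qed.

(** The row variances have some limit v. The second moments of the normalized sums tend to v by
    Cesaro means and to c Lambda c' entry by entry, so the two agree. *)
Lemma functional_variance c :
  Ex P (fun w => functional_row c n w ^+ 2) @[n --> \oo] --> (c *m Lambda m *m c^T) 0 0.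
Proof.
have [v hv] := mrow_cross (functional_row_lin c) (functional_row_lin c).
have h1 := mrow_nsum_cvg (functional_row_lin c) (functional_row_lin c) hv.
have urow_vec a : exists2 y, mrow_lin m y & forall n w, vec (umx0 m n w) a 0 = nsum y n w.
  case/mxvec_indexP: a => k j; exists (urow k j); first exact: urow_lin.
  by move=> n w; rewrite vecE umx0_nsum.
have [y hy] := choice (fun a => let: ex_intro2 y l e := urow_vec a in
  ex_intro (fun y => mrow_lin m y /\ forall n w, vec (umx0 m n w) a 0 = nsum y n w) y (conj l e)).
have h2 : Ex P (fun w => nsum (functional_row c) n w * nsum (functional_row c) n w) @[n --> \oo] -->
    \sum_a \sum_b c 0 a * c 0 b * Lambda m a b.
  have -> : (fun n => Ex P (fun w => nsum (functional_row c) n w * nsum (functional_row c) n w)) =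
      (fun n => Ex P (fun w => (\sum_a c 0 a * nsum (y a) n w) * (\sum_a c 0 a * nsum (y a) n w))).
    apply/funext => n; congr (Ex P _); apply/funext => w; rewrite -functional_nsum mxE.
    by congr (_ * _); apply: eq_bigr => a _; have [_ ->] := hy a.
  apply: comb_cross_cvg => [a|a|a|a|a b]; [by have [] := hy a|by have [] := hy a|exact: cvg_cst|exact: cvg_cst|].
  have := @Lambda_cvg a b; have [_ ea] := hy a; have [_ eb] := hy b.
  by under eq_fun do under eq_fun do rewrite ea eb.
have <- : v = (c *m Lambda m *m c^T) 0 0.
  rewrite (cvg_unique _ h1 h2)//; rewrite [RHS]mxE.
  under [RHS]eq_bigr do rewrite mxE mulr_suml.
  rewrite exchange_big/=; apply: eq_bigr => a _; apply: eq_bigr => b _.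
  by rewrite [c^T _ _]mxE mulrAC.
by under eq_fun do under eq_fun do rewrite expr2.
Qed.

Lemma functional_clt (c : 'rV[R]_(p * q)) b :
  Ex P (fun w => cos (b + (c *m vec (umx0 m n w)) 0 0)) @[n --> \oo] -->
  cos b * expR (- (c *m Lambda m *m c^T) 0 0 / 2).
Proof.
have -> : (fun n => Ex P (fun w => cos (b + (c *m vec (umx0 m n w)) 0 0))) =
    (fun n => Ex P (fun w => cos (b + nsum (functional_row c) n w))).
  by apply/funext => n; congr (Ex P _); apply/funext => w; rewrite functional_nsum.
have := nsum_clt (measurable_errors m) (errors_independent Hm) (errors_L4 Hm)
  (errors_moment_eq Hm) (errors_law Hm) (functional_row_lin c) (@functional_variance c).
exact.
Qed.

Lemma Lambda_sym : (Lambda m)^T = Lambda m.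
Proof.
apply/matrixP => a b; rewrite mxE; have h := @Lambda_cvg a b.
apply: (cvg_unique _ (@Lambda_cvg b a)) => //.
apply: cvg_trans h; apply: near_eq_cvg; near=> n; congr (Ex P _).
by apply/funext => w; rewrite mulrC.
Unshelve. all: by end_near. Qed.

Lemma Lambda_ge0 (c : 'rV[R]_(p * q)) : 0 <= (c *m Lambda m *m c^T) 0 0.
Proof.
apply: (cvgr_to_ge (@functional_variance c)); near=> n.
by apply: Ex_ge0 => w; exact: sqr_ge0.
Unshelve. all: by end_near. Qed.

End LimitCovariance.

(** * Estimation errors *)

Section EstimatorAlgebra.
Context {d : measure_display} {T : measurableType d} {R : realType}.
Context {P : probability T R} {p q : nat}.
Variable m : eiv_model P p q.

Local Notation B := (regB m).

Lemma smpM_sym n : (n%:R^-1 *: ((smpM m n)^T *m smpM m n))^T = n%:R^-1 *: ((smpM m n)^T *m smpM m n).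
Proof. by rewrite linearZ/= trmx_mul trmxK. Qed.

Lemma SigmaX_sym n : (SigmaX m n)^T = SigmaX m n.
Proof. by rewrite /SigmaX !linearD/= smpM_sym !tr_scalar_mx. Qed.

Lemma devH_sym n w : (devH m n w)^T = devH m n w.
Proof. by rewrite /devH linearB/= !linearZ/= SigmaX_sym /gramX trmx_mul trmxK. Qed.

Lemma KXbar_tr n : SigmaX m n \in unitmx -> (KXbar m n)^T = 1%:M - KX m n.
Proof.
move=> Su; rewrite /KXbar SigmaXD trmx_mul tr_scalar_mx trmx_inv SigmaX_sym -(SigmaXD m n).
by rewrite mulmxBr mulVmx.
Qed.

(** Transposition turns [KXbar] into I - K_X; then the centring term of h and the one coming from H
    are opposite and cancel. *)
Lemma umxE n w : SigmaX m n \in unitmx ->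
  umx m n w = (@rootn R n)^-1 *: ((smpX m n w)^T *m (smpE m n w - smpDelta m n w *m B)
    + gramX m n w *m (1%:M - KX m n) *m B).
Proof.
move=> Su; rewrite /umx linearD/= trmxK [(_ *m devH m n w)^T]trmx_mul [(_ *m KXbar m n)^T]trmx_mul trmxK.
rewrite devH_sym KXbar_tr//.
rewrite mulmxA /devH mulmxBl -!scalemxAl.
have -> : SigmaX m n *m (1%:M - KX m n) = (sig_del m ^+ 2)%:M.
  by rewrite mulmxBr mulmx1 mulKVmx// SigmaXD.
rewrite mulmxBl -!scalemxAl mul_scalar_mx /devh scalerDr addrACA [in X in _ + X]addrC.
by rewrite addNr addr0.
Qed.

Let cancel_mx a b (G K : 'M[R]_p) (A : 'M[R]_(p, a)) (Z : 'M[R]_(a, b)) :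
  G \in unitmx -> K \in unitmx -> G *m K *m (invmx K *m invmx G *m A *m Z) = A *m Z.
Proof. by move=> Gu Ku; rewrite -!mulmxA mulKVmx// mulKVmx. Qed.

Lemma Bhat1_error n w : (0 < n)%N -> SigmaX m n \in unitmx -> KX m n \in unitmx ->
  gramX m n w \in unitmx ->
  @rootn R n *: (Bhat1 m n w - B) = invmx (scaled_gram m n w *m KX m n) *m umx m n w.
Proof.
move=> n0 Su Ku Gu; have n1 : n%:R^-1 \is a @GRing.unit R by rewrite unitfE invr_eq0 pnatr_eq0 -lt0n.
have Qu : scaled_gram m n w *m KX m n \in unitmx.
  by rewrite unitmx_mul Ku /scaled_gram unitmxZ// Gu.
apply: (canRL (mulKmx Qu)); rewrite umxE//.
rewrite /scaled_gram -scalemxAl -scalemxAr -!scalemxAl scalerA rootn_divn; congr (_ *: _).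
rewrite mulmxBr.
have -> : gramX m n w *m KX m n *m Bhat1 m n w = (smpX m n w)^T *m smpZ m n w.
  exact: cancel_mx.
(* The regression rewritten in terms of the observed X, with composite error E - Delta B. *)
have -> : smpZ m n w = smpX m n w *m B + (smpE m n w - smpDelta m n w *m B).
  by rewrite /smpZ /smpX [in RHS]mulmxDl -addrA [X in _ = _ + X]addrC subrK.
rewrite mulmxDr mulmxA -/(gramX m n w) [gramX m n w *m (1%:M - _)]mulmxBr mulmx1 mulmxBl.
by rewrite [X in X - _]addrC -addrA.
Qed.

Section Restricted.
Variables (r1 r2 : nat) (R1 : 'M[R]_(r1, p)) (R2 : 'M[R]_(q, r2)) (theta : 'M[R]_(r1, r2)).
Hypothesis Htheta : R1 *m B *m R2 = theta.

(** When the inner inverse exists, the projection onto the range of W R1' along the kernel of R1. *)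
Definition oblique (W : 'M[R]_p) : 'M[R]_p := W *m R1^T *m invmx (R1 *m W *m R1^T) *m R1.

(** Scale invariance lets X'X be replaced by X'X/n, which converges. *)
Lemma obliqueZ a W : a \is a GRing.unit -> R1 *m W *m R1^T \in unitmx ->
  oblique (a *: W) = oblique W.
Proof.
move=> au Wu; rewrite /oblique -scalemxAr -!scalemxAl.
by rewrite invmxZ ?unitmxZ// -!scalemxAr -!scalemxAl scalerA mulrV// scale1r.
Qed.

(** The restriction turns R1 b R2 - theta into R1 (b - B) R2. *)
Lemma restricted_error (W : 'M[R]_p) (b : 'M[R]_(p, q)) (c : R) :
  c *: (b - W *m R1^T *m invmx (R1 *m W *m R1^T) *m (R1 *m b *m R2 - theta)
          *m invmx (R2^T *m R2) *m R2^T - B) =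
  c *: (b - B) - oblique W *m (c *: (b - B)) *m P2 R2.
Proof.
rewrite -Htheta -mulmxBl -mulmxBr addrAC scalerBr; congr (_ - _).
by rewrite /oblique /P2 -scalemxAr -scalemxAl !mulmxA.
Qed.

(** Weight 0 stands for the unrestricted estimator, and the choice W = I for the fourth. *)
Definition weight n w : 'I_4 -> 'M[R]_p := tnth [tuple 0;
  oblique (invmx (scaled_gram m n w *m KX m n)); oblique (invmx (scaled_gram m n w)); oblique 1%:M].

Lemma Bhat_error n w i : (0 < n)%N -> SigmaX m n \in unitmx -> KX m n \in unitmx ->
  gramX m n w \in unitmx -> R1 *m invmx (gramX m n w *m KX m n) *m R1^T \in unitmx ->
  R1 *m invmx (gramX m n w) *m R1^T \in unitmx ->
  @rootn R n *: (Bhat m n R1 R2 theta i w - B) =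
  invmx (scaled_gram m n w *m KX m n) *m umx m n w -
  weight n w i *m (invmx (scaled_gram m n w *m KX m n) *m umx m n w) *m P2 R2.
Proof.
move=> n0 Su Ku Gu R1u R1u'; rewrite -Bhat1_error//.
have nu : n%:R \is a @GRing.unit R by rewrite unitfE pnatr_eq0 -lt0n.
have nu' : n%:R^-1 \is a @GRing.unit R by rewrite unitrV.
case: i => [[|[|[|[|//]]]] ?]; rewrite /Bhat /weight !(tnth_nth 0)/=.
- by rewrite !mul0mx subr0.
- have -> : oblique (invmx (scaled_gram m n w *m KX m n)) = oblique (invmx (gramX m n w *m KX m n)).
    have GKu : gramX m n w *m KX m n \in unitmx by rewrite unitmx_mul Gu.
    by rewrite /scaled_gram -scalemxAl invmxZ ?unitmxZ// invrK obliqueZ.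
  exact: restricted_error.
- have -> : oblique (invmx (scaled_gram m n w)) = oblique (invmx (gramX m n w)).
    by rewrite /scaled_gram invmxZ ?unitmxZ// invrK obliqueZ.
  exact: restricted_error.
- have := restricted_error 1%:M (Bhat1 m n w) (@rootn R n).
  by rewrite !mul1mx !mulmx1.
Qed.

Definition weight_lim : 'I_4 -> 'M[R]_p := tnth [tuple 0;
  oblique (invmx (Sigmalim m *m Klim m)); oblique (invmx (Sigmalim m)); oblique 1%:M].

Definition limit_map (i : 'I_4) (U : 'M[R]_(p, q)) : 'M[R]_(p, q) :=
  invmx (Sigmalim m *m Klim m) *m U
  - weight_lim i *m (invmx (Sigmalim m *m Klim m) *m U) *m P2 R2.

Lemma P2_sym : (P2 R2)^T = P2 R2.
Proof. by rewrite /P2 !trmx_mul trmxK trmx_inv trmx_mul trmxK mulmxA. Qed.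

Lemma vec_limit_map i U : vec (limit_map i U) = Ablk m R1 R2 i *m vec U.
Proof.
have e1 : vec (invmx (Sigmalim m *m Klim m) *m U) = A1 m *m vec U.
  by rewrite /A1 -[X in vec X]mulmx1 vec_mulmx trmx1.
have e2 W : vec (W *m (invmx (Sigmalim m *m Klim m) *m U) *m P2 R2) =
    ((W *m invmx (Sigmalim m *m Klim m)) *t P2 R2) *m vec U.
  by rewrite mulmxA vec_mulmx P2_sym.
rewrite /limit_map vecB e1 e2 /Ablk /weight_lim.
case: i => [[|[|[|[|//]]]] ?]; rewrite !(tnth_nth 0)/=.
- by rewrite mul0mx tens0mx mul0mx subr0.
- by rewrite /A2 mulmxBl.
- by rewrite /A3 mulmxBl.
- by rewrite /A4 mulmxBl /oblique mul1mx mulmx1.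
Qed.

Hypothesis Hm : eiv_assumptions m.
Hypothesis Hinv : inverses_exist m R1 R2.

Let Su := Sigma_unit Hinv.

Lemma unscaled_gram_inv_cvg : mcvg (asym P) (fun x => invmx (scaled_gram m x.1 x.2)) (invmx (Sigmalim m)).
Proof. apply: mcvgV => //; exact: scaled_gram_cvg. Qed.

Lemma coefficient_cvg : mcvg (asym P) (fun x => invmx (scaled_gram m x.1 x.2 *m KX m x.1))
  (invmx (Sigmalim m *m Klim m)).
Proof.
apply: mcvgV; last exact: SigmaK_unit Hinv.
apply: mcvgM; first exact: scaled_gram_cvg.
by apply: mcvg_fst; exact: KX_cvg.
Qed.

Lemma oblique_cvg (W : nat * T -> 'M[R]_p) (W0 : 'M[R]_p) : mcvg (asym P) W W0 ->
  R1 *m W0 *m R1^T \in unitmx -> mcvg (asym P) (fun x => oblique (W x)) (oblique W0).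
Proof.
move=> WW u.
have WR : mcvg (asym P) (fun x => W x *m R1^T) (W0 *m R1^T).
  by apply: mcvgM => //; exact: mcvg_cst.
apply: mcvgM; last exact: mcvg_cst.
apply: mcvgM => //; apply: mcvgV => //.
apply: mcvgM; last exact: mcvg_cst.
by apply: mcvgM => //; exact: mcvg_cst.
Qed.

Lemma weight_cvg i : mcvg (asym P) (fun x => weight x.1 x.2 i) (weight_lim i).
Proof.
pose W x := [:: 0; oblique (invmx (scaled_gram m x.1 x.2 *m KX m x.1));
  oblique (invmx (scaled_gram m x.1 x.2)); oblique 1%:M].
have -> : (fun x => weight x.1 x.2 i) = fun x : nat * T => nth 0 (W x) i.
  by apply/funext => x; rewrite /weight (tnth_nth 0).
rewrite /weight_lim (tnth_nth 0).
case: i => [[|[|[|[|//]]]] ?]; rewrite /W/=.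
- exact: mcvg_cst.
- by apply: oblique_cvg; [exact: coefficient_cvg|exact: R1_SigmaK_unit Hinv].
- by apply: oblique_cvg; [exact: unscaled_gram_inv_cvg|exact: R1_Sigma_unit Hinv].
- exact: mcvg_cst.
Qed.

(** Here a is the scaled first error, b its limiting form and F, F0 the weights: the difference of
    two restricted errors is expressed through a - b and F - F0, both of which tend to 0. *)
Let error_diff (F F0 : 'M[R]_p) (a b : 'M[R]_(p, q)) (Q : 'M[R]_q) :
  (a - b) - (F *m (a - b) *m Q + (F - F0) *m (b *m Q)) = a - F *m a *m Q - (b - F0 *m b *m Q).
Proof.
rewrite mulmxBr !mulmxBl !mulmxA addrA subrK !opprB addrACA [RHS]addrACA.
by congr (_ + _); exact: addrC.
Qed.

(** The exact error formula needs the inverses, so it is used near [asym] only; there the difference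
    is a combination of products with one factor tending to 0 and the others convergent or bounded
    in probability. *)
Lemma error_cvg0 i : mcvg (asym P)
  (fun x => @rootn R x.1 *: (Bhat m x.1 R1 R2 theta i x.2 - B) - limit_map i (umx0 m x.1 x.2)) 0.
Proof.
pose C x := invmx (scaled_gram m x.1 x.2 *m KX m x.1).
pose S := invmx (Sigmalim m *m Klim m).
pose D x := C x *m umx m x.1 x.2 - S *m umx0 m x.1 x.2.
have tU0 := umx0_tight Hm.
have D0 : mcvg (asym P) D 0.
  have -> : D = fun x => (C x - S) *m umx m x.1 x.2 + S *m (umx m x.1 x.2 - umx0 m x.1 x.2).
    by apply/funext => x; rewrite /D mulmxBl mulmxBr addrA subrK.
  rewrite -[X in mcvg _ _ X]addr0; apply: mcvgD.
    apply: mcvg0_mtightM.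
      by rewrite -(subrr S); apply: mcvgB; [exact: coefficient_cvg|exact: mcvg_cst].
    have -> : (fun x => umx m x.1 x.2) =
        fun x : nat * T => umx0 m x.1 x.2 + (umx m x.1 x.2 - umx0 m x.1 x.2).
      by apply/funext => x; rewrite addrC subrK.
    by apply: mtightD => //; apply: mcvg0_mtight; exact: umx_sub_cvg0.
  rewrite -[X in mcvg _ _ X](mulmx0 _ S); apply: mcvgM; first exact: mcvg_cst.
  exact: umx_sub_cvg0.
apply: (@mcvg_near _ _ _ _ _ _ (fun x => D x - (weight x.1 x.2 i *m D x *m P2 R2 +
    (weight x.1 x.2 i - weight_lim i) *m ((S *m umx0 m x.1 x.2) *m P2 R2)))).
  have h0 := @asym_fst _ _ _ P [set n | 0 < n]%N (nbhs_infty_gt 0).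
  have h1 := @asym_fst _ _ _ P _ (SigmaX_unit Hinv).
  have h2 := @asym_fst _ _ _ P _ (KX_unit Hinv).
  have h3 := asym_ae (gramX_unit Hinv).
  have h4 := asym_ae (R1_gramXKX_unit Hinv).
  have h5 := asym_ae (R1_gramX_unit Hinv).
  near=> x.
  rewrite Bhat_error; [|by near: x..].
  exact: error_diff.
rewrite -[X in mcvg _ _ X](subrr 0); apply: mcvgB => //.
rewrite -[X in mcvg _ _ X](addr0 0); apply: mcvgD.
  rewrite -[X in mcvg _ _ X](mul0mx _ (P2 R2)); apply: mcvgM; last exact: mcvg_cst.
  rewrite -[X in mcvg _ _ X](mulmx0 _ (weight_lim i)); apply: mcvgM => //.
  exact: weight_cvg.
apply: mcvg0_mtightM; last by apply: mtightMr; exact: mtightMl.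
rewrite -(subrr (weight_lim i)); apply: mcvgB; [exact: weight_cvg|exact: mcvg_cst].
Unshelve. all: by end_near. Qed.

End Restricted.

End EstimatorAlgebra.

(** * The four estimation errors together *)

Section Assembly.
Context {d : measure_display} {T : measurableType d} {R : realType}.
Context {P : probability T R} {p q r1 r2 : nat}.
Variable m : eiv_model P p q.
Variables (R1 : 'M[R]_(r1, p)) (R2 : 'M[R]_(q, r2)) (theta : 'M[R]_(r1, r2)).

Lemma random_array a b (f : 'I_a -> 'I_b -> {RV P >-> R}) :
  random_mx (fun w => \matrix_(i, j) f i j w : 'M[R]_(a, b)).
Proof. by move=> i j; under eq_fun do rewrite mxE; exact: measurable_funPT. Qed.

Lemma random_smpX n : random_mx (smpX m n).
Proof.
apply: random_mxD; last exact: random_array.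
by apply: random_mxD; [exact: random_mx_cst|exact: random_array].
Qed.

Lemma random_gramX n : random_mx (gramX m n).
Proof. by apply: random_mxM; [apply: random_mxT|]; exact: random_smpX. Qed.

Lemma random_Bhat1 n : random_mx (Bhat1 m n).
Proof.
apply: random_mxM.
  apply: random_mxM; last by apply: random_mxT; exact: random_smpX.
  by apply: random_mxM; [exact: random_mx_cst|apply: random_mxV; exact: random_gramX].
apply: random_mxD; last exact: random_array.
apply: random_mxM; last exact: random_mx_cst.
by apply: random_mxD; [exact: random_mx_cst|exact: random_array].
Qed.

Lemma random_restricted n (W : T -> 'M[R]_p) : random_mx W ->
  random_mx (fun w => Bhat1 m n w - W w *m R1^T *m invmx (R1 *m W w *m R1^T)
    *m (R1 *m Bhat1 m n w *m R2 - theta) *m invmx (R2^T *m R2) *m R2^T).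
Proof.
move=> mW; apply: random_mxD; first exact: random_Bhat1.
apply: random_mxN; do 2![apply: random_mxM; last exact: random_mx_cst].
have c a b (A : 'M[R]_(a, b)) : random_mx (fun=> A : 'M[R]_(a, b)) (T := T) by exact: random_mx_cst.
apply: random_mxM.
  apply: random_mxM; first exact: random_mxM.
  by apply: random_mxV; apply: random_mxM => //; exact: random_mxM.
apply: random_mxD => //; apply: random_mxM => //; apply: random_mxM => //.
exact: random_Bhat1.
Qed.

Lemma random_Bhat n i : random_mx (Bhat m n R1 R2 theta i).
Proof.
have -> : Bhat m n R1 R2 theta i = fun w =>
    nth 0 [:: Bhat1 m n w; Bhat2 m n R1 R2 theta w; Bhat3 m n R1 R2 theta w; Bhat4 m n R1 R2 theta w] i.
  by apply/funext => w; rewrite /Bhat (tnth_nth 0).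
case: i => [[|[|[|[|//]]]] ?] /=.
- exact: random_Bhat1.
- apply: random_restricted; apply: random_mxV; apply: random_mxM; first exact: random_gramX.
  exact: random_mx_cst.
- by apply: random_restricted; apply: random_mxV; exact: random_gramX.
- have := random_restricted n (random_mx_cst 1%:M).
  rewrite (_ : (fun w => _) = Bhat4 m n R1 R2 theta)//.
  by apply/funext => w; rewrite mul1mx mulmx1.
Qed.

Lemma random_stacked_errors n : random_mx (stacked_errors m n R1 R2 theta).
Proof.
move=> s j; under eq_fun do rewrite mxE.
apply: random_mxZ; apply: random_mxD; last exact: random_mx_cst.
exact: random_Bhat.
Qed.

Lemma castmx_mull a a' b c (e : a = a') (A : 'M[R]_(a, b)) (A' : 'M[R]_(b, c)) :
  castmx (e, erefl c) (A *m A') = castmx (e, erefl b) A *m A'.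
Proof. by case: a' / e; rewrite !castmx_id. Qed.

Lemma castmx_congruence a a' b (e : a = a') (A : 'M[R]_(a, b)) (L : 'M[R]_b) :
  castmx (e, e) (A *m L *m A^T) = castmx (e, erefl b) A *m L *m (castmx (e, erefl b) A)^T.
Proof. by case: a' / e; rewrite !castmx_id. Qed.

Definition stacked_map : 'M[R]_((\sum_(i < 4) p) * q, p * q) :=
  castmx (@stacked_dim p q, erefl (p * q)%N) (\mxcol_(i < 4) Ablk m R1 R2 i).

Lemma limit_covarianceE :
  limit_covariance m R1 R2 = stacked_map *m Lambda m *m stacked_map^T.
Proof.
rewrite /stacked_map -castmx_congruence tr_mxcol mxcol_mul mul_mxcol_mxrow.
by [].
Qed.

Lemma vec_stacked_map (U : 'M[R]_(p, q)) :
  vec (\mxcol_(i < 4) limit_map m R1 R2 i U) = stacked_map *m vec U.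
Proof.
rewrite (vec_mxcol _ (@stacked_dim p q)) /stacked_map -castmx_mull mxcol_mul.
by congr (castmx _ _); apply: eq_mxcol => i; exact: vec_limit_map.
Qed.

Hypothesis Hm : eiv_assumptions m.
Hypothesis Hinv : inverses_exist m R1 R2.
Hypothesis Htheta : R1 *m regB m *m R2 = theta.

Let Su := Sigma_unit Hinv.

Lemma psd_limit_covariance : psd (limit_covariance m R1 R2).
Proof.
rewrite limit_covarianceE; split.
  by rewrite !trmx_mul trmxK Lambda_sym// mulmxA.
by move=> c; rewrite !mulmxA -mulmxA -trmx_mul; exact: Lambda_ge0.
Qed.

Definition limit_errors n (w : T) : 'M[R]_(\sum_(i < 4) p, q) :=
  \mxcol_(i < 4) limit_map m R1 R2 i (umx0 m n w).

Lemma stacked_errors_cvg0 :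
  mcvg (asym P) (fun x => stacked_errors m x.1 R1 R2 theta x.2 - limit_errors x.1 x.2) 0.
Proof.
move=> s j; rewrite mxE.
have h := error_cvg0 Htheta Hm Hinv; have := @h (tagnat.sig1 s) (tagnat.sig2 s) j.
rewrite mxE; apply: cvg_trans; apply: near_eq_cvg; apply: nearW => x.
by rewrite /stacked_errors /limit_errors -mxcolB [RHS]mxE.
Qed.

Lemma limit_errors_tight : mtight P (fun x => limit_errors x.1 x.2).
Proof.
move=> s j; have tU := umx0_tight Hm.
have := mtightD (mtightMl (invmx (Sigmalim m *m Klim m)) tU)
  (mtightMr (- P2 R2) (mtightMl (weight_lim m R1 (tagnat.sig1 s))
    (mtightMl (invmx (Sigmalim m *m Klim m)) tU))) (tagnat.sig2 s) j.
congr tight; apply/funext => x; rewrite [RHS]mxE.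
by congr (fun_of_matrix _ _ _); rewrite /limit_map mulmxN.
Qed.

Lemma stacked_errors_tight : mtight P (fun x => stacked_errors m x.1 R1 R2 theta x.2).
Proof.
have := mtightD limit_errors_tight (mcvg0_mtight stacked_errors_cvg0).
by congr mtight; apply/funext => x; rewrite addrC subrK.
Qed.

Lemma cos_lipschitz (x y : R) : `|cos x - cos y| <= `|x - y|.
Proof.
have := @MVT_bound R (fun t => cos (y + t) - cos y) (fun t => - sin (y + t)) 1 (x - y).
rewrite mul1r [y + (x - y)]addrC subrK; apply.
- by move=> t; apply: is_derive_eq; rewrite add0r mulr1 subr0.
- by rewrite addr0 subrr.
- by move=> t _; rewrite normrN; exact: sin_max.
Qed.

(** The cosine is 1-Lipschitz, so the errors may be replaced by the linear image of [umx0], and the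
    cosine limit applies to the functional t [stacked_map]. *)
Lemma trig_stacked_errors b (t : 'rV[R]_((\sum_(i < 4) p) * q)) :
  Ex P (fun w => cos (b + (t *m vec (stacked_errors m n R1 R2 theta w)) 0 0)) @[n --> \oo] -->
  cos b * expR (- (t *m limit_covariance m R1 R2 *m t^T) 0 0 / 2).
Proof.
have -> : t *m limit_covariance m R1 R2 *m t^T =
    (t *m stacked_map) *m Lambda m *m (t *m stacked_map)^T.
  by rewrite limit_covarianceE trmx_mul !mulmxA.
have clt := @functional_clt _ _ _ _ _ _ _ Hm Su (t *m stacked_map) b.
have lin (V : 'cV[R]_((\sum_(i < 4) p) * q)) : (t *m V) 0 0 = \sum_s t 0 s * V s 0 by rewrite mxE.
have mS n : measurable_fun setT (fun w => (t *m vec (stacked_errors m n R1 R2 theta w)) 0 0).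
  under eq_fun do rewrite lin; apply: measurable_sum => s; apply: measurable_funM => //.
  by case/mxvec_indexP: s => r j; under eq_fun do rewrite vecE; exact: random_stacked_errors.
have mU n : measurable_fun setT (fun w => (t *m stacked_map *m vec (umx0 m n w)) 0 0).
  under eq_fun do rewrite functional_nsum.
  exact: (nsum_measurable (measurable_errors m) n (functional_row_lin Hm _)).
apply: cvg_sub0 clt.
apply: (@Ex_asym_diff _ _ _ P _ _ (fun x =>
  (t *m vec (stacked_errors m x.1 R1 R2 theta x.2 - limit_errors x.1 x.2)) 0 0) 1).
- by move=> n; exact: measurable_cosD.
- by move=> n; exact: measurable_cosD.
- by move=> n w; exact: cos_max.
- by move=> n w; exact: cos_max.
- have : \sum_s t 0 s * vec (stacked_errors m x.1 R1 R2 theta x.2 - limit_errors x.1 x.2) s 0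
      @[x --> asym P] --> \sum_(s < (\sum_(i < 4) p) * q) t 0 s * 0.
    apply: cvg_bigsum => s; apply: cvgM; first exact: cvg_cst.
    case/mxvec_indexP: s => r j; have := @stacked_errors_cvg0 r j; rewrite mxE.
    by apply: cvg_trans; apply: near_eq_cvg; apply: nearW => x; rewrite vecE.
  have -> : \sum_(s < (\sum_(i < 4) p) * q) t 0 s * 0 = 0.
    by apply: big1 => s _; rewrite mulr0.
  by apply: cvg_trans; apply: near_eq_cvg; apply: nearW => x; rewrite lin.
- move=> n w; apply: le_trans (cos_lipschitz _ _) _.
  rewrite opprD addrACA subrr add0r vecB mulmxBr /limit_errors vec_stacked_map mulmxA.
  by rewrite [in leRHS]mxE [X in _ <= `|_ + X|]mxE.
Qed.

End Assembly.

Lemma continuous_vec_mx (R : realType) a b : continuous (@vec_mx R a b).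
Proof.
move=> v A /nbhs_ballP[e /= e0 vA]; apply/nbhs_ballP; exists e => // y [_ vy].
by apply: vA; split=> // i j; rewrite !mxE; exact: vy.
Qed.

Theorem corollary3p1 (R : realType) (d : measure_display)
    (T : measurableType d) (P : probability T R) (p q r1 r2 : nat)
    (m : eiv_model P p q) (R1 : 'M[R]_(r1, p)) (R2 : 'M[R]_(q, r2))
    (theta : 'M[R]_(r1, r2))
    (Hm : eiv_assumptions m)
    (HX : \forall n \near \oo, {ae P, forall w, \rank (smpX m n w) = p})
    (HR1 : \rank R1 = r1) (HR2 : \rank R2 = r2)
    (Hinv : inverses_exist m R1 R2)
    (Htheta : R1 *m regB m *m R2 = theta) :
  exists (d' : measure_display) (T' : measurableType d')
    (P' : probability T' R) (Y : T' -> 'M[R]_(\sum_(i < 4) p, q)),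
    matrix_normal P' Y 0 (limit_covariance m R1 R2) /\
    converges_in_distribution P P'
      (fun n => stacked_errors m n R1 R2 theta) Y.
Proof.
have psdO := psd_limit_covariance Hm Hinv.
have [d' [T' [P' [V gV]]]] := gaussian_vector_exists psdO.
have normV := gaussian_multivariate_normal psdO gV.
have mV i : measurable_fun setT (fun w => V w i 0) by have [h _ _ _] := normV; exact: h.
pose Y w := vec_mx (V w)^T.
have vecY w : vec (Y w) = V w by rewrite /vec /Y vec_mxK trmxK.
have mY : random_mx Y.
  by move=> i j; have := mV (mxvec_index i j); under eq_fun do rewrite -vecY vecE.
have mS := random_stacked_errors m R1 R2 theta.
exists d', T', P', Y; split.
  rewrite /matrix_normal (_ : vec 0 = 0); last by rewrite /vec !linear0.
  by rewrite (_ : (fun w => vec (Y w)) = V)//; apply/funext.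
split=> // f cf [C fC].
have mxvec_measurable d0 (T0 : measurableType d0) (Z : T0 -> 'M[R]_(\sum_(i < 4) p, q)) :
    random_mx Z -> forall s, measurable_fun setT (fun w => mxvec (Z w) 0 s).
  by move=> mZ; case/mxvec_indexP=> i j; under eq_fun do rewrite mxvecE; exact: mZ.
(* The test function is moved to row vectors, where the passage from cosines to continuous functions
   is stated. *)
have cfv : continuous (f \o vec_mx).
  by move=> v; apply: continuous_comp; [exact: continuous_vec_mx|exact: cf].
have fvC v : `|(f \o vec_mx) v| <= C by exact: fC.
have L1f d0 (T0 : measurableType d0) (P0 : probability T0 R) (Z : T0 -> 'M[R]_(\sum_(i < 4) p, q)) :
    random_mx Z -> L1 P0 (fun w => f (Z w)).
  move=> mZ; apply: (@L1_bounded _ _ _ P0 _ C) => //.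
  have := continuous_rV_measurable cfv fvC (mxvec_measurable _ _ _ mZ).
  by congr measurable_fun; apply/funext => w /=; rewrite mxvecK.
rewrite (expectationE (L1f _ _ P' _ mY)).
under eq_fun do rewrite (expectationE (L1f _ _ P _ (mS _))).
apply: cvg_EFin; first by apply: nearW.
have := @trig_cvg_distribution R _ _ P _ _ P' _ (fun n w => mxvec (stacked_errors m n R1 R2 theta w))
  (fun w => mxvec (Y w)) (f \o vec_mx) C _ _ _ _ _ cfv fvC.
rewrite (_ : (f \o vec_mx) \o (fun w => mxvec (Y w)) = fun w => f (Y w)); last first.
  by apply/funext => w /=; rewrite mxvecK.
rewrite (_ : (fun n => Ex P ((f \o vec_mx) \o _)) =
    fine \o (fun n => (Ex P (fun w => f (stacked_errors m n R1 R2 theta w)))%:E)); last first.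
  by apply/funext => n /=; congr (Ex P _); apply/funext => w /=; rewrite mxvecK.
apply.
- by move=> n s; exact: mxvec_measurable.
- by move=> s; exact: mxvec_measurable.
- case/mxvec_indexP=> i j; have := stacked_errors_tight Hm Hinv Htheta i j.
  by congr tight; apply/funext => x; rewrite mxvecE.
- case/mxvec_indexP=> i j; have [+ _] := gaussian_coord_sqr psdO gV (mxvec_index i j).
  by congr L1; apply/funext => w; rewrite mxvecE -vecY vecE.
move=> b t.
have -> : Ex P' (fun w => cos (b + (t *m (mxvec (Y w))^T) 0 0)) =
    cos b * expR (- (t *m limit_covariance m R1 R2 *m t^T) 0 0 / 2).
  rewrite -(gauss_characteristic b (psdO.2 t) (gV t)); congr (Ex P' _).
  by apply/funext => w; rewrite -/(vec (Y w)) vecY.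
exact: trig_stacked_errors.
Qed.
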